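(* Let $G=(\mathbb V,E)$ be a transitive locally-finite connected graph on a countable vertex set, and let $\omega\in\{0,1\}^E$ be a random percolation process on $G$ which almost surely has a unique infinite cluster. Let $q\ge2$ be an integer and let $\sigma\in\{0,\dots,q-1\}^{\mathbb V}$ be the random spin configuration such that, conditionally on $\omega$: spins of vertices in the same cluster are equal, spins of different clusters are independent, the spin of each finite cluster is uniform on $\{0,\dots,q-1\}$, and the spin of the infinite cluster is $0$. Let $\nabla\sigma$ be defined by $(\nabla\sigma)_{(u,v)}=\sigma_v-\sigma_u \bmod q$ for oriented edges $(u,v)$ of $G$. Then $\nabla\sigma$ is a finitary factor of $(\omega,\xi)$, where $\xi$ is an i.i.d. process independent of $\omega$. In particular, if $\omega$ is ffiid, then so is $\nabla\sigma$. Moreover, if $\omega$ is ffiid with a coding radius having exponential tails and there exist constants $c,c',a>0$ such that for all $u\in\mathbb V$ and $r\ge1$, $$\mathbb P(r\le\operatorname{diam}C_u<\infty)+\mathbb P(\mathrm{dist}(C_u,C_\infty)\ge r)+\mathbb P(L_{u,r}\ge ar)\le c'e^{-cr},$$ then $\nabla\sigma$ is ffiid with a coding radius having exponential tails.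
   Context: Clusters of $\omega$ are the connected components of the graph $(\mathbb V,\{e\in E:\omega_e=1\})$. $C_u$ is the cluster containing $u$ and $C_\infty$ is the unique infinite cluster. $\mathrm{dist}$ and $\operatorname{diam}$ are with respect to the graph distance of $G$; the distance between two sets is the minimal distance between their vertices. $L_{u,r}$ is the minimal $\ell\ge r$ such that any two vertices $v,w\in C_\infty$ contained in the ball of radius $r$ around $u$ are connected in $\omega$ within the ball of radius $\ell$ around $u$. Finitary factors: let $\Gamma$ be the automorphism group of $G$, acting naturally on vertices, edges and oriented edges. Let $X=(X_i)_{i\in I}$ and $Y=(Y_j)_{j\in J}$ be $\Gamma$-invariant processes, each indexed by vertices and/or (oriented) edges of $G$. $X$ is a finitary factor of $Y$ if there is a measurable map $\varphi$ commuting with the action of $\Gamma$ such that $\varphi(Y)$ has the law of $X$ and, for each $i\in I$, the coding radius at $i$ is almost surely finite. The coding radius at $i$ is the minimal $r\ge0$ such that $\varphi(y')_i=\varphi(Y)_i$ for all $y'$ agreeing with $Y$ on the ball of radius $r$ around $i$ (around a fixed endpoint, if $i$ is an edge), with value $\infty$ if no such $r$ exists. $X$ is ffiid if it is a finitary factor of some i.i.d. process indexed by the vertices of $G$ (with values in an arbitrary measurable space); an i.i.d. process $\xi$ in the statement is also indexed by the vertices of $G$. ''Coding radius having exponential tails'' means that for each $i$ there are $C,c>0$ such that the coding radius $R$ at $i$ satisfies $\mathbb P(R\ge r)\le Ce^{-cr}$ for all $r\geq 0$. *)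

(* Defs.v *)
From HB Require Import structures.
From mathcomp Require Import all_boot all_order all_algebra finmap.
From mathcomp Require Import all_classical all_reals all_analysis.

Set Implicit Arguments.
Unset Strict Implicit.
Unset Printing Implicit Defensive.
Import Order.TTheory GRing.Theory Num.Theory.
Import numFieldNormedType.Exports.

Local Open Scope classical_set_scope.
Local Open Scope ring_scope.

(* Ordinals, and hence 'Z_q, come with no sigma-algebra; as for bool and nat,
   take the discrete one. *)
HB.instance Definition _ n := isPointed.Build 'I_n.+1 ord0.
HB.instance Definition _ n := @isMeasurable.Build default_measure_display
  'I_n.+1 discrete_measurable discrete_measurable0
  discrete_measurableC discrete_measurableU.

(* The space of functions I -> T with the product sigma-algebra. *)
Definition cylinders (I : Type) d (T : measurableType d) : set (set (I -> T)) :=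
  [set A | exists i B, measurable B /\ A = [set x | B (x i)]].

Definition pspace (I : Type) d (T : measurableType d) :=
  g_sigma_algebraType (@cylinders I d T).

HB.instance Definition _ I d (T : measurableType d) := Pointed.on (pspace I T).
HB.instance Definition _ I d (T : measurableType d) :=
  @isMeasurable.Build (sigma_display (@cylinders I d T)) (pspace I T)
    <<s @cylinders I d T >> (@sigma_algebra0 _ setT _) (@sigma_algebraC _ _)
    (@sigma_algebra_bigcup _ setT _).

Section Graphs.
Variables (V : countType) (e : rel V).

Definition walk (n : nat) (u v : V) : Prop :=
  exists p, [/\ path e u p, last u p = v & size p = n].

Definition graph_connected : Prop := forall u v, exists n, walk n u v.

Definition locally_finite_graph : Prop :=
  forall u, finite_set [set v | e u v].

(* The graph distance; its value is junk (0) when there is no walk. *)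
Definition gdist (u v : V) : nat :=
  xget 0%N [set n | walk n u v /\ forall m, walk m u v -> (n <= m)%N].

Definition gball (u : V) (r : nat) : set V := [set v | (gdist u v <= r)%N].

Record aut := Aut {
  aut_fun :> V -> V ;
  aut_bij : bijective aut_fun ;
  aut_adj : forall u v, e (aut_fun u) (aut_fun v) = e u v }.

Definition transitive_graph : Prop := forall u v, exists g : aut, g u = v.

Definition is_oedge (p : V * V) : bool := e p.1 p.2.
Definition oedge := {p : V * V | is_oedge p}.

Lemma aut_is_oedge (g : aut) p : is_oedge p -> is_oedge (g p.1, g p.2).
Proof. by rewrite /is_oedge aut_adj. Qed.

Definition oedge_act (g : aut) (a : oedge) : oedge :=
  exist _ (g (val a).1, g (val a).2) (aut_is_oedge g (valP a)).

Definition is_edge (A : {fset V}) : bool :=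
  `[< exists u v, e u v /\ A = [fset u; v]%fset >].
Definition edge := {A : {fset V} | is_edge A}.

Lemma aut_is_edge (g : aut) A : is_edge A -> is_edge (g @` A)%fset.
Proof.
move=> /asboolP[u [v [euv ->]]]; apply/asboolP.
by exists (g u), (g v); rewrite aut_adj imfset_fset2.
Qed.

Definition edge_act (g : aut) (a : edge) : edge :=
  exist _ (g @` val a)%fset (aut_is_edge g (valP a)).

Lemma edge_nonempty (a : edge) : exists u, u \in val a.
Proof. by case: a => A /= /asboolP[u [v [_ ->]]]; exists u; rewrite !inE eqxx. Qed.

(* What a process may be indexed by: a set with an action of the automorphism
   group, the endpoints of an index, and a fixed endpoint around which the
   balls of the coding radius are taken. *)
Record indexing := Indexing {
  index_sort :> Type ;
  iact : aut -> index_sort -> index_sort ;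
  ends : index_sort -> set V ;
  base : index_sort -> V }.

Definition vindex : indexing :=
  @Indexing V (fun g v => g v) (fun v => [set v]) id.

Definition oindex : indexing :=
  @Indexing oedge oedge_act
    (fun a => [set (val a).1; (val a).2]) (fun a => (val a).1).

Definition eindex : indexing :=
  @Indexing edge edge_act
    (fun a => [set v | v \in val a]) (fun a => xchoose (edge_nonempty a)).

(* A space of configurations y. [cact g] is the action of g^-1, that is
   y |-> (i |-> y (g i)); since it is only used under a quantifier over the
   whole automorphism group, this loses nothing. [agree B y y'] says that y and
   y' coincide on the subgraph induced by B. *)
Record config_space := ConfigSpace {
  conf_display : measure_display ;
  conf :> measurableType conf_display ;
  cact : aut -> conf -> conf ;
  agree : set V -> conf -> conf -> Prop }.

Definition fconf (I : indexing) d (T : measurableType d) : config_space :=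
  @ConfigSpace _ (pspace I T)
    (fun g y i => y (iact g i))
    (fun B y y' => forall i, ends i `<=` B -> y i = y' i).

Definition pair_conf (C1 C2 : config_space) : config_space :=
  @ConfigSpace _ (conf C1 * conf C2)%type
    (fun g y => (cact g y.1, cact g y.2))
    (fun B y y' => agree B y.1 y'.1 /\ agree B y.2 y'.2).

End Graphs.

Section ExtendedNat.
Variable R : realType.

Definition einf (A : set nat) : \bar R := ereal_inf [set n%:R%:E | n in A].
Definition esup (A : set nat) : \bar R := ereal_sup [set n%:R%:E | n in A].

End ExtendedNat.

Section Processes.
Variables (R : realType) (V : countType) (e : rel V).
Local Open Scope ereal_scope.

Definition same_law d1 d2 d (W1 : measurableType d1) (W2 : measurableType d2)
    (T : measurableType d) (P1 : probability W1 R) (X1 : W1 -> T)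
    (P2 : probability W2 R) (X2 : W2 -> T) : Prop :=
  forall A, measurable A -> P1 (X1 @^-1` A) = P2 (X2 @^-1` A).

Definition independent d d1 d2 (W : measurableType d) (T1 : measurableType d1)
    (T2 : measurableType d2) (P : probability W R) (X : W -> T1) (Y : W -> T2)
    : Prop :=
  forall A B, measurable A -> measurable B ->
    P (X @^-1` A `&` Y @^-1` B) = P (X @^-1` A) * P (Y @^-1` B).

Definition iid d dS (W : measurableType d) (S : measurableType dS)
    (P : probability W R) (xi : W -> pspace (vindex e) S) : Prop :=
  exists m : probability S R,
  forall (F : {fset V}) (B : V -> set S), (forall v, measurable (B v)) ->
    P [set x | forall v, v \in F -> B v (xi x v)] = \prod_(v <- F) m (B v).

Definition aut_invariant d (W : measurableType d) (P : probability W R)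
    (C : config_space e) (Y : W -> C) : Prop :=
  forall g : aut e, same_law P (fun x => cact g (Y x)) P Y.

Section FinitaryFactors.
Variables (C : config_space e) (I : indexing e).
Variables (dT : measure_display) (T : measurableType dT).
Variable phi : C -> pspace I T.

Definition equivariant : Prop :=
  forall (g : aut e) y, phi (cact g y) = cact (c := fconf I T) g (phi y).

Definition coding_radius (y : C) (i : I) : \bar R :=
  einf R [set r | forall y', agree (gball e (base i) r) y y' ->
                             phi y' i = phi y i].

Variables (d d' : measure_display).
Variables (W : measurableType d) (P : probability W R) (X : W -> pspace I T).
Variables (W' : measurableType d') (P' : probability W' R) (Y : W' -> C).

Definition finitary_factor_map : Prop :=
  [/\ measurable_fun setT phi,
      equivariant,
      same_law P' (phi \o Y) P X &
      forall i, {ae P', forall x, coding_radius (Y x) i < +oo}].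

(* The event that the coding radius is at least r need not be measurable, T and
   the value space of Y being arbitrary; its probability is the outer one. *)
Definition exp_tails : Prop :=
  forall i, exists K c : R, [/\ (0 < K)%R, (0 < c)%R &
    forall r : R, (0 <= r)%R -> exists A, [/\ measurable A,
      [set x | r%:E <= coding_radius (Y x) i] `<=` A &
      P' A <= (K * expR (- (c * r)))%:E]].

End FinitaryFactors.

Definition finitary_factor (C : config_space e) (I : indexing e)
    dT (T : measurableType dT) d (W : measurableType d) (P : probability W R)
    (X : W -> pspace I T) d' (W' : measurableType d') (P' : probability W' R)
    (Y : W' -> C) : Prop :=
  exists phi : C -> pspace I T, finitary_factor_map phi P X P' Y.

Section Ffiid.
Variables (I : indexing e) (dT : measure_display) (T : measurableType dT).
Variables (d : measure_display) (W : measurableType d).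
Variables (P : probability W R) (X : W -> pspace I T).

Definition ffiid : Prop :=
  exists d' (W' : measurableType d') (P' : probability W' R)
         dS (S : measurableType dS) (Y : {RV P' >-> pspace (vindex e) S}),
    iid P' Y /\ finitary_factor (C := fconf (vindex e) S) P X P' Y.

Definition ffiid_exp_tails : Prop :=
  exists d' (W' : measurableType d') (P' : probability W' R)
         dS (S : measurableType dS) (Y : {RV P' >-> pspace (vindex e) S}),
    iid P' Y /\
    exists phi : fconf (vindex e) S -> pspace I T,
      finitary_factor_map phi P X P' Y /\ exp_tails phi P' Y.

End Ffiid.

End Processes.

Section Percolation.
Variables (V : countType) (e : rel V).
Implicit Types (w : pspace (eindex e) bool) (u v : V).

Definition open_adj w : rel V := fun u v =>
  `[< exists a : edge e, val a = [fset u; v]%fset /\ w a >].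

Definition open_cluster w u : set V :=
  [set v | exists p, path (open_adj w) u p /\ last u p = v].

Definition unique_infinite_cluster w : Prop :=
  exists! C : set V, (exists u, C = open_cluster w u) /\ infinite_set C.

(* The infinite cluster, when there is exactly one. *)
Definition Cinf w : set V := [set v | infinite_set (open_cluster w v)].

Definition connected_within w (B : set V) u v : Prop :=
  exists p, [/\ path (open_adj w) u p, last u p = v &
                forall x, x \in u :: p -> B x].

Variable R : realType.

Definition gdiam (C : set V) : \bar R :=
  esup R [set n | exists u v, [/\ C u, C v & n = gdist e u v]].

Definition set_gdist (A B : set V) : \bar R :=
  einf R [set n | exists u v, [/\ A u, B v & n = gdist e u v]].

(* The quantity L_{u,r}. *)
Definition local_uniq w u (r : nat) : \bar R :=
  einf R [set l | (r <= l)%N /\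
    forall v v', Cinf w v -> Cinf w v' -> gball e u r v -> gball e u r v' ->
      connected_within w (gball e u l) v v'].

End Percolation.

Section Spins.
Variables (R : realType) (V : countType) (e : rel V) (q : nat).
Local Open Scope ereal_scope.

Definition spins := pspace (vindex e) 'Z_q.

Definition spin_law (w : pspace (eindex e) bool) (m : {measure set spins -> \bar R})
    : Prop :=
  [/\ forall u v, open_cluster w u v -> m [set s | s u = s v] = 1,
      forall (F : {fset V}) (B : V -> set 'Z_q),
        {in F &, forall u v, u != v -> open_cluster w u <> open_cluster w v} ->
        m [set s | forall v, v \in F -> B v (s v)] =
        \prod_(v <- F) m [set s | B v (s v)],
      forall u (a : 'Z_q), finite_set (open_cluster w u) ->
        m [set s | s u = a] = (q%:R^-1)%:E &
      forall u, Cinf w u -> m [set s | s u = 0%R] = 1].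

(* [kappa] is a regular conditional distribution of sigma given omega. *)
Definition spins_given_percolation d (W : measurableType d)
    (P : probability W R) (omega : W -> pspace (eindex e) bool)
    (sigma : W -> spins) : Prop :=
  exists kappa : R.-pker (pspace (eindex e) bool) ~> spins,
    (forall A B, measurable A -> measurable B ->
       P (omega @^-1` A `&` sigma @^-1` B) =
       \int[P]_(x in omega @^-1` A) kappa (omega x) B) /\
    {ae P, forall x, spin_law (omega x) (kappa (omega x))}.

(* The subtraction of 'Z_q is subtraction mod q when 1 < q. *)
Definition gradient (s : spins) : pspace (oindex e) 'Z_q :=
  fun a => (s (val a).2 - s (val a).1)%R.

End Spins.

(* Main.v *)
From HB Require Import structures.
Require Import Defs.
From mathcomp Require Import all_boot all_order all_algebra finmap.
From mathcomp Require Import all_classical all_reals all_analysis.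
From mathcomp Require Import measurable_realfun.
From mathcomp Require Import zify ring lra.

Set Implicit Arguments.
Unset Strict Implicit.
Unset Printing Implicit Defensive.
Import Order.TTheory GRing.Theory Num.Theory.
Import numFieldNormedType.Exports.

Local Open Scope classical_set_scope.
Local Open Scope ring_scope.

(** Nothing read in a finite ball tells whether a cluster is infinite, hence
whether its spin is 0. The gradient involves only differences of spins, and
these can be computed from rules that never mention infinity: each finite
cluster defines its spin relative to another cluster, its parent, and the rules
are followed from both ends of an edge until the two lines of ancestors meet.

Fix thresholds f j > 3 * j and give every vertex independent uniform digits.
Digit 0 of a vertex contributes to spins; the other digits form a label, used
to break ties. The level of a finite cluster F is the least j such that F has
diameter at most j and some vertex within distance j of F lies in a cluster
that extends to distance f j; among these vertices the one with the least label
lies in the parent of F. A parent of a cluster of level j extends to distance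
f j, so its level, if it has one, is at least f j: levels grow along a line of
ancestors, which thus never returns ([step_level_le], [chain_loop]). The spin
of a vertex is the sum of the digits 0 of all vertices in the clusters of its
line, up to the infinite cluster ([chain_spin]). The gradient along an edge is
the difference of the sums taken up to any common ancestor ([merged]); this
difference is unique whatever the input ([merged_uniq]), and it commutes with
automorphisms ([merged_aut]).

The law is correct because adding 1 to digit 0 of a vertex u preserves the law
of the digits, adds 1 to the spin of the cluster of u, and changes no spin of
another cluster of the same or higher level ([chain_spin_shift],
[chain_spin_shift_avoid]). Splitting off clusters in order of increasing level
shows that spins of distinct clusters are independent, and uniform on the
finite ones ([spin_product], [spin_uniform]). For a fixed percolation
configuration these properties determine the law of the spins
([spin_law_unique]), and integrating over the configuration gives the law of
the gradient ([gradient_law]).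

The coding radius is finite because a line of ancestors that stays below level
K is decided by a ball whose radius is of the order of f K ([chain_agree]). The
line that starts at u reaches the infinite cluster at bounded level as soon as,
for every large j, no finite cluster near u is stretched at threshold f j
([tame], [chain_reaches]); since every finite cluster has finite diameter and
finite distance to the infinite cluster, thresholds that grow fast enough
achieve this almost surely, by Borel-Cantelli ([exists_scale]). The two lines
of an edge then end in the unique infinite cluster, and a finite open path that
joins their ends completes a certificate of the gradient which is visible in a
ball ([gradient_read]). If the percolation is itself coded by i.i.d. labels,
pairing these with the digits codes the gradient ([composition_factor]).

For exponential tails, linear thresholds f j = B * j.+1 suffice: with a steep
slope B the assumed tails outweigh the growth of balls, so each of the
ingredients above fails at scale n with exponentially small probability. The
remaining point is a union bound over the edges of a ball of radius linear in n,
at each of which the percolation has to be read off its labels. It needs tails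
that are uniform over edges, although the coding radius of a given map has
constants that depend on the edge and level sets that need not be events of the
label field. The coding map is therefore replaced by an almost surely equal one
that outputs a value as soon as the labels near the edge determine it almost
surely ([regularize]). The new events are measurable in the labels, and
invariance of the i.i.d. law makes their probabilities equal along each of the
finitely many orbits of edges ([regular_coding]). *)

(** * Graph distance and balls *)

Section Distance.
Variables (V : countType) (e : rel V).
Hypotheses (e_sym : symmetric e) (e_conn : graph_connected e).
Hypothesis e_lf : locally_finite_graph e.
Local Open Scope nat_scope.

Lemma walk_cat m n u v w : walk e m u v -> walk e n v w -> walk e (m + n) u w.
Proof.
move=> [p [pp <- <-]] [p' [pp' <- <-]]; exists (p ++ p').
by rewrite cat_path pp pp' last_cat size_cat.
Qed.

Lemma gdist_spec n u v : walk e n u v ->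
  walk e (gdist e u v) u v /\ forall m, walk e m u v -> gdist e u v <= m.
Proof.
move=> wn; have ex : exists n, `[< walk e n u v >] by exists n; apply/asboolP.
apply: (@xgetPex _ 0 [set n | walk e n u v /\ forall m, walk e m u v -> n <= m]).
case: (ex_minnP ex) => k /asboolP wk kmin; exists k; split=> // m wm.
by apply: kmin; apply/asboolP.
Qed.

Lemma gdist_walk u v : walk e (gdist e u v) u v.
Proof. by have [n /gdist_spec[]] := e_conn u v. Qed.

Lemma gdist_min n u v : walk e n u v -> gdist e u v <= n.
Proof. by move=> wn; have [_] := gdist_spec wn; apply. Qed.

Lemma gdistxx u : gdist e u u = 0.
Proof. by apply/eqP; rewrite -leqn0; apply: gdist_min; exists [::]. Qed.

Lemma gdist_eq0 u v : gdist e u v <= 0 -> u = v.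
Proof.
rewrite leqn0 => /eqP d0; have := gdist_walk u v; rewrite d0 => -[p [_ + ]].
by case: p.
Qed.

Lemma gdist_tri v u w : gdist e u w <= gdist e u v + gdist e v w.
Proof. by apply/gdist_min/walk_cat; apply: gdist_walk. Qed.

Lemma gdist_adj u v : e u v -> gdist e u v <= 1.
Proof. by move=> uv; apply: gdist_min; exists [:: v]; rewrite /= uv. Qed.

Lemma walk_aut (g : aut e) n u v : walk e n (g u) (g v) <-> walk e n u v.
Proof.
have [h gK hK] := aut_bij g.
have pathg x p : path e (g x) (map g p) = path e x p.
  by elim: p x => //= y p IH x; rewrite aut_adj IH.
split=> -[p [pp pl ps]]; last first.
  by exists (map g p); rewrite pathg pp last_map pl size_map.
have pE : p = map g (map h p) by rewrite mapK.
exists (map h p); rewrite -pathg -pE size_map pp; split=> //.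
by apply: (can_inj gK); rewrite -last_map -pE.
Qed.

Lemma gdist_aut (g : aut e) u v : gdist e (g u) (g v) = gdist e u v.
Proof.
by apply/eqP; rewrite eqn_leq !gdist_min//; apply/walk_aut/gdist_walk.
Qed.

Definition nbrs u : seq V := fset_set [set v | e u v].

Lemma mem_nbrs u v : (v \in nbrs u) = e u v.
Proof.
rewrite /nbrs in_fset_set; last exact: e_lf.
by apply/idP/idP => [/set_mem|uv] //; apply/mem_set.
Qed.

(** Balls as lists of the endpoints of walks. Repetitions are kept, so that
lengths are bounded by counting walks. *)
Fixpoint ball_seq u n : seq V :=
  u :: (if n is m.+1 then flatten [seq ball_seq v m | v <- nbrs u] else [::]).

Lemma mem_ball_seq u n v : (v \in ball_seq u n) = (gdist e u v <= n).
Proof.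
apply/idP/idP.
- elim: n u => [|n IH] u /=; rewrite inE.
    by move=> /eqP ->; rewrite gdistxx.
  case/orP => [/eqP ->|]; first by rewrite gdistxx.
  move=> /flattenP[_ /mapP[w + ->]] /IH wv; rewrite mem_nbrs => uw.
  by rewrite (leq_trans (gdist_tri w u v))// -add1n leq_add// gdist_adj.
- have [p [pp <- <-]] := gdist_walk u v.
  elim: p n u pp => [|w p IH] n u /=; first by case: n => [|n]; rewrite mem_head.
  case: n => // n /andP[uw pp] pn; rewrite inE; apply/orP; right.
  apply/flattenP; exists (ball_seq w n); last exact: IH.
  by apply/mapP; exists w; rewrite ?mem_nbrs.
Qed.

(** Degrees are strictly below D because the recursion also lists the centre of
the ball. *)
Lemma size_ball_seq D u n : (forall x, size (nbrs x) < D) ->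
  size (ball_seq u n) <= D ^ n.
Proof.
move=> degD; elim: n u => [|n IH] u //=.
have h s : size (flatten [seq ball_seq v n | v <- s]) <= size s * D ^ n.
  by elim: s => //= v s IHs; rewrite size_cat mulSn leq_add.
have Dn : 0 < D ^ n by rewrite expn_gt0 (leq_trans _ (degD u)).
rewrite expnS (leq_trans (n := (size (nbrs u)).+1 * D ^ n))//.
  by rewrite mulSn -[X in X <= _]add1n leq_add.
by rewrite leq_mul2r degD orbT.
Qed.

Lemma size_nbrs_aut (g : aut e) u : size (nbrs (g u)) = size (nbrs u).
Proof.
have [h gK hK] := aut_bij g.
have /perm_size -> : perm_eq (nbrs (g u)) (map g (nbrs u)).
  apply: uniq_perm; rewrite ?fset_uniq//.
    by rewrite map_inj_uniq ?fset_uniq//; exact: can_inj gK.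
  move=> v; rewrite mem_nbrs; apply/idP/mapP => [guv|[w + ->]].
    by exists (h v); rewrite ?hK// mem_nbrs -(aut_adj g) hK.
  by rewrite mem_nbrs aut_adj.
by rewrite size_map.
Qed.

End Distance.

(** * Clusters and their lines of ancestors *)

Section Connectivity.
Variables (V : countType) (rho : rel V).

Definition conn x y := exists p, path rho x p /\ last x p = y.

Lemma connxx x : conn x x. Proof. by exists [::]. Qed.

Lemma conn_trans y x z : conn x y -> conn y z -> conn x z.
Proof.
move=> [p [pp <-]] [p' [pp' <-]]; exists (p ++ p').
by rewrite cat_path pp last_cat.
Qed.

Lemma conn1 x y : rho x y -> conn x y.
Proof. by move=> xy; exists [:: y]; rewrite /= xy. Qed.

(** Finite clusters are handled as finite sets, so that their vertices can be
summed over; no finite set represents an infinite cluster. *)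
Definition is_cluster x (F : {fset V}) := forall y, y \in F <-> conn x y.

Definition finite_at x := exists F, is_cluster x F.

Lemma is_cluster_uniq x F F' : is_cluster x F -> is_cluster x F' -> F = F'.
Proof.
by move=> hF hF'; apply/fsetP => y; apply/idP/idP => [/(hF y).1/(hF' y).2|
  /(hF' y).1/(hF y).2].
Qed.

Lemma is_cluster_self x F : is_cluster x F -> x \in F.
Proof. by move=> hF; apply/hF/connxx. Qed.

Hypothesis rho_sym : symmetric rho.

Lemma conn_sym x y : conn x y -> conn y x.
Proof.
move=> [p [pp <-]]; exists (rev (belast x p)); split.
- by rewrite -rev_path (eq_path (e' := rho)) // in pp.
- by case: p pp => [|a p] //= _; rewrite rev_cons last_rcons.
Qed.

Lemma is_cluster_conn x y F : conn x y -> is_cluster x F -> is_cluster y F.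
Proof.
move=> xy hF z; split=> [/hF xz|yz]; last exact/hF/(conn_trans xy).
exact: conn_trans (conn_sym xy) xz.
Qed.

Lemma finite_at_conn x y : conn x y -> finite_at x -> finite_at y.
Proof. by move=> xy [F hF]; exists F; apply: is_cluster_conn hF. Qed.

End Connectivity.

Section Chain.
Variables (V : countType) (e : rel V) (q : nat) (f : nat -> nat).
Local Notation gdist := (gdist e).
Implicit Types (rho : rel V) (xi : V -> nat -> 'Z_q) (F : {fset V}).

(** Lexicographic order on the digits from index 1 on. Digit 0 is kept out of it
because it enters the spins and is going to be shifted. *)
Definition label_lt (a b : nat -> 'Z_q) : Prop := exists n,
  (forall k, (k < n)%N -> a k.+1 = b k.+1) /\ (a n.+1 < b n.+1)%N.

Definition reach rho x m := exists y, conn rho x y /\ (m <= gdist x y)%N.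

(** Candidates for the parent of F at scale j. That their clusters extend to
distance f j is what makes levels grow along a line of ancestors. *)
Definition candidate rho F j y :=
  (exists2 x, x \in F & (gdist x y <= j)%N) /\ reach rho y (f j).

Definition admissible rho F j :=
  (forall x y, x \in F -> y \in F -> (gdist x y <= j)%N) /\
  exists y, candidate rho F j y.

Definition scale rho F j :=
  admissible rho F j /\ forall i, (i < j)%N -> ~ admissible rho F i.

Definition level rho x j := exists F, is_cluster rho x F /\ scale rho F j.

Definition step rho xi x j y := exists F,
  [/\ is_cluster rho x F, scale rho F j, candidate rho F j y &
      forall y', candidate rho F j y' -> y' <> y -> label_lt (xi y) (xi y')].

Definition mass rho xi x t := exists F,
  is_cluster rho x F /\ t = \sum_(v <- F) xi v 0%N.

(** [chain K n x t z] follows n parents, through clusters of level at most K,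
from the cluster of x to the vertex z, and t adds up the masses of the clusters
that are left behind. The bound K is what will localize the construction. *)
Fixpoint chain rho xi K n x t z : Prop :=
  if n is m.+1 then exists j y s,
    [/\ (j <= K)%N, step rho xi x j y, mass rho xi x s &
        chain rho xi K m y (t - s) z]
  else x = z /\ t = 0.

(** Above a common ancestor both lines collect the same mass, so the difference
of the masses below it is the difference of the spins. *)
Definition merged rho xi u v c := exists K n m z z' t t',
  [/\ chain rho xi K n u t z, chain rho xi K m v t' z', conn rho z z' &
      c = t' - t].

Definition chain_spin rho xi u c := exists K n z,
  chain rho xi K n u c z /\ ~ finite_at rho z.

Section Uniqueness.
Variables (rho : rel V) (xi : V -> nat -> 'Z_q).
Hypothesis rho_sym : symmetric rho.
Hypothesis f_gt : forall j, (j < f j)%N.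

Lemma label_lt_asym a b : label_lt a b -> label_lt b a -> False.
Proof.
move=> [n [eqn ltn]] [m [eqm ltm]].
have [nm|mn|nm] := ltngtP n m.
- by rewrite (eqm _ nm) ltnn in ltn.
- by rewrite (eqn _ mn) ltnn in ltm.
- by rewrite nm in ltn; have := ltn_trans ltn ltm; rewrite ltnn.
Qed.

Lemma scale_uniq F i j : scale rho F i -> scale rho F j -> i = j.
Proof.
move=> [ai mi] [aj mj]; apply/eqP; rewrite eqn_leq.
by apply/andP; split; rewrite leqNgt; apply/negP => /[dup];
  [move/mi|move/mj].
Qed.

Lemma level_conn x y j : conn rho x y -> level rho x j -> level rho y j.
Proof. by move=> xy [F [hF sF]]; exists F; split=> //; apply: is_cluster_conn hF. Qed.

Lemma level_uniq x i j : level rho x i -> level rho x j -> i = j.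
Proof.
move=> [F [hF sF]] [F' [hF' sF']]; rewrite (is_cluster_uniq hF' hF) in sF'.
exact: scale_uniq sF sF'.
Qed.

Lemma step_level x j y : step rho xi x j y -> level rho x j.
Proof. by move=> [F [hF sF _ _]]; exists F. Qed.

Lemma step_finite x j y : step rho xi x j y -> finite_at rho x.
Proof. by move=> [F [hF sF _ _]]; exists F. Qed.

Lemma step_reach x j y : step rho xi x j y -> reach rho y (f j).
Proof. by move=> [F [_ _ [_ ?] _]]. Qed.

Lemma level_reach x j m : level rho x j -> reach rho x m -> (m <= j)%N.
Proof.
move=> [F [hF [[diamF _] _]]] [y [xy my]].
by rewrite (leq_trans my)// diamF//; [exact: is_cluster_self hF|apply/hF].
Qed.

(** A cluster of level i has diameter at most i, while a parent chosen at level j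
extends to distance f j. *)
Lemma step_level_le x j y i :
  step rho xi x j y -> level rho y i -> (f j <= i)%N.
Proof. by move=> /step_reach h /level_reach; apply. Qed.

Lemma step_uniq x x' j j' y y' : conn rho x x' ->
  step rho xi x j y -> step rho xi x' j' y' -> y = y'.
Proof.
move=> xx' [F [hF sF cF lF]] [F' [hF' sF' cF' lF']].
have FF' : F' = F by apply: is_cluster_uniq hF' (is_cluster_conn _ xx' hF).
move: sF' cF' lF'; rewrite FF' => sF'.
rewrite (scale_uniq sF' sF) => cF' lF'.
apply: contrapT => yy'; apply: label_lt_asym (lF' _ cF yy') (lF _ cF' _).
exact: nesym.
Qed.

Lemma mass_uniq x x' s s' : conn rho x x' ->
  mass rho xi x s -> mass rho xi x' s' -> s = s'.
Proof.
move=> xx' [F [hF ->]] [F' [hF' ->]].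
by rewrite (is_cluster_uniq hF' (is_cluster_conn _ xx' hF)).
Qed.

Lemma chain_level K n x t z i : chain rho xi K n x t z -> level rho z i ->
  exists2 j, level rho x j & (j + n <= i)%N.
Proof.
elim: n x t => [|n IH] x t /=; first by move=> [-> _]; exists i; rewrite ?addn0.
move=> [j [y [s [_ st _ /IH a]]]] /a[k yk kn].
exists j; first exact: step_level st.
by have := step_level_le st yk; have := f_gt j; lia.
Qed.

Lemma chain_mono K K' n x t z : (K <= K')%N ->
  chain rho xi K n x t z -> chain rho xi K' n x t z.
Proof.
move=> KK'; elim: n x t => [|n IH] x t //= [j [y [s [jK st ms a]]]].
by exists j, y, s; split=> //; [exact: leq_trans jK KK'|exact: IH].
Qed.

Lemma chain_cat K K' n m x t y s z : chain rho xi K n x t y ->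
  chain rho xi K' m y s z -> chain rho xi (maxn K K') (n + m) x (t + s) z.
Proof.
elim: n x t => [|n IH] x t /=.
  by move=> [-> ->]; rewrite add0r; apply: chain_mono; rewrite leq_maxr.
move=> [j [w [r [jK st ms a]]]] b; exists j, w, r; split=> //.
  by rewrite leq_max jK.
by rewrite addrAC; apply: IH.
Qed.

(** Levels grow along a line of ancestors, and connected vertices have the same
level. *)
Lemma chain_loop K n x t z : conn rho z x -> chain rho xi K n x t z -> n = 0%N.
Proof.
case: n => // n zx /[dup] a [j [y [s [_ st _ _]]]].
have xj := step_level st.
have [i xi' jn] := chain_level a (level_conn (conn_sym rho_sym zx) xj).
by have := level_uniq xj xi'; lia.
Qed.

Lemma chain_mass_uniq K K' n n' x x' t t' z z' :
  conn rho x x' -> conn rho z z' ->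
  chain rho xi K n x t z -> chain rho xi K' n' x' t' z' -> t = t'.
Proof.
move=> + zz'; elim: n n' x x' t t' => [|n IH] [|n'] x x' t t' xx'.
- by move=> [_ ->] [_ ->].
- move=> [xz _] /chain_loop; rewrite -xz in zz' => h.
  by have := h (conn_trans (conn_sym rho_sym zz') xx').
- move=> /chain_loop h [xz _]; subst x'.
  have /h // : conn rho z x.
  exact: conn_trans zz' (conn_sym rho_sym xx').
- move=> [j [y [s [_ st ms a]]]] [j' [y' [s' [_ st' ms' a']]]].
  have yy' := step_uniq xx' st st'; subst y'.
  have ss' := mass_uniq xx' ms ms'; subst s'.
  have /(congr1 (+%R^~ s)) := IH _ _ _ _ _ (connxx rho y) a a'.
  by rewrite !subrK.
Qed.

(** Parents being unique, of two lines that start from one cluster one continues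
the other. *)
Lemma chain_linear K K' n n' x x' t t' z z' : conn rho x x' ->
  chain rho xi K n x t z -> chain rho xi K' n' x' t' z' ->
  (exists L m w s, [/\ chain rho xi L m w s z', conn rho z w & t' = t + s]) \/
  (exists L m w s, [/\ chain rho xi L m w s z, conn rho z' w & t = t' + s]).
Proof.
elim: n n' x x' t t' => [|n IH] n' x x' t t' xx'.
  by move=> [<- ->] a; left; exists K', n', x', t'; rewrite add0r.
case: n' => [|n'].
  move=> a [<- ->]; right; exists K, n.+1, x, t; rewrite add0r; split=> //.
  exact: conn_sym.
move=> [j [y [s [_ st ms a]]]] [j' [y' [s' [_ st' ms' a']]]].
have yy' := step_uniq xx' st st'; subst y'.
have ss' := mass_uniq xx' ms ms'; subst s'.
have [|] := IH _ _ _ _ _ (connxx rho y) a a' => -[L [m [w [r [b zw]]]]];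
  move=> /(congr1 (+%R^~ s)); rewrite subrK addrAC subrK => ->.
- by left; exists L, m, w, r.
- by right; exists L, m, w, r.
Qed.

Lemma chain_conn_l K n x x' t z : conn rho x x' -> chain rho xi K n x t z ->
  exists w, conn rho z w /\ chain rho xi K n x' t w.
Proof.
case: n => [|n] xx' /=; first by move=> [<- ->]; exists x'.
move=> [j [y [s [jK [F [hF sF cF lF]] [F' [hF' ->]] a]]]]; exists z.
split; first exact: connxx.
exists j, y, (\sum_(v <- F') xi v 0%N); split=> //.
- by exists F; split=> //; exact: is_cluster_conn hF.
- by exists F'; split=> //; exact: is_cluster_conn hF'.
Qed.

(** Two common ancestors lie on one line, and the mass collected between them
cancels in the difference. *)
Lemma merged_uniq u v c c' :
  merged rho xi u v c -> merged rho xi u v c' -> c = c'.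
Proof.
move=> [K [n [m [z [w [t [s [a b zw ->]]]]]]]].
move=> [K' [n' [m' [z' [w' [t' [s' [a' b' zw' ->]]]]]]]].
wlog: K K' n n' m m' z z' w w' t t' s s' a b a' b' zw zw' /
  exists L l x r, [/\ chain rho xi L l x r z', conn rho z x & t' = t + r].
move=> W; have [h|h] := chain_linear (connxx rho u) a a'.
  by apply: (W _ _ _ _ _ _ _ _ _ _ _ _ _ _ a b a' b' zw zw' h).
  by apply/esym; exact: (W _ _ _ _ _ _ _ _ _ _ _ _ _ _ a' b' a b zw' zw h).
move=> [L [l [x [r [d zx ->]]]]].
have wx : conn rho x w by apply: conn_trans zw; exact: conn_sym.
have [y [z'y d']] := chain_conn_l wx d.
have := chain_mass_uniq (connxx rho v) _ b' (chain_cat b d').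
move=> ->; first by rewrite opprD addrA addrAC addrK.
exact: conn_trans (conn_sym rho_sym zw') z'y.
Qed.

Lemma chain_finite K n x t z : ~ finite_at rho x -> chain rho xi K n x t z ->
  x = z /\ t = 0.
Proof.
by case: n => // n nx [j [y [s [_ /step_finite]]]].
Qed.

Lemma chain_spin_uniq x x' c c' : conn rho x x' ->
  chain_spin rho xi x c -> chain_spin rho xi x' c' -> c = c'.
Proof.
move=> xx' [K [n [z [a nz]]]] [K' [n' [z' [a' nz']]]].
have [|] := chain_linear xx' a a' => -[L [m [w [s [b zw ->]]]]].
- have nw : ~ finite_at rho w.
    by apply: contra_not nz; apply: finite_at_conn (conn_sym rho_sym zw).
  by have [_ ->] := chain_finite nw b; rewrite addr0.
- have nw : ~ finite_at rho w.
    by apply: contra_not nz'; apply: finite_at_conn (conn_sym rho_sym zw).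
  by have [_ ->] := chain_finite nw b; rewrite addr0.
Qed.

Lemma chain_spin_conn x x' c : conn rho x x' -> chain_spin rho xi x c ->
  chain_spin rho xi x' c.
Proof.
move=> xx' [K [n [z [a nz]]]]; have [w [zw a']] := chain_conn_l xx' a.
exists K, n, w; split=> //; apply: contra_not nz.
exact: finite_at_conn (conn_sym rho_sym zw).
Qed.

End Uniqueness.
End Chain.

(** * Equivariance and locality of the lines of ancestors *)

Section Equivariance.
Variables (V : countType) (e : rel V) (q : nat) (f : nat -> nat).
Hypotheses (e_sym : symmetric e) (e_conn : graph_connected e).
Variables (g : aut e) (rho rho' : rel V) (xi xi' : V -> nat -> 'Z_q).
Hypothesis rhoE : forall x y, rho' x y = rho (g x) (g y).
Hypothesis xiE : forall x, xi' x = xi (g x).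
Local Open Scope fset_scope.
Implicit Types F : {fset V}.

Let g_inj : injective g. Proof. exact: bij_inj (aut_bij g). Qed.

Let g_surj x : exists y, x = g y.
Proof. by have [h gK hK] := aut_bij g; exists (h x). Qed.

Lemma conn_aut x y : conn rho' x y <-> conn rho (g x) (g y).
Proof.
have pathg z p : path rho (g z) (map g p) = path rho' z p.
  by elim: p z => //= w p IH z; rewrite rhoE IH.
have [h gK hK] := aut_bij g.
split=> -[p [pp pl]].
  by exists (map g p); rewrite pathg pp last_map pl.
have pE : p = map g (map h p) by rewrite mapK.
exists (map h p); rewrite -pathg -pE pp; split=> //.
by apply: g_inj; rewrite -last_map -pE.
Qed.

Let mem_img F x : (g x \in g @` F) = (x \in F).
Proof. by rewrite mem_imfset. Qed.

Let img_surj F : exists F', F = g @` F'.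
Proof.
have [h gK hK] := aut_bij g; exists (h @` F); apply/fsetP => x.
apply/idP/imfsetP => [xF|[_ /imfsetP[w wF ->] ->]]; last by rewrite hK.
by exists (h x); rewrite ?hK//; apply/imfsetP; exists x.
Qed.

Lemma cluster_aut x F : is_cluster rho' x F <-> is_cluster rho (g x) (g @` F).
Proof.
split=> hF y; first by have [z ->] := g_surj y; rewrite mem_img -conn_aut; exact: hF.
by rewrite -mem_img conn_aut; exact: hF.
Qed.

Lemma reach_aut x m : reach e rho' x m <-> reach e rho (g x) m.
Proof.
split=> -[y [xy my]].
  by exists (g y); split; [exact/conn_aut|rewrite gdist_aut].
have [z yE] := g_surj y; subst y; exists z.
by split; [exact/conn_aut|rewrite -(gdist_aut e_conn g)].
Qed.

Lemma candidate_aut F j y : candidate e f rho' F j y <-> candidate e f rho (g @` F) j (g y).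
Proof.
rewrite /candidate -reach_aut; split=> -[[x xF xy] r]; split=> //.
  by exists (g x); rewrite ?mem_img ?gdist_aut.
have [z xE] := g_surj x; subst x; exists z; first by rewrite -mem_img.
by rewrite -(gdist_aut e_conn g).
Qed.

Lemma admissible_aut F j : admissible e f rho' F j <-> admissible e f rho (g @` F) j.
Proof.
split=> -[d [y c]]; split.
- move=> x z; have [x' ->] := g_surj x; have [z' ->] := g_surj z.
  by rewrite !mem_img gdist_aut//; exact: d.
- by exists (g y); apply/candidate_aut.
- by move=> x z xF zF; rewrite -(gdist_aut e_conn g) d ?mem_img.
- by have [y' yE] := g_surj y; exists y'; apply/candidate_aut; rewrite -yE.
Qed.

Lemma scale_aut F j : scale e f rho' F j <-> scale e f rho (g @` F) j.
Proof.
by rewrite /scale -admissible_aut; split=> -[a m]; split=> // i /m; rewrite -admissible_aut.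
Qed.

Lemma step_aut x j y :
  step e f rho' xi' x j y <-> step e f rho xi (g x) j (g y).
Proof.
split=> -[F [hF sF cF lF]].
  exists (g @` F); split; [exact/cluster_aut|exact/scale_aut|exact/candidate_aut|].
  move=> z; have [z' ->] := g_surj z => /candidate_aut/lF; rewrite !xiE => h gzy.
  by apply: h => zy; apply: gzy; rewrite zy.
have [F' FE] := img_surj F; subst F.
exists F'; split; [exact/cluster_aut|exact/scale_aut|exact/candidate_aut|].
by move=> z /candidate_aut/lF; rewrite !xiE => h zy; apply: h => /g_inj.
Qed.

Lemma mass_aut x t : mass rho' xi' x t <-> mass rho xi (g x) t.
Proof.
have sumE F : \sum_(v <- g @` F) xi v 0%N = \sum_(v <- F) xi' v 0%N.
  rewrite (perm_big (map g F)) ?big_map.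
    by apply: eq_bigr => v _; rewrite xiE.
  apply: uniq_perm; rewrite ?fset_uniq ?map_inj_uniq ?fset_uniq//.
  move=> z; have [z' ->] := g_surj z.
  by rewrite mem_img mem_map.
split=> -[F [hF ->]].
  by exists (g @` F); rewrite sumE; split=> //; exact/cluster_aut.
have [F' FE] := img_surj F; subst F.
by exists F'; rewrite sumE; split=> //; exact/cluster_aut.
Qed.

Lemma chain_aut K n x t z :
  chain e f rho' xi' K n x t z <-> chain e f rho xi K n (g x) t (g z).
Proof.
elim: n x t => [|n IH] x t /=; first by split=> -[]; [move=> ->|move=> /g_inj].
split=> -[j [y [s [jK st ms a]]]].
  by exists j, (g y), s; split=> //; [exact/step_aut|exact/mass_aut|exact/IH].
have [y' yE] := g_surj y; subst y; exists j, y', s.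
by split=> //; [exact/step_aut|exact/mass_aut|exact/IH].
Qed.

Lemma merged_aut u v c :
  merged e f rho' xi' u v c <-> merged e f rho xi (g u) (g v) c.
Proof.
split=> -[K [n [m [z [w [t [s [a b zw ->]]]]]]]].
  exists K, n, m, (g z), (g w), t, s.
  by split=> //; [exact/chain_aut|exact/chain_aut|exact/conn_aut].
have [z' zE] := g_surj z; have [w' wE] := g_surj w; subst z w.
exists K, n, m, z', w', t, s.
by split=> //; [exact/chain_aut|exact/chain_aut|exact/conn_aut].
Qed.

End Equivariance.

Section Locality.
Variables (V : countType) (e : rel V) (q : nat) (f : nat -> nat).
Hypotheses (e_sym : symmetric e) (e_conn : graph_connected e).
Hypothesis f_mono : {homo f : i j / (i <= j)%N}.
Hypothesis f_big : forall j, (3 * j < f j)%N.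
Local Notation gdist := (gdist e).
Implicit Types (rho : rel V) (A : set V) (F : {fset V}).

Let f_gt j : (j < f j)%N. Proof. by have := f_big j; lia. Qed.

Definition agree_on A rho rho' := forall x y, A x -> A y -> rho x y = rho' x y.

Lemma agree_onC A rho rho' : agree_on A rho rho' -> agree_on A rho' rho.
Proof. by move=> h x y Ax Ay; rewrite h. Qed.

Lemma agree_onS A B rho rho' :
  A `<=` B -> agree_on B rho rho' -> agree_on A rho rho'.
Proof. by move=> AB h x y /AB Bx /AB By; exact: h. Qed.

Lemma gball_sub x y r s : (gdist x y + r <= s)%N -> gball e y r `<=` gball e x s.
Proof.
by move=> h z; rewrite /gball/=; have := gdist_tri e_conn y x z; lia.
Qed.

Lemma conn_agree A rho rho' x p : agree_on A rho rho' ->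
  (forall y, y \in x :: p -> A y) -> path rho x p -> path rho' x p.
Proof.
move=> h; elim: p x => //= y p IH x Ap /andP[xy py].
rewrite -h// ?xy/=; first last.
- by apply: Ap; rewrite !inE eqxx orbT.
- by apply: Ap; rewrite inE eqxx.
by apply: IH => // z zp; apply: Ap; rewrite inE zp orbT.
Qed.

Section Agree.
Variables (rho rho' : rel V).
Hypotheses (rho_e : subrel rho e) (rho_e' : subrel rho' e).

(** To recognize F as a whole cluster one must also see that the edges leaving it
are closed, hence one more unit of radius. *)
Lemma cluster_agree x F j : agree_on (gball e x j.+1) rho rho' ->
  (forall y, y \in F -> (gdist x y <= j)%N) ->
  is_cluster rho x F -> is_cluster rho' x F.
Proof.
move=> h d hF y; split=> [/[dup] yF /hF[p [pp px]]|[p [pp <-]]].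
  exists p; split=> //; apply: (conn_agree h _ pp) => z zp.
  rewrite /gball/=; apply/ltnW; rewrite ltnS; apply: d; apply/hF.
  move: zp; rewrite inE => /orP[/eqP ->|zp]; first exact: connxx.
  case/splitPr: zp pp px => p1 p2; rewrite cat_path /= => /and3P[pp1 xz _] _.
  by exists (rcons p1 z); rewrite rcons_path pp1 last_rcons xz.
elim/last_ind: p pp => [_|p z IH]; first exact: is_cluster_self hF.
rewrite rcons_path last_rcons => /andP[/IH lF lz]; apply/hF.
apply: conn_trans (conn1 _); first by apply/hF; exact: lF.
rewrite h//; rewrite /gball/=; first by have := d _ lF; lia.
apply: leq_trans (gdist_tri e_conn (last x p) _ _) _.
by have := d _ lF; have := gdist_adj (rho_e' lz); lia.
Qed.

(** An open path that leaves a ball may be stopped when it first does so. *)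
Lemma reach_agree x m : agree_on (gball e x m) rho rho' ->
  reach e rho x m -> reach e rho' x m.
Proof.
move=> h [y [[p [pp <-]] mp]].
pose ok p' := [/\ path rho x p', (m <= gdist x (last x p'))%N &
  forall y, y \in x :: p' -> (gdist x y <= m)%N].
have [ltm|[p' [pp' mp' hp']]] :
    (forall y, y \in x :: p -> (gdist x y < m)%N) \/ exists p', ok p'.
- elim/last_ind: p pp {mp} => [_|p z IH].
    have [m0|m0] := posnP m; [right; exists [::]|left=> w].
      by split; rewrite ?m0// => w; rewrite inE => /eqP ->; rewrite gdistxx.
    by rewrite inE => /eqP ->; rewrite gdistxx.
  rewrite rcons_path => /andP[pp lz]; have [lt|] := IH pp; [|by right].
  have zm : (gdist x z <= m)%N.
    have xl : (gdist x (last x p) < m)%N by apply: lt; exact: mem_last.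
    have := gdist_tri e_conn (last x p) x z.
    have lz1 : (gdist (last x p) z <= 1)%N by exact/gdist_adj/rho_e.
    by lia.
  have [ltz|] := ltnP (gdist x z) m.
    left=> w; rewrite -rcons_cons mem_rcons inE => /orP[/eqP -> //|].
    exact: lt.
  right; exists (rcons p z); split; rewrite ?last_rcons ?rcons_path ?pp//.
  move=> w; rewrite -rcons_cons mem_rcons inE => /orP[/eqP -> //|/lt].
  exact: ltnW.
- by have := ltm _ (mem_last x p); rewrite ltnNge mp.
exists (last x p'); split=> //.
by exists p'; split=> //; apply: conn_agree h _ pp'.
Qed.

End Agree.

Section AgreeStep.
Variables (rho rho' : rel V) (xi xi' : V -> nat -> 'Z_q).
Hypotheses (rho_e : subrel rho e) (rho_e' : subrel rho' e).

Lemma candidate_agree F j y :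
  (forall x, x \in F -> agree_on (gball e x (j + f j)) rho rho') ->
  candidate e f rho F j y -> candidate e f rho' F j y.
Proof.
move=> h [[x xF xy] r]; split; first by exists x.
apply: reach_agree r => //; apply: agree_onS (h _ xF).
by apply: gball_sub; lia.
Qed.

Lemma admissible_agree F j :
  (forall x, x \in F -> agree_on (gball e x (j + f j)) rho rho') ->
  admissible e f rho F j -> admissible e f rho' F j.
Proof. by move=> h [d [y c]]; split=> //; exists y; exact: candidate_agree c. Qed.

End AgreeStep.

(** From a vertex of F, the set F is visible at distance j and the candidates at
distance 2 * j; to test that a candidate extends to distance f j one looks that
much further. *)
Definition reading_radius j := (2 * j + f j + 1)%N.

Lemma step_agree rho rho' xi xi' x j y :
  subrel rho e -> subrel rho' e ->
  agree_on (gball e x (reading_radius j)) rho rho' ->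
  (forall z, gball e x (reading_radius j) z -> xi z = xi' z :> (nat -> 'Z_q)) ->
  step e f rho xi x j y -> step e f rho' xi' x j y.
Proof.
move=> re re' h hxi [F [hF [adF minF] cF lF]].
have xF := is_cluster_self hF.
have dF z : z \in F -> (gdist x z <= j)%N by case: adF => d _; exact: d.
have hj i : (i <= j)%N -> forall z, z \in F ->
    agree_on (gball e z (i + f i)) rho rho'.
  move=> ij z zF; apply: agree_onS h; apply: gball_sub.
  rewrite /reading_radius; have := dF _ zF; have := f_mono ij; lia.
have hj' i (ij : (i <= j)%N) z zF := agree_onC (hj i ij z zF).
exists F; split.
- apply: cluster_agree dF hF => //; apply: agree_onS h; apply: gball_sub.
  rewrite gdistxx /reading_radius; have := f_gt j; lia.
- split; first exact: admissible_agree (hj _ (leqnn j)) adF.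
  move=> i ij /(admissible_agree re' (hj' _ (ltnW ij))); exact: minF.
- exact: candidate_agree (hj _ (leqnn j)) cF.
- have xiE z : candidate e f rho F j z -> xi z = xi' z.
    move=> [[w wF wz] _]; apply: hxi; rewrite /gball/= /reading_radius.
    by have := gdist_tri e_conn w x z; have := dF _ wF; lia.
  move=> z /(candidate_agree re' (hj' _ (leqnn j))) cz zy.
  by rewrite -!xiE//; exact: lF.
Qed.

Lemma mass_agree rho rho' xi xi' x j t :
  subrel rho e -> subrel rho' e ->
  agree_on (gball e x (reading_radius j)) rho rho' ->
  (forall z, gball e x (reading_radius j) z -> xi z = xi' z :> (nat -> 'Z_q)) ->
  level e f rho x j -> mass rho xi x t -> mass rho' xi' x t.
Proof.
move=> re re' h hxi [F' [hF' [[d' _] _]]] [F [hF ->]].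
have FE := is_cluster_uniq hF' hF; subst F'.
have xF := is_cluster_self hF.
exists F; split.
  apply: cluster_agree hF => //; last by move=> z zF; exact: d' xF zF.
  apply: agree_onS h; apply: gball_sub.
  rewrite gdistxx /reading_radius; have := f_gt j; lia.
apply: eq_big_seq => z zF; rewrite hxi// /gball/= /reading_radius.
by have := d' _ _ xF zF; lia.
Qed.

(** A passage from level i to a parent has length at most 2 * i, and the level of
the parent is at least 3 * i. As j is at most i and
2 * i + (3 * K - 3 * i) <= 3 * K - j, the total length stays within 3 * K - j. *)
Lemma chain_agree rho rho' xi xi' K n x j t z :
  subrel rho e -> subrel rho' e ->
  (j <= K)%N -> (n != 0%N -> forall i, level e f rho x i -> (j <= i)%N) ->
  agree_on (gball e x (3 * K - j + reading_radius K)) rho rho' ->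
  (forall z, gball e x (3 * K - j + reading_radius K) z ->
     xi z = xi' z :> (nat -> 'Z_q)) ->
  chain e f rho xi K n x t z ->
  chain e f rho' xi' K n x t z /\ (gdist x z <= 3 * K - j)%N.
Proof.
move=> re re'; elim: n x j t => [|n IH] x j t /=.
  by move=> _ _ _ _ [<- ->]; rewrite gdistxx.
move=> jK /(_ isT) lj h hxi [i [y [s [iK st ms a]]]].
have ji : (j <= i)%N by apply: lj; exact: step_level st.
have fK : (f i <= f K)%N by exact: f_mono.
have xyi : (gdist x y <= 2 * i)%N.
  case: st => [F [hF [[d _] _] [[w wF wy] _] _]].
  have := d _ _ (is_cluster_self hF) wF.
  by have := gdist_tri e_conn w x y; lia.
have sub : gball e x (reading_radius i) `<=`
           gball e x (3 * K - j + reading_radius K).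
  by apply: gball_sub; rewrite gdistxx /reading_radius; lia.
have st' : step e f rho' xi' x i y.
  by apply: step_agree st => //; [exact: agree_onS h|move=> w /sub/hxi].
have ms' : mass rho' xi' x s.
  apply: (mass_agree (j := i)) ms => //; last exact: step_level st.
    exact: agree_onS h.
  by move=> w /sub/hxi.
case: n IH a => [_ /= [yz ts]|n IH a].
  subst y; split; first by exists i, z, s.
  by lia.
have iK3 : (3 * i < K)%N.
  case: a => [k [w [r [kK st2 _ _]]]].
  have := step_level_le st (step_level st2).
  by have := f_big i; lia.
have sub' : gball e y (3 * K - 3 * i + reading_radius K) `<=`
            gball e x (3 * K - j + reading_radius K).
  by apply: gball_sub; lia.
have [a' yz] : chain e f rho' xi' K n.+1 y (t - s) z /\
    (gdist y z <= 3 * K - 3 * i)%N.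
  apply: (IH _ (3 * i)%N) => //; first exact: ltnW.
  - by move=> _ k /(step_level_le st); have := f_big i; lia.
  - exact: agree_onS h.
  - by move=> w /sub'/hxi.
split; first by exists i, y, s.
by have := gdist_tri e_conn y x z; lia.
Qed.

End Locality.

(** * Reaching the infinite cluster *)

Section LabelOrder.
Variable q : nat.
Implicit Types a b c : nat -> 'Z_q.

Lemma label_lt_trans b a c : label_lt a b -> label_lt b c -> label_lt a c.
Proof.
move=> [n [eqn ltn]] [m [eqm ltm]].
have [nm|mn|nm] := ltngtP n m.
- exists n; split; last by rewrite -(eqm _ nm).
  by move=> k kn; rewrite eqn// eqm// (ltn_trans kn).
- exists m; split; last by rewrite (eqn _ mn).
  by move=> k km; rewrite eqn ?(ltn_trans km)// eqm.
- subst m; exists n; split; last exact: ltn_trans ltn ltm.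
  by move=> k kn; rewrite eqn// eqm.
Qed.

Definition labels_distinct (V : Type) (xi : V -> nat -> 'Z_q) :=
  forall x y, x <> y -> exists n, xi x n.+1 <> xi y n.+1.

Lemma label_lt_total (V : Type) (xi : V -> nat -> 'Z_q) x y :
  labels_distinct xi -> x <> y ->
  label_lt (xi x) (xi y) \/ label_lt (xi y) (xi x).
Proof.
move=> h xy; have [n0 /eqP n0P] := h _ _ xy.
have exn : exists n, xi x n.+1 != xi y n.+1 by exists n0.
case: (ex_minnP exn) => n dn minn.
have eqn k : (k < n)%N -> xi x k.+1 = xi y k.+1.
  by move=> kn; apply/eqP/negPn/negP => /minn; rewrite leqNgt kn.
have [lt|lt|/val_inj eq] := ltngtP (xi x n.+1) (xi y n.+1).
- by left; exists n.
- by right; exists n; split=> // k kn; rewrite eqn.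
- by rewrite eq eqxx in dn.
Qed.

Lemma label_min (V : eqType) (xi : V -> nat -> 'Z_q) (C : V -> Prop)
    (s : seq V) : labels_distinct xi -> (forall x, C x -> x \in s) ->
  (exists x, C x) ->
  exists2 x, C x & forall y, C y -> y <> x -> label_lt (xi x) (xi y).
Proof.
move=> hxi Cs [x0 Cx0].
have min : exists2 x, C x & forall y, y \in s -> C y -> y <> x ->
    label_lt (xi x) (xi y).
  elim: s {Cs} => [|a s [x Cx xmin]]; first by exists x0.
  have [[Ca ax]|nax] := pselect (C a /\ label_lt (xi a) (xi x)).
    exists a => // y; rewrite inE => /orP[/eqP -> //|ys Cy ya].
    have [->|yx] := pselect (y = x) => //.
    by apply: label_lt_trans ax _; exact: xmin.
  exists x => // y; rewrite inE => /orP[/eqP ->|]; last exact: xmin.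
  move=> Ca ax; have [lt|//] := label_lt_total hxi ax.
  by exfalso; apply: nax.
by have [x Cx xmin] := min; exists x => // y Cy; apply: xmin; first exact: Cs.
Qed.

End LabelOrder.

Section Termination.
Variables (V : countType) (e : rel V) (q : nat) (f : nat -> nat).
Hypotheses (e_sym : symmetric e) (e_conn : graph_connected e).
Hypothesis e_lf : locally_finite_graph e.
Hypothesis f_mono : {homo f : i j / (i <= j)%N}.
Hypothesis f_big : forall j, (3 * j < f j)%N.
Variables (rho : rel V) (xi : V -> nat -> 'Z_q).
Hypotheses (rho_sym : symmetric rho) (rho_e : subrel rho e).
Hypothesis xi_distinct : labels_distinct xi.
Local Notation gdist := (gdist e).

(** When an infinite cluster exists, a finite cluster that is not stretched at
distance m has level below m: it is narrow, and the infinite cluster is a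
candidate. *)
Definition stretched x m := finite_at rho x /\
  ((exists a b, [/\ conn rho x a, conn rho x b & (m <= gdist a b)%N]) \/
   (forall a z, conn rho x a -> ~ finite_at rho z -> (m <= gdist a z)%N)).

(** A line of ancestors that starts at u is still within 3 * j of u when it leaves
level j, so stretched clusters further away do not matter. *)
Definition tame u j0 := forall j x, (j0 <= j)%N -> (gdist u x <= 3 * j)%N ->
  ~ stretched x (f j).

Let f_gt j : (j < f j)%N. Proof. by have := f_big j; lia. Qed.

(** Otherwise the cluster would be contained in a ball, which is finite. *)
Lemma infinite_reach z m : ~ finite_at rho z -> reach e rho z m.
Proof.
move=> nz; apply: contrapT => nr; apply: nz.
exists [fset y in ball_seq e z m | `[< conn rho z y >]]%fset => y.
rewrite !inE; split=> [/andP[_ /asboolP]//|zy]; rewrite asboolT// andbT.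
rewrite mem_ball_seq//; have [my|/ltnW//] := leqP m (gdist z y).
by exfalso; apply: nr; exists y.
Qed.

Lemma finite_scale x F j : is_cluster rho x F -> admissible e f rho F j ->
  exists2 i, scale e f rho F i & (i <= j)%N.
Proof.
move=> hF aj.
have ex : exists i, `[< admissible e f rho F i >] by exists j; exact/asboolP.
case: (ex_minnP ex) => i /asboolP ai imin; exists i; last exact/imin/asboolP.
by split=> // k ki /asboolP/imin; rewrite leqNgt ki.
Qed.

Lemma scale_exists x F m : is_cluster rho x F ->
  (exists z, ~ finite_at rho z) -> (0 < m)%N -> ~ stretched x m ->
  exists2 j, scale e f rho F j & (j <= m.-1)%N.
Proof.
move=> hF [z0 nz0] m0 nst; apply: (finite_scale hF); split.
  move=> a b /hF xa /hF xb; rewrite -ltnS prednK//.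
  rewrite ltnNge; apply/negP => ab; apply: nst; split; first by exists F.
  by left; exists a, b.
apply: contrapT => nc; apply: nst; split; first by exists F.
right=> a z xa nz; rewrite leqNgt; apply/negP => az; apply: nc; exists z.
split; last exact: infinite_reach.
by exists a; [exact/hF|lia].
Qed.

Lemma tame_level u j0 : tame u j0 -> (exists z, ~ finite_at rho z) ->
  finite_at rho u -> exists j, level e f rho u j.
Proof.
move=> tm nz [F hF]; have [j sj _] : exists2 j, scale e f rho F j & (j <= (f j0).-1)%N.
  apply: (scale_exists hF) => //; first by have := f_gt j0; lia.
  by apply: tm; rewrite ?gdistxx.
by exists j, F.
Qed.

Lemma level_gt0 x j : level e f rho x j -> (0 < j)%N.
Proof.
move=> [F [hF [[d [y [[x' x'F x'y] [w [yw fw]]]]] _]]].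
rewrite lt0n; apply/eqP => j0; subst j.
have := gdist_eq0 e_conn x'y => ?; subst x'.
have := d _ _ x'F _; have xw : conn rho x w.
  by apply: conn_trans yw; apply/hF.
by move=> /(_ w ((hF w).2 xw)); have := f_gt 0; lia.
Qed.

(** The number i is the level from which x was reached. As long as i < j0,
tameness at j0 bounds the level of x by f j0. Once i >= j0, the cluster of x
extends to distance f i, which tameness forbids if it is finite. The measure m
bounds the number of passages left before i reaches f j0. *)
Lemma chain_reaches_from u j0 m x i : tame u j0 -> (exists z, ~ finite_at rho z) ->
  (f j0 <= i + m)%N -> (gdist u x <= 3 * i)%N ->
  (forall j, level e f rho x j -> (3 * i <= j)%N /\ (i < j)%N) ->
  ((j0 <= i)%N -> ~ finite_at rho x) ->
  exists n t z, chain e f rho xi (f j0) n x t z /\ ~ finite_at rho z.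
Proof.
move=> tm [z0 nz0]; elim: m x i => [|m IH] x i im xi3 lx ninf.
  exists 0%N, 0, x; split=> //; apply: ninf.
  by have := f_gt j0; lia.
have [j0i|ij0] := leqP j0 i; first by exists 0%N, 0, x; split=> //; exact: ninf.
have [[F hF]|nx] := pselect (finite_at rho x); last by exists 0%N, 0, x.
have f0 := f_gt j0.
have [j sj jle] : exists2 j, scale e f rho F j & (j <= (f j0).-1)%N.
  apply: (scale_exists (x := x)) => //; [by exists z0|by lia|].
  by apply: tm; lia.
have xj : level e f rho x j by exists F.
have [ij3 ij] := lx _ xj.
have dF a : a \in F -> (gdist x a <= j)%N.
  by case: sj => -[d _] _; apply: d; exact: is_cluster_self hF.
have [y cy ymin] : exists2 y, candidate e f rho F j y &
    forall y', candidate e f rho F j y' -> y' <> y -> label_lt (xi y) (xi y').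
  apply: (label_min (s := ball_seq e x (2 * j))) => //.
    move=> y [[a aF ay] _]; rewrite mem_ball_seq//.
    by have := gdist_tri e_conn a x y; have := dF _ aF; lia.
  by case: sj => -[].
have st : step e f rho xi x j y by exists F.
have uy : (gdist u y <= 3 * j)%N.
  case: cy => -[a aF ay] _; have := dF _ aF.
  by have := gdist_tri e_conn a x y; have := gdist_tri e_conn x u y; lia.
have [|||n [t [z [a nz]]]] := IH y j _ uy.
- by lia.
- move=> k /(step_level_le st); have := f_big j; lia.
- move=> j0j fy; apply: (tm j y j0j uy); split=> //.
  by left; have [w [yw fw]] := step_reach st; exists y, w; split=> //; exact: connxx.
exists n.+1, (t + \sum_(v <- F) xi v 0%N), z; split=> //=.
exists j, y, (\sum_(v <- F) xi v 0%N); split=> //; last by rewrite addrK.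
- by lia.
- by exists F.
Qed.

Lemma chain_reaches u j0 : (0 < j0)%N -> tame u j0 ->
  (exists z, ~ finite_at rho z) ->
  exists n t z, chain e f rho xi (f j0) n u t z /\ ~ finite_at rho z.
Proof.
move=> j00 tm nz; apply: (@chain_reaches_from u j0 (f j0) u 0) => //.
- by rewrite gdistxx.
- by move=> j /level_gt0.
- by rewrite leqNgt j00.
Qed.

Lemma chain_dist K n u t z : chain e f rho xi K n u t z -> (gdist u z <= 3 * K)%N.
Proof.
move=> a; have [] := chain_agree (xi' := xi) (j := 0) e_conn f_mono f_big
  rho_e rho_e (leq0n K) (fun _ _ _ => isT) (fun _ _ _ _ => erefl)
  (fun _ _ => erefl) a.
by rewrite subn0.
Qed.

Definition chain_radius K := (3 * K + reading_radius f K)%N.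

(** Two lines followed up to scale K, together with an open path that joins the
vertices they arrive at, certify the difference of the spins; all of it is
visible in a ball. *)
Lemma merged_agree rho' xi' u v K n m t t' z z' r p :
  subrel rho' e -> (gdist u v <= 1)%N ->
  chain e f rho xi K n u t z -> chain e f rho xi K m v t' z' ->
  path rho z p -> last z p = z' ->
  (forall y, y \in z :: p -> gball e u r y) ->
  ((chain_radius K).+1 <= r)%N ->
  agree_on (gball e u r) rho rho' ->
  (forall y, gball e u r y -> xi y = xi' y :> (nat -> 'Z_q)) ->
  merged e f rho' xi' u v (t' - t).
Proof.
move=> re' uv au av pp pz pr Kr h hxi.
have sub x : (gdist u x <= 1)%N ->
    gball e x (3 * K - 0 + reading_radius f K) `<=` gball e u r.
  by move=> ux; apply: gball_sub => //; rewrite /chain_radius in Kr; lia.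
have uu : (gdist u u <= 1)%N by rewrite gdistxx.
have [au' _] := chain_agree e_conn f_mono f_big rho_e re' (leq0n K)
  (fun _ _ _ => isT) (agree_onS (sub u uu) h) (fun y yr => hxi y (sub u uu y yr)) au.
have [av' _] := chain_agree e_conn f_mono f_big rho_e re' (leq0n K)
  (fun _ _ _ => isT) (agree_onS (sub v uv) h) (fun y yr => hxi y (sub v uv y yr)) av.
exists K, n, m, z, z', t, t'; split=> //; exists p; split=> //.
exact: conn_agree h pr pp.
Qed.

End Termination.

(** * The effect of shifting one digit *)

Section SpinShift.
Variables (V : countType) (e : rel V) (q : nat) (f : nat -> nat).
Hypothesis f_gt : forall j, (j < f j)%N.
Variables (rho : rel V) (xi xi' : V -> nat -> 'Z_q) (u0 : V).
Hypothesis rho_sym : symmetric rho.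
Hypothesis xiS : forall v k, xi' v k.+1 = xi v k.+1.
Hypothesis xi0 : forall v, v <> u0 -> xi' v 0%N = xi v 0%N.
Hypothesis xi0u : xi' u0 0%N = xi u0 0%N + 1.

Lemma label_lt_shift v w : label_lt (xi' v) (xi' w) <-> label_lt (xi v) (xi w).
Proof.
by split=> -[n [eqn ltn]]; exists n; split; move: ltn; rewrite ?xiS// => _ k /eqn;
  rewrite !xiS.
Qed.

(** Parents depend on the labels only, so the shift changes masses but no line of
ancestors. *)
Lemma step_shift x j y : step e f rho xi x j y -> step e f rho xi' x j y.
Proof.
move=> [F [hF sF cF lF]]; exists F; split=> // z cz zy.
by apply/label_lt_shift; exact: lF.
Qed.

Lemma mass_shift_avoid x t : ~ conn rho x u0 -> mass rho xi x t -> mass rho xi' x t.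
Proof.
move=> nx [F [hF ->]]; exists F; split=> //.
by apply: eq_big_seq => v vF; rewrite xi0// => vu; subst v; apply/nx/hF.
Qed.

Lemma mass_shift t : mass rho xi u0 t -> mass rho xi' u0 (t + 1).
Proof.
move=> [F [hF ->]]; exists F; split=> //.
have u0F := is_cluster_self hF.
rewrite (big_fsetD1 u0)//= [in RHS](big_fsetD1 u0)//= xi0u.
rewrite addrAC; congr (_ + _ + _).
by apply: eq_big_seq => v; rewrite !inE => /andP[/eqP vu _]; rewrite xi0.
Qed.

(** Levels grow along the line, so that it can never enter the cluster of u0 if it
starts elsewhere at the same or a higher level. *)
Lemma chain_shift_avoid K n x t z j0 : level e f rho u0 j0 ->
  (forall j, level e f rho x j -> (j0 <= j)%N) -> ~ conn rho x u0 ->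
  chain e f rho xi K n x t z -> chain e f rho xi' K n x t z.
Proof.
move=> u0j; elim: n x t => [|n IH] x t //= xj nx [j [y [s [jK st ms a]]]].
exists j, y, s; split=> //; [exact: step_shift|exact: mass_shift_avoid|].
have jj := xj _ (step_level st).
apply: (IH _ _ _ _ a) => [i /(step_level_le st)|yu0]; first by have := f_gt j; lia.
have /(step_level_le st) := level_conn rho_sym (conn_sym rho_sym yu0) u0j.
by have := f_gt j; lia.
Qed.

Lemma chain_spin_shift_avoid x c j0 : level e f rho u0 j0 ->
  (forall j, level e f rho x j -> (j0 <= j)%N) -> ~ conn rho x u0 ->
  chain_spin e f rho xi x c -> chain_spin e f rho xi' x c.
Proof.
move=> u0j xj nx [K [n [z [a nz]]]]; exists K, n, z; split=> //.
exact: (chain_shift_avoid u0j xj nx a).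
Qed.

Lemma chain_spin_shift c : finite_at rho u0 ->
  chain_spin e f rho xi u0 c -> chain_spin e f rho xi' u0 (c + 1).
Proof.
move=> fu [K [[|n] [z [a nz]]]]; first by case: a nz => <- _ /(_ fu).
exists K, n.+1, z; split=> //; case: a => [j [y [s [jK st ms a]]]] /=.
exists j, y, (s + 1); split=> //; [exact: step_shift|exact: mass_shift|].
have u0j := step_level st.
have -> : c + 1 - (s + 1) = c - s by rewrite opprD addrACA subrr addr0.
apply: (chain_shift_avoid u0j _ _ a) => [i /(step_level_le st)|yu0].
  by have := f_gt j; lia.
have /(step_level_le st) := level_conn rho_sym (conn_sym rho_sym yu0) u0j.
by have := f_gt j; lia.
Qed.

End SpinShift.

(** * Measurability of events defined by quantifiers *)

Section MeasurablePredicates.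
Context d (T : measurableType d).
Implicit Types P Q : T -> Prop.

(** Measurability of an event is obtained by following the logical structure of the
predicate that defines it, all quantifiers ranging over countable types. *)
Definition mpred P := measurable [set x | P x].

Lemma mpred_cst (p : Prop) : mpred (fun=> p).
Proof.
rewrite /mpred; have [hp|np] := pselect p.
  by rewrite (_ : [set _ | _] = setT)//; apply/seteqP; split.
by rewrite (_ : [set _ | _] = set0)//; apply/seteqP; split.
Qed.

Lemma mpred_ext P Q : (forall x, P x <-> Q x) -> mpred P -> mpred Q.
Proof.
move=> PQ; rewrite /mpred (_ : [set x | P x] = [set x | Q x])//.
by apply/seteqP; split=> x /PQ.
Qed.

Lemma mpred_not P : mpred P -> mpred (fun x => ~ P x).
Proof. exact: measurableC. Qed.

Lemma mpred_and P Q : mpred P -> mpred Q -> mpred (fun x => P x /\ Q x).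
Proof. exact: measurableI. Qed.

Lemma mpred_or P Q : mpred P -> mpred Q -> mpred (fun x => P x \/ Q x).
Proof. exact: measurableU. Qed.

Lemma mpred_imp P Q : mpred P -> mpred Q -> mpred (fun x => P x -> Q x).
Proof.
move=> mP mQ; apply: mpred_ext (mpred_or (mpred_not mP) mQ) => x.
split=> [[|]//|PQ]; have [Px|] := pselect (P x); last by left.
by right; exact: PQ.
Qed.

Lemma mpred_iff P Q : mpred P -> mpred Q -> mpred (fun x => P x <-> Q x).
Proof. by move=> mP mQ; apply: mpred_and; apply: mpred_imp. Qed.

Lemma mpred_ex (I : countType) (P : I -> T -> Prop) :
  (forall i, mpred (P i)) -> mpred (fun x => exists i, P i x).
Proof.
move=> mP; rewrite /mpred.
rewrite (_ : [set _ | _] = \bigcup_n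
    if @choice.unpickle I n is Some i then [set x | P i x] else set0); last first.
  apply/seteqP; split=> x /=.
    by move=> [i Pi]; exists (choice.pickle i); rewrite ?choice.pickleK.
  by move=> [n _]; case: choice.unpickle => // i Pi; exists i.
apply: bigcupT_measurable => n; case: choice.unpickle => // i; exact: mP.
Qed.

Lemma mpred_all (I : countType) (P : I -> T -> Prop) :
  (forall i, mpred (P i)) -> mpred (fun x => forall i, P i x).
Proof.
move=> mP; apply: mpred_ext (mpred_not (mpred_ex (fun i => mpred_not (mP i)))).
move=> x; split=> [nE i|A [i]]; last exact.
by apply: contrapT => nP; apply: nE; exists i.
Qed.

Lemma mpred_ex2 (I : countType) (P Q : I -> T -> Prop) :
  (forall i, mpred (P i)) -> (forall i, mpred (Q i)) ->
  mpred (fun x => exists2 i, P i x & Q i x).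
Proof.
move=> mP mQ; apply: mpred_ext (mpred_ex (fun i => mpred_and (mP i) (mQ i))).
by move=> x; split=> [[i [? ?]]|[i ? ?]]; exists i.
Qed.

Lemma mpred_and3 P Q S : mpred P -> mpred Q -> mpred S ->
  mpred (fun x => [/\ P x, Q x & S x]).
Proof.
move=> mP mQ mS; apply: mpred_ext (mpred_and mP (mpred_and mQ mS)).
by move=> x; split=> [[? []]|[? ? ?]].
Qed.

Lemma mpred_and4 P Q S U : mpred P -> mpred Q -> mpred S -> mpred U ->
  mpred (fun x => [/\ P x, Q x, S x & U x]).
Proof.
move=> mP mQ mS mU; apply: mpred_ext (mpred_and mP (mpred_and3 mQ mS mU)).
by move=> x; split=> [[? []]|[? ? ? ?]].
Qed.

Lemma mpred_bool (b : T -> bool) : mpred (fun x => b x) -> measurable_fun setT b.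
Proof.
move=> mb; apply: (measurable_fun_bool true); rewrite setTI.
by rewrite (_ : _ @^-1` _ = [set x | b x]).
Qed.

End MeasurablePredicates.

Section ChainMeasurability.
Context d (T : measurableType d).
Variables (V : countType) (e : rel V) (q : nat) (f : nat -> nat).
Variables (rho : T -> rel V) (xi : T -> V -> nat -> 'Z_q).
Hypothesis m_rho : forall u v, mpred (fun x => rho x u v).
Hypothesis m_xi : forall v k c, mpred (fun x => xi x v k = c).
Implicit Types F : {fset V}.

Lemma mpred_path u p : mpred (fun x => path (rho x) u p).
Proof.
elim: p u => [|v p IH] u /=; first exact: mpred_cst.
by apply: mpred_ext (mpred_and (m_rho u v) (IH v)) => x; split=> /andP.
Qed.

Lemma mpred_conn u v : mpred (fun x => conn (rho x) u v).
Proof. by apply: mpred_ex => p; apply: mpred_and (mpred_path _ _) (mpred_cst _ _). Qed.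

Lemma mpred_is_cluster u F : mpred (fun x => is_cluster (rho x) u F).
Proof.
apply: mpred_all => y; apply: mpred_iff; [exact: mpred_cst|exact: mpred_conn].
Qed.

Lemma mpred_finite_at u : mpred (fun x => finite_at (rho x) u).
Proof. apply: mpred_ex => F; exact: mpred_is_cluster. Qed.

Lemma mpred_reach u m : mpred (fun x => reach e (rho x) u m).
Proof.
by apply: mpred_ex => y; apply: mpred_and (mpred_conn _ _) (mpred_cst _ _).
Qed.

Lemma mpred_stretched u m : mpred (fun x => stretched e (rho x) u m).
Proof.
apply: mpred_and; first exact: mpred_finite_at.
apply: mpred_or.
  apply: mpred_ex => a; apply: mpred_ex => b.
  by apply: mpred_and3 => //; [exact: mpred_conn..|exact: mpred_cst].
apply: mpred_all => a; apply: mpred_all => z; apply: mpred_imp.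
  exact: mpred_conn.
apply: mpred_imp; first exact/mpred_not/mpred_finite_at.
exact: mpred_cst.
Qed.

Lemma mpred_tame u j0 : mpred (fun x => tame e f (rho x) u j0).
Proof.
apply: mpred_all => j; apply: mpred_all => y; do 2 apply: mpred_imp (mpred_cst _ _) _.
exact/mpred_not/mpred_stretched.
Qed.

Lemma mpred_candidate F j y : mpred (fun x => candidate e f (rho x) F j y).
Proof. apply: mpred_and (mpred_cst _ _) _; exact: mpred_reach. Qed.

Lemma mpred_admissible F j : mpred (fun x => admissible e f (rho x) F j).
Proof.
apply: mpred_and (mpred_cst _ _) _; apply: mpred_ex => y; exact: mpred_candidate.
Qed.

Lemma mpred_scale F j : mpred (fun x => scale e f (rho x) F j).
Proof.
apply: mpred_and; first exact: mpred_admissible.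
apply: mpred_all => i; apply: mpred_imp (mpred_cst _ _) _.
exact/mpred_not/mpred_admissible.
Qed.

Lemma mpred_rel2 (r : 'Z_q -> 'Z_q -> Prop) v k w l :
  mpred (fun x => r (xi x v k) (xi x w l)).
Proof.
have m : mpred (fun x => exists a b, [/\ xi x v k = a, xi x w l = b & r a b]).
  apply: mpred_ex => a; apply: mpred_ex => b; apply: mpred_and3 => //.
  exact: mpred_cst.
apply: mpred_ext m => x; split; first by move=> [a [b [-> ->]]].
by move=> h; exists (xi x v k), (xi x w l).
Qed.

Lemma mpred_label_lt u v : mpred (fun x => label_lt (xi x u) (xi x v)).
Proof.
apply: mpred_ex => n; apply: mpred_and.
  apply: mpred_all => k; apply: mpred_imp (mpred_cst _ _) _.
  exact: (mpred_rel2 (fun a b => a = b)).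
exact: (mpred_rel2 (fun a b => (a < b)%N)).
Qed.

Lemma mpred_labels_distinct : mpred (fun x => labels_distinct (xi x)).
Proof.
apply: mpred_all => u; apply: mpred_all => v; apply: mpred_imp (mpred_cst _ _) _.
apply: mpred_ex => n; exact: (mpred_rel2 (fun a b => a <> b)).
Qed.

Lemma mpred_step u j v : mpred (fun x => step e f (rho x) (xi x) u j v).
Proof.
apply: mpred_ex => F; apply: mpred_and4.
- exact: mpred_is_cluster.
- exact: mpred_scale.
- exact: mpred_candidate.
- apply: mpred_all => w; apply: mpred_imp; first exact: mpred_candidate.
  apply: mpred_imp (mpred_cst _ _) _; exact: mpred_label_lt.
Qed.

Lemma mpred_sum (s : seq V) t : mpred (fun x => t = \sum_(v <- s) xi x v 0%N).
Proof.
elim: s t => [|v s IH] t.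
  apply: mpred_ext (mpred_cst _ (t = 0)) => x.
  by rewrite big_nil.
have m : mpred (fun x => exists c, xi x v 0%N = c /\ t - c = \sum_(v <- s) xi x v 0%N).
  by apply: mpred_ex => c; apply: mpred_and.
apply: mpred_ext m => x; rewrite big_cons; split.
  by move=> [c [-> <-]]; rewrite addrC subrK.
by move=> ->; exists (xi x v 0%N); rewrite addrAC subrr add0r.
Qed.

Lemma mpred_mass u t : mpred (fun x => mass (rho x) (xi x) u t).
Proof.
apply: mpred_ex => F; apply: mpred_and; first exact: mpred_is_cluster.
exact: mpred_sum.
Qed.

Lemma mpred_chain K n u t z : mpred (fun x => chain e f (rho x) (xi x) K n u t z).
Proof.
elim: n u t => [|n IH] u t /=; first exact: mpred_cst.
apply: mpred_ex => j; apply: mpred_ex => y; apply: mpred_ex => s.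
apply: mpred_and4; first exact: mpred_cst.
- exact: mpred_step.
- exact: mpred_mass.
- exact: IH.
Qed.

Lemma mpred_merged u v c : mpred (fun x => merged e f (rho x) (xi x) u v c).
Proof.
do 7 apply: mpred_ex => ?; apply: mpred_and4; [exact: mpred_chain..| |].
  exact: mpred_conn.
exact: mpred_cst.
Qed.

Lemma mpred_chain_spin u c : mpred (fun x => chain_spin e f (rho x) (xi x) u c).
Proof.
do 3 apply: mpred_ex => ?; apply: mpred_and; first exact: mpred_chain.
exact/mpred_not/mpred_finite_at.
Qed.

End ChainMeasurability.

(** * Product spaces and uniform digits *)

Section ProductSpace.
Context (I : eqType) d (S : measurableType d).

Lemma measurable_coord i : measurable_fun setT (fun x : pspace I S => x i).
Proof.
move=> _ B mB; rewrite setTI; apply: sub_sigma_algebra.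
by exists i, B.
Qed.

Lemma measurable_pspace d' (T : measurableType d') (F : T -> pspace I S) :
  (forall i, measurable_fun setT (fun x => F x i)) -> measurable_fun setT F.
Proof.
move=> mF; apply: (@measurability _ _ T (pspace I S) setT F (@cylinders I d S)) => //.
move=> _ [_ [i [B [mB ->]]] <-]; exact: mF.
Qed.

Definition boxes : set (set (I -> S)) := [set A | exists (s : seq I) B,
  (forall i, measurable (B i)) /\ A = [set x | forall i, i \in s -> B i (x i)]].

Lemma boxes_setI : setI_closed boxes.
Proof.
move=> _ _ [s [B [mB ->]]] [s' [B' [mB' ->]]].
exists (s ++ s'), (fun i => (if i \in s then B i else setT) `&`
                            (if i \in s' then B' i else setT)).
split=> [i|]; first by apply: measurableI; case: ifP.
apply/seteqP; split=> x /=.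
  by move=> [xs xs'] i _; split; case: ifP => // ?; [exact: xs|exact: xs'].
move=> h; split=> i ii.
  by have := h i; rewrite mem_cat ii => /(_ isT)[].
by have := h i; rewrite mem_cat ii orbT => /(_ isT)[].
Qed.

Lemma measurable_box (s : seq I) (B : I -> set S) : (forall i, measurable (B i)) ->
  measurable ([set x | forall i, i \in s -> B i (x i)] : set (pspace I S)).
Proof.
move=> mB; elim: s => [|i s IH].
  by rewrite (_ : [set _ | _] = setT)//; apply/seteqP; split.
rewrite (_ : [set _ | _] = [set x | B i (x i)] `&`
  [set x | forall j, j \in s -> B j (x j)]).
  apply: measurableI => //; have := measurable_coord i measurableT (mB i).
  by rewrite setTI.
apply/seteqP; split=> x /=.
  move=> h; split=> [|j js]; first by apply: h; rewrite inE eqxx.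
  by apply: h; rewrite inE js orbT.
by move=> [hi h] j; rewrite inE => /orP[/eqP ->//|/h].
Qed.

Lemma pspace_boxes : @measurable _ (pspace I S) = <<s boxes >>.
Proof.
apply/seteqP; split.
  apply: sub_smallest2r; first exact: smallest_sigma_algebra.
  move=> _ [i [B [mB ->]]].
  exists [:: i], (fun=> B); split=> //.
  apply/seteqP; split=> x /=; first by move=> Bx j; rewrite inE => /eqP ->.
  by apply; rewrite inE.
apply: smallest_sub; first exact: sigma_algebra_measurable.
move=> _ [s [B [mB ->]]]; exact: measurable_box.
Qed.

End ProductSpace.

Lemma pi_unique d (T : measurableType d) (R : realType) (G : set (set T))
    (m1 m2 : {measure set T -> \bar R}) :
  @measurable _ T = <<s G >> -> setI_closed G -> G setT ->
  (m1 setT < +oo)%E -> (forall A, G A -> m1 A = m2 A) ->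
  forall A, measurable A -> m1 A = m2 A.
Proof.
move=> mG GI GT fin m12 A mA; apply: (measure_unique G (fun=> setT)) => //.
by apply/seteqP; split=> // x _; exists 0%N.
Qed.

Lemma pspace_unique (I : eqType) d (S : measurableType d) (R : realType)
    (m1 m2 : {measure set (pspace I S) -> \bar R}) :
  (m1 setT < +oo)%E ->
  (forall (s : seq I) B, (forall i, measurable (B i)) ->
    m1 [set x | forall i, i \in s -> B i (x i)] =
    m2 [set x | forall i, i \in s -> B i (x i)]) ->
  forall A, measurable A -> m1 A = m2 A.
Proof.
move=> fin m12; apply: (pi_unique (pspace_boxes I S) (@boxes_setI I d S)) => //.
  exists [::], (fun=> setT); split=> //.
  by apply/seteqP; split.
by move=> _ [s [B [mB ->]]]; exact: m12.
Qed.

Section Digits.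
Variables (R : realType) (q : nat).
Local Notation Q := (Zp_trunc q).+2.

(** The digits in base Q of a uniform number of the unit interval: an i.i.d.
sequence obtained without an infinite product of measures. *)
Definition digits (x : measurableTypeR R) : pspace nat 'Z_q :=
  fun k => inZp (Num.truncn (x * (Q ^ k.+1)%:R)).

Lemma measurable_digits : measurable_fun setT digits.
Proof.
apply: measurable_pspace => k _ B _; rewrite setTI.
have mle (c : R) n : measurable [set x : measurableTypeR R | (Num.truncn (x * c) <= n)%N].
  rewrite (_ : [set x | _] = ( *%R^~ c) @^-1` `]-oo, (n.+1%:R : R)[).
    rewrite -[X in measurable X]setTI.
    have mc : measurable_fun [set: measurableTypeR R] ( *%R^~ c : R -> R).
      by apply: measurable_funM; [exact: measurable_id|exact: measurable_cst].
    by apply: mc => //; exact: measurable_itv.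
  by apply/seteqP; split=> x /=; rewrite in_itv/= truncn_le_nat.
have meq (c : R) n : measurable [set x : measurableTypeR R | Num.truncn (x * c) = n].
  case: n => [|n].
    rewrite (_ : [set x | _] = [set x | (Num.truncn (x * c) <= 0)%N])//.
    by apply/seteqP; split=> x /=; rewrite leqn0 => /eqP.
  rewrite (_ : [set x | _] = [set x | (Num.truncn (x * c) <= n.+1)%N] `\`
    [set x | (Num.truncn (x * c) <= n)%N]); first exact: measurableD.
  apply/seteqP; split=> x /=; first by move=> ->; rewrite ltnn.
  by move=> [h1 /negP]; rewrite -ltnNge => h2; apply/eqP; rewrite eqn_leq h1.
rewrite (_ : _ @^-1` B = \bigcup_(n in [set n | B (inZp n)])
   [set x : measurableTypeR R | Num.truncn (x * (Q ^ k.+1)%:R) = n]);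
  first exact: bigcup_measurable.
apply/seteqP; split=> x /=; last by move=> [n Bn nE]; rewrite /digits nE.
by move=> Bx; exists (Num.truncn (x * (Q ^ k.+1)%:R)).
Qed.

HB.instance Definition _ := isMeasurableFun.Build _ _ _ _ digits measurable_digits.

Definition digit_law := distribution (uniform_prob (@ltr01 R)) digits.

HB.instance Definition _ := Probability.on digit_law.

Definition atom (c : seq 'Z_q) : set (pspace nat 'Z_q) :=
  [set x | forall k, (k < size c)%N -> x k = nth 0 c k].

Lemma measurable_atom c : measurable (atom c).
Proof.
have := measurable_box (I := nat) (iota 0 (size c)) (B := fun k => [set nth 0 c k])
  (fun _ => I).
rewrite (_ : [set x | _] = atom c)//.
by apply/seteqP; split=> x /= h k; have := h k; rewrite mem_iota.
Qed.

Lemma atom_rcons c (a : 'Z_q) x :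
  atom (rcons c a) x <-> atom c x /\ x (size c) = a.
Proof.
rewrite /atom/= size_rcons; split.
  move=> h; split=> [k kc|]; last by rewrite h// nth_rcons ltnn eqxx.
  by rewrite h ?nth_rcons ?kc// ltnW.
move=> [h ha] k; rewrite ltnS leq_eqVlt nth_rcons => /orP[/eqP ->|kc].
  by rewrite ltnn eqxx.
by rewrite kc h.
Qed.

End Digits.

Section FullEvents.
Context d (T : measurableType d) (R : realType) (P : probability T R).

Lemma probability_lty A : measurable A -> (P A < +oo)%E.
Proof. by move=> mA; rewrite (le_lt_trans (probability_le1 P mA)) ?ltry. Qed.

Lemma full_setC0 J : measurable J -> P J = 1%E -> P (~` J) = 0%E.
Proof. by move=> mJ PJ; rewrite probability_setC// PJ subee. Qed.

Lemma full_setI A J : measurable A -> measurable J -> P J = 1%E ->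
  P (A `&` J) = P A.
Proof.
move=> mA mJ PJ; rewrite -[in RHS](setIT A) -(setUv J) setIUr measureU//.
- rewrite [X in (_ + X)%E](_ : _ = 0%E) ?adde0//.
  apply/eqP; rewrite eq_le measure_ge0 andbT -(full_setC0 mJ PJ).
  by apply: le_measure; rewrite ?inE//; [apply: measurableI => //|];
     exact: measurableC.
- exact: measurableI.
- by apply: measurableI => //; exact: measurableC.
- by rewrite setIACA setICr setI0.
Qed.

Lemma full_eq A B J : measurable A -> measurable B -> measurable J -> P J = 1%E ->
  (forall x, J x -> (A x <-> B x)) -> P A = P B.
Proof.
move=> mA mB mJ PJ AB; rewrite -(full_setI mA mJ PJ) -(full_setI mB mJ PJ).
by congr (P _); apply/seteqP; split=> x [? Jx]; split=> //; apply/(AB _ Jx).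
Qed.

Lemma full1 A : measurable A -> P (~` A) = 0%E -> P A = 1%E.
Proof.
move=> mA A0; rewrite -(setCK A) probability_setC; last exact: measurableC.
by rewrite A0 sube0.
Qed.

Lemma measure_levels n (X : T -> 'I_n) (E : set T) (B : set 'I_n) :
  (forall a, measurable (E `&` [set x | X x = a])) ->
  P (E `&` [set x | B (X x)]) =
  (\sum_(a < n | `[< B a >]) P (E `&` [set x | X x = a]))%E.
Proof.
move=> mX; rewrite -measure_bigsetU_ord_cond//; last first.
  by move=> i j _ _ [x [[_ /= <-] [_ /= <-]]].
congr (P _); rewrite -bigcup_seq_cond; apply/seteqP; split=> x /=.
  by move=> [Ex Bx]; exists (X x) => //=; rewrite mem_index_enum asboolT.
by move=> [a /= /andP[_ /asboolP Ba] [Ex xa]]; split=> //=; rewrite xa.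
Qed.

End FullEvents.

Section DigitLaw.
Variables (R : realType) (q : nat).
Local Notation Q := (Zp_trunc q).+2.
Local Notation digits := (@digits R q).
Local Notation digit_law := (@digit_law R q).

Definition value (c : seq 'Z_q) : nat := foldl (fun m (a : 'Z_q) => m * Q + a)%N 0%N c.

Lemma value_lt c : (value c < Q ^ size c)%N.
Proof.
elim/last_ind: c => [|c a IH] //.
rewrite /value foldl_rcons size_rcons expnSr -/(value c).
have := ltn_ord a; have aQ : (a < Q)%N by exact: ltn_ord.
move=> _; apply: (@leq_trans ((value c).+1 * Q)%N); first by rewrite mulSn; lia.
by rewrite leq_mul2r IH orbT.
Qed.

Lemma truncn_div (y : R) : 0 <= y -> (Num.truncn (y * Q%:R) %/ Q)%N = Num.truncn y.
Proof.
move=> y0; have yQ0 : 0 <= y * Q%:R by rewrite mulr_ge0.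
set N := Num.truncn _; apply/esym/truncn_def.
have /andP[Nle Nlt] := truncn_itv yQ0; rewrite -/N in Nle Nlt.
have Q0 : (0 : R) < Q%:R by rewrite ltr0n.
apply/andP; split; [rewrite -(ler_pM2r Q0)|rewrite -(ltr_pM2r Q0)]; rewrite -natrM.
  by rewrite (le_trans _ Nle)// ler_nat leq_divM.
by rewrite (lt_le_trans Nlt)// ler_nat ltn_ceil.
Qed.

(** Prescribing the first digits confines x to one interval of length
1 / Q ^ size c. *)
Lemma digits_atom c (x : R) : 0 <= x < 1 ->
  atom c (digits x) <-> Num.truncn (x * (Q ^ size c)%:R) = value c.
Proof.
move=> /andP[x0 x1]; elim/last_ind: c => [|c a IH].
  rewrite mulr1; split=> // _; apply: truncn_def; rewrite x0.
  by rewrite x1.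
rewrite atom_rcons IH /digits size_rcons expnSr natrM mulrA.
rewrite -(truncn_div (y := x * (Q ^ size c)%:R)); last by rewrite mulr_ge0.
set N := Num.truncn _; rewrite /value foldl_rcons -/(value c).
split=> [[h1 h2]|->].
  by rewrite (divn_eq N Q) h1 -[in RHS]h2.
have aQ : (a < Q)%N by exact: ltn_ord.
split; first by rewrite divnMDl// divn_small ?addn0.
by apply: val_inj => /=; rewrite modnMDl modn_small.
Qed.

Lemma uniform_prob_itv (a b : R) : 0 <= a -> a <= b -> b <= 1 ->
  uniform_prob (@ltr01 R) `[a, b[%classic = (b - a)%:E.
Proof.
move=> a0 ab b1; rewrite /uniform_prob.
rewrite (eq_integral (cst 1%E)); last first.
  move=> x; rewrite inE/= in_itv/= => /andP[ax xb].
  by rewrite /uniform_pdf (le_trans a0 ax) (ltW (lt_le_trans xb b1)) subr0 invr1.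
rewrite integral_cst//= mul1e lebesgue_measure_itv/= lte_fin.
case: ltP => // ba; have -> : b = a by apply/eqP; rewrite eq_le ba ab.
by rewrite subrr.
Qed.

Lemma digit_law_atom c : digit_law (atom c) = ((Q ^ size c)%:R^-1)%:E.
Proof.
pose J : set (measurableTypeR R) := `[(0 : R), 1[%classic.
have mJ : measurable J by exact: measurable_itv.
have PJ : uniform_prob (@ltr01 R) J = 1%E by rewrite uniform_prob_itv// subr0.
set n := size c; have Q0 : (0 : R) < (Q ^ n)%:R by rewrite ltr0n expn_gt0.
rewrite /digit_law /distribution /pushforward.
pose I : set (measurableTypeR R) :=
  `[(value c)%:R / (Q ^ n)%:R : R, (value c).+1%:R / (Q ^ n)%:R[%classic.
have PI : uniform_prob (@ltr01 R) I = ((Q ^ n)%:R^-1)%:E.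
  transitivity (((value c).+1%:R / (Q ^ n)%:R - (value c)%:R / (Q ^ n)%:R : R)%:E).
    apply: uniform_prob_itv; first by rewrite divr_ge0.
    - by rewrite ler_pM2r ?invr_gt0// ler_nat.
    - by rewrite ler_pdivrMr// mul1r ler_nat; exact: value_lt.
  by rewrite -mulrBl -natrB// subSnn mul1r.
rewrite -PI; apply: (@full_eq _ _ _ _ _ I J) => //.
- by rewrite -[X in measurable X]setTI; apply: measurable_digits => //; exact: measurable_atom.
- exact: measurable_itv.
- move=> x; rewrite /J/= in_itv/= => x01; rewrite digits_atom//.
  have x0 : 0 <= x by case/andP: x01.
  rewrite /I/= in_itv/= ler_pdivrMr// ltr_pdivlMr// -truncn_eq ?mulr_ge0//.
  by split=> [->|/eqP].
Qed.

End DigitLaw.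

(** * Invariance under digit shifts *)

Section ShiftInvariance.
Variables (R : realType) (q : nat).
Local Notation Q := (Zp_trunc q).+2.
Local Notation bits := (pspace nat 'Z_q).
Local Notation digit_law := (@digit_law R q).

Definition shift_digit k (x : bits) : bits :=
  fun j => if j == k then x j + 1 else x j.

Lemma measurable_shift_digit k : measurable_fun setT (shift_digit k).
Proof.
apply: measurable_pspace => j _ B _; rewrite setTI.
have := @measurable_coord nat _ 'Z_q j measurableT
  (if j == k then [set a | B (a + 1)] else B) I.
rewrite setTI (_ : _ @^-1` _ = (fun x : bits => shift_digit k x j) @^-1` B)//.
by apply/seteqP; split=> x; rewrite /shift_digit/=; case: eqP.
Qed.

HB.instance Definition _ k := isMeasurableFun.Build _ _ _ _ (shift_digit k)
  (measurable_shift_digit k).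

Definition unshift k (c : seq 'Z_q) :=
  [seq if j == k then nth 0 c j - 1 else nth 0 c j | j <- iota 0 (size c)].

Lemma atom_unshift k c : shift_digit k @^-1` (atom c) = atom (unshift k c).
Proof.
have sz : size (unshift k c) = size c by rewrite size_map size_iota.
have nthE j : (j < size c)%N ->
    nth 0 (unshift k c) j = if j == k then nth 0 c j - 1 else nth 0 c j.
  by move=> jc; rewrite (nth_map 0%N) ?size_iota// nth_iota.
apply/seteqP; split=> x /=; rewrite /atom/= sz => h j jc; have := h j jc;
  rewrite /shift_digit nthE//; case: eqP => // _.
  by move=> <-; rewrite addrK.
by move=> ->; rewrite subrK.
Qed.

(** Two cylinders over initial digits are nested or disjoint; hence the empty set
is all that has to be added to obtain a pi-system. *)
Definition atoms : set (set bits) := [set A | A = set0 \/ exists c, A = atom c].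

Lemma atoms_setI : setI_closed atoms.
Proof.
move=> A B [->|[c ->]] [->|[c' ->]]; rewrite ?set0I ?setI0; try by left.
have sub (c1 c2 : seq 'Z_q) x : (size c1 <= size c2)%N -> atom c1 x -> atom c2 x ->
    atom c2 `<=` atom c1.
  move=> s12 a1 a2 y b2 k kc; rewrite b2 ?(leq_trans kc)//.
  by rewrite -a2 ?(leq_trans kc)// a1.
have [->|/set0P[x [xc xc']]] := eqVneq (atom c `&` atom c') set0; first by left.
right; have [s|/ltnW s] := leqP (size c) (size c').
  exists c'; apply/seteqP; split=> [y []//|y yc'].
  by split=> //; exact: (sub _ _ x s xc xc' y yc').
exists c; apply/seteqP; split=> [y []//|y yc].
by split=> //; exact: (sub _ _ x s xc' xc y yc).
Qed.

Lemma measurable_atoms : @measurable _ bits = <<s atoms >>.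
Proof.
apply/seteqP; split; last first.
  apply: smallest_sub; first exact: sigma_algebra_measurable.
  by move=> _ [->|[c ->]] //; exact: measurable_atom.
apply: smallest_sub; first exact: smallest_sigma_algebra.
move=> _ [i [B [_ ->]]].
have m : mpred (fun x : g_sigma_algebraType atoms =>
    exists c, (size c = i.+1 /\ B (nth 0 c i)) /\ atom c x).
  apply: mpred_ex => c; apply: mpred_and; first exact: mpred_cst.
  by apply: sub_sigma_algebra; right; exists c.
apply: mpred_ext m => x; split=> [[c [[sc Bc] xc]]|Bx]; first by rewrite xc ?sc.
have szE : size (map x (iota 0 i.+1)) = i.+1 by rewrite size_map size_iota.
have nthE k : (k < i.+1)%N -> nth 0 (map x (iota 0 i.+1)) k = x k.
  by move=> ki; rewrite (nth_map 0%N) ?size_iota// nth_iota.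
exists (map x (iota 0 i.+1)); rewrite nthE//; split=> // k.
by rewrite szE => ki; rewrite nthE.
Qed.

Lemma digit_law_shift k A : measurable A ->
  digit_law (shift_digit k @^-1` A) = digit_law A.
Proof.
move: A; apply: (pi_unique (m1 := distribution digit_law (shift_digit k))
  (m2 := digit_law) measurable_atoms atoms_setI).
- by right; exists [::]; apply/seteqP; split.
- exact: (probability_lty (distribution digit_law (shift_digit k)) measurableT).
move=> _ [->|[c ->]]; first by rewrite !measure0.
transitivity (digit_law (shift_digit k @^-1` (atom c))) => //.
rewrite atom_unshift digit_law_atom /unshift size_map size_iota.
exact: esym (digit_law_atom R c).
Qed.

(** The shift permutes the events X = a cyclically inside E and preserves their
probabilities. *)
Lemma shift_uniform k (X : bits -> 'Z_q) (E : set bits) :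
  measurable E -> (forall a, measurable (E `&` [set x | X x = a])) ->
  (forall x, E (shift_digit k x) <-> E x) ->
  (forall x, E x -> X (shift_digit k x) = X x + 1) ->
  forall a, digit_law (E `&` [set x | X x = a]) = (Q%:R^-1%:E * digit_law E)%E.
Proof.
move=> mE mX Ek Xk.
pose F a := E `&` [set x | X x = a].
have FS a : digit_law (F (a + 1)) = digit_law (F a).
  transitivity (digit_law (shift_digit k @^-1` (F (a + 1)))).
    by apply/esym; apply: digit_law_shift; exact: mX.
  congr (digit_law _); apply/seteqP; split=> x.
    move=> [/Ek Ex XE]; split=> //; apply: (addIr 1).
    exact: etrans (esym (Xk _ Ex)) XE.
  by move=> [Ex <-]; split; [exact/Ek|exact: Xk].
have FE a : digit_law (F a) = digit_law (F 0).
  rewrite -[a]natr_Zp; elim: (nat_of_ord a) => // n IH.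
  by rewrite -natr1 FS.
have sumF : digit_law E = (Q%:R%:E * digit_law (F 0%R))%E.
  have -> : E = E `&` [set x | setT (X x)] by rewrite setIT.
  rewrite measure_levels//.
  rewrite (eq_bigl xpredT) => [|a]; last exact: asboolT.
  rewrite (eq_bigr (fun=> digit_law (F 0))) => [|a _]; last exact: FE.
  by rewrite sumr_const card_ord; apply/esym; exact: mule_natl.
by move=> a; rewrite -/(F a) FE sumF muleA -EFinM mulVf ?mul1e// pnatr_eq0.
Qed.

End ShiftInvariance.

(** * Almost sure events, tails and independence *)

Section AlmostSure.
Context d (T : measurableType d) (R : realType) (P : probability T R).

Lemma ae_prob1 (A : set T) : measurable A -> {ae P, forall x, A x} -> P A = 1%E.
Proof.
move=> mA aeA; apply: full1 => //; apply/negligibleP => //.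
exact: measurableC.
Qed.

Lemma prob1_ae (A : set T) : measurable A -> P A = 1%E -> {ae P, forall x, A x}.
Proof.
move=> mA PA; apply/negligibleP; first exact: measurableC.
exact: full_setC0.
Qed.

Lemma ae_prob_eq (A B : set T) : measurable A -> measurable B ->
  {ae P, forall x, A x <-> B x} -> P A = P B.
Proof.
move=> mA mB [N [mN PN sN]]; apply: (@full_eq _ _ _ _ _ _ (~` N)) => //.
- exact: measurableC.
- by rewrite probability_setC// PN sube0.
- by move=> x Nx; apply: contrapT => h; apply: Nx; apply: sN.
Qed.

Lemma ae_all (I : countType) (A : I -> T -> Prop) :
  (forall i, {ae P, forall x, A i x}) -> {ae P, forall x, forall i, A i x}.
Proof.
move=> aeA.
have : {ae P, forall x, forall n : nat,
    (if @choice.unpickle I n is Some i then A i x else True)}.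
  apply: ae_foralln => n; case: choice.unpickle => [i|]; first exact: aeA.
  exact: aeW.
apply: filterS => x h i; have := h (choice.pickle i).
by rewrite choice.pickleK.
Qed.

End AlmostSure.

Section GeometricTails.
Variable R : realType.

Lemma geometric_eq0 (p : \bar R) (K rho : R) n0 : 0 <= rho < 1 -> (0 <= p)%E ->
  (forall n, (n0 <= n)%N -> (p <= (K * rho ^+ n)%:E)%E) -> p = 0%E.
Proof.
move=> /andP[r0 r1]; case: p => [p| |//]; last by move=> _ /(_ n0 (leqnn _)).
rewrite lee_fin => p0 h; congr (_%:E); apply/eqP; rewrite eq_le p0 andbT.
have cv : K * rho ^+ n @[n --> \oo] --> K * 0.
  by apply: cvgMr; apply: cvg_expr; rewrite ger0_norm.
rewrite mulr0 in cv; rewrite -(cvg_lim _ cv)//.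
apply: limr_ge; first by apply/cvg_ex; exists 0.
by near=> n; have := h n; rewrite lee_fin; apply; near: n; exact: nbhs_infty_ge.
Unshelve. all: by end_near. Qed.

Lemma geometric_tail (K rho : R) k : 0 <= K -> 0 <= rho < 1 ->
  (\sum_(k <= i <oo) (K * rho ^+ i)%:E <= (K * rho ^+ k / (1 - rho))%:E)%E.
Proof.
move=> K0 /andP[r0 r1]; have r1' : 0 < 1 - rho by rewrite subr_gt0.
apply: lime_le; first by apply: is_cvg_nneseries => n _ _; rewrite lee_fin mulr_ge0// exprn_ge0.
apply: nearW => n; rewrite sumEFin lee_fin ler_pdivlMr// mulr_suml.
have [kn|nk] := leqP k n; last first.
  by rewrite big_geq ?mulr_ge0 ?exprn_ge0// ltnW.
suff -> : \sum_(k <= i < n) K * rho ^+ i * (1 - rho) = K * rho ^+ k - K * rho ^+ n.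
  by rewrite lerBlDr lerDl mulr_ge0// exprn_ge0.
have tE := telescope_sumr (fun i => K * rho ^+ i) kn.
transitivity (- (K * rho ^+ n - K * rho ^+ k)); last by rewrite opprB.
rewrite -tE -sumrN.
by apply: eq_bigr => i _; rewrite opprB mulrBr mulr1 -mulrA -exprSr.
Qed.

Lemma union_tail d (T : measurableType d) (P : probability T R)
    (F : nat -> set T) (K rho : R) k : 0 <= K -> 0 <= rho < 1 ->
  (forall n, measurable (F n)) ->
  (forall n, (k <= n)%N -> (P (F n) <= (K * rho ^+ n)%:E)%E) ->
  (P [set x | exists2 n, (k <= n)%N & F n x] <= (K * rho ^+ k / (1 - rho))%:E)%E.
Proof.
move=> K0 r01 mF PF; apply: le_trans (geometric_tail k K0 r01).
have mU : mpred (fun x => exists2 n, (k <= n)%N & F n x).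
  by apply: mpred_ex2 => n; [exact: mpred_cst|exact: mF].
apply: (@le_trans _ _ (\sum_(k <= n <oo) P (F n))%E).
  apply: measure_sigma_subadditive_tail => //.
  move=> x [n kn Fx]; exists n => //=.
  by apply/negP; rewrite -leqNgt.
rewrite eseries_cond [leRHS]eseries_cond; apply: lee_nneseries => [n _ _|n /= kn] //.
exact: PF.
Qed.

End GeometricTails.

Section IndependenceCriterion.
Context d dS (W : measurableType d) (S : measurableType dS).
Variables (R : realType) (P : probability W R) (m : probability S R).
Variables (V : eqType) (X : V -> {mfun W >-> S}) (G : set (set S)).
Hypotheses (mG : @measurable _ S = <<s G >>) (GI : setI_closed G) (GT : G setT).
Hypothesis PG : forall (s : seq V) (B : V -> set S), uniq s -> (forall v, G (B v)) ->
  P [set x | forall v, v \in s -> B v (X v x)] = (\prod_(v <- s) m (B v))%E.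

Let measurable_event (s : seq V) (B : V -> set S) : (forall v, measurable (B v)) ->
  measurable [set x | forall v, v \in s -> B v (X v x)].
Proof.
move=> mB; elim: s => [|v s IH]; first exact: (mpred_ext _ (mpred_cst W True)).
apply: mpred_ext (mpred_and (P := fun x => B v (X v x)) _ IH) => [x|].
  split=> [[Bv h] w|h]; first by rewrite inE => /orP[/eqP -> //|/h].
  by split=> [|w ws]; apply: h; rewrite inE ?eqxx// ws orbT.
rewrite /mpred (_ : [set x | _] = X v @^-1` B v)//.
exact: measurable_funPTI.
Qed.

(** The product rule extends from a generating pi-system to all measurable sets one
coordinate at a time, as both sides are measures in the set attached to that
coordinate. *)
Lemma product_rule_pi (s : seq V) (B : V -> set S) : uniq s ->
  (forall v, measurable (B v)) ->
  P [set x | forall v, v \in s -> B v (X v x)] = (\prod_(v <- s) m (B v))%E.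
Proof.
(* t lists the coordinates whose sets are no longer confined to G *)
suff H (t : seq V) : forall s B, uniq s -> (forall v, measurable (B v)) ->
    (forall v, v \notin t -> G (B v)) ->
    P [set x | forall v, v \in s -> B v (X v x)] = (\prod_(v <- s) m (B v))%E.
  move=> us mB; pose B' v := if v \in s then B v else setT.
  have B'E v : v \in s -> B' v = B v by rewrite /B' => ->.
  have := H s s B' us; rewrite (eq_big_seq (fun v => m (B v))) => [<-|v /B'E ->//].
  - congr (P _); apply/seteqP; split=> x /= h v vs; have := h v vs;
      by rewrite B'E.
  - by move=> v; rewrite /B'; case: ifP.
  - by move=> v; rewrite /B' => /negbTE ->.
elim: t => [|v0 t IH] {s B}s B us mB BG; first by apply: PG => // v; exact: BG.
have [v0s|v0s] := boolP (v0 \in s); last first.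
  pose B' v := if v == v0 then setT else B v.
  have B'E v : v \in s -> B' v = B v.
    by rewrite /B'; case: eqP => // -> v0s'; rewrite v0s' in v0s.
  have := IH s B' us; rewrite (eq_big_seq (fun v => m (B v))) => [<-|v /B'E ->//].
  - congr (P _); apply/seteqP; split=> x /= h v vs; have := h v vs;
      by rewrite B'E.
  - by move=> v; rewrite /B'; case: ifP.
  - move=> v vt; rewrite /B'; case: eqP => // /eqP vv0.
    by apply: BG; rewrite inE negb_or vv0.
pose s' := rem v0 s; have s's : perm_eq s (v0 :: s') by exact: perm_to_rem.
have v0s' : v0 \notin s' by rewrite mem_rem_uniqF.
have us' : uniq s' by exact: rem_uniq.
rewrite (perm_big _ s's) big_cons /=.
pose E := [set x | forall v, v \in s' -> B v (X v x)].
have mE : measurable E by exact: measurable_event.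
have splitE A : [set x | forall v, v \in s -> (if v == v0 then A else B v) (X v x)]
    = X v0 @^-1` A `&` E.
  apply/seteqP; split=> x /=.
    move=> h; split; first by have := h v0 v0s; rewrite eqxx.
    move=> v vs'; have := h v; rewrite (perm_mem s's) inE vs' orbT => /(_ isT).
    by case: eqP => // vv0; rewrite -vv0 vs' in v0s'.
  move=> [Ax Ex] v; rewrite (perm_mem s's) inE; case: eqP => [->//|_ /=].
  exact: Ex.
have prodE A : (\prod_(v <- s') m (if v == v0 then A else B v) =
    \prod_(v <- s') m (B v))%E.
  apply: eq_big_seq => v vs'; case: eqP => // vv0.
  by rewrite -vv0 vs' in v0s'.
set c := (\prod_(v <- s') m (B v))%E.
have [r cE r0] : exists2 r : R, c = r%:E & 0 <= r.
  rewrite /c; elim: (s') => [|v l [r rE r0]]; first by exists 1; rewrite ?big_nil.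
  exists (fine (m (B v)) * r); rewrite ?big_cons ?rE; last first.
    by rewrite mulr_ge0// fine_ge0.
  by rewrite EFinM fineK// fin_num_measure.
pose nu1 := pushforward (mrestr P mE) (X v0).
pose nu2 := mscale (NngNum r0) m.
have nuE : forall A, measurable A -> nu1 A = nu2 A.
  apply: (pi_unique mG GI GT).
    rewrite /= /pushforward /mrestr preimage_setT setTI.
    exact: probability_lty.
  move=> A GA; rewrite /= /pushforward /mrestr /mscale/= -splitE.
  have mA : measurable A by rewrite mG; exact: sub_sigma_algebra.
  rewrite (IH s (fun v => if v == v0 then A else B v)) //; first last.
  - move=> v vt; case: eqP => // /eqP vv0.
    by apply: BG; rewrite inE negb_or vv0.
  - by move=> v; case: ifP.
  by rewrite (perm_big _ s's) big_cons eqxx prodE -/c cE muleC.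
transitivity (nu1 (B v0)).
  rewrite /nu1 /= /pushforward /mrestr -splitE; congr (P _).
  by apply/seteqP; split=> x /= h v vs; have := h v vs; case: eqP => // ->.
by rewrite nuE// /nu2 /mscale/= -cE muleC.
Qed.

End IndependenceCriterion.

(** * The field of labels *)

Section LabelField.
Variables (R : realType) (V : countType) (q : nat).
Local Notation Q := (Zp_trunc q).+2.
Local Notation bits := (pspace nat 'Z_q).
Local Notation digit_law := (@digit_law R q).

(** One sequence of digits is dealt out to all vertices along an enumeration of the
pairs of a vertex and an index. *)
Definition label_field (x : bits) : pspace V bits :=
  fun v n => x (choice.pickle (v, n)).

Lemma measurable_label_field_digit v n c : mpred (fun x => label_field x v n = c).
Proof.
rewrite /mpred -[X in measurable X]setTI.
exact: (@measurable_coord nat _ 'Z_q (choice.pickle (v, n)) measurableT [set c]).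
Qed.

Definition label_field_at v (x : bits) : bits := label_field x v.

Lemma measurable_label_field_at v : measurable_fun setT (label_field_at v).
Proof.
apply: measurable_pspace => n.
exact: (@measurable_coord nat _ 'Z_q (choice.pickle (v, n))).
Qed.

HB.instance Definition _ v := isMeasurableFun.Build _ _ _ _ (label_field_at v)
  (measurable_label_field_at v).

Lemma measurable_label_field : measurable_fun setT label_field.
Proof. apply: measurable_pspace => v; exact: measurable_label_field_at. Qed.

HB.instance Definition _ := isMeasurableFun.Build _ _ _ _ label_field measurable_label_field.

Lemma label_field_shift v n x w k : label_field (shift_digit (choice.pickle (v, n)) x) w k =
  if (w == v) && (k == n) then label_field x w k + 1 else label_field x w k.
Proof.
rewrite /label_field /shift_digit -xpair_eqE.
by rewrite (inj_eq (pcan_inj (@choice.pickleK _))).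
Qed.

Lemma measurable_label_field_atom v (c : seq 'Z_q) : mpred (fun x => atom c (label_field x v)).
Proof.
have := measurable_label_field_at v measurableT (measurable_atom c).
by rewrite setTI.
Qed.

(** Each digit of v is uniform given the earlier digits of v and an event that does
not depend on v, because shifting that digit leaves both alone. *)
Lemma label_field_atom v c (E : set bits) : measurable E ->
  (forall (n : nat) x, E (shift_digit (choice.pickle (v, n)) x) <-> E x) ->
  digit_law (E `&` [set x | atom c (label_field x v)]) =
  (((Q ^ size c)%:R^-1)%:E * digit_law E)%E.
Proof.
move=> mE Ev; elim/last_ind: c => [|c a IH].
  rewrite expn0 invr1 mul1e; congr (digit_law _); apply/seteqP.
  by split=> [x []|].
pose E' := E `&` [set x | atom c (label_field x v)].
rewrite (_ : E `&` _ = E' `&` [set x | label_field x v (size c) = a]); last first.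
  apply/seteqP; split=> x /=.
    by move=> [Ex /atom_rcons[ac xa]].
  by move=> [[Ex ac] xa]; split=> //; apply/atom_rcons.
rewrite (@shift_uniform R q (choice.pickle (v, size c))
  (fun x => label_field x v (size c))) ?IH.
- by rewrite muleA -EFinM -invfM -natrM size_rcons expnS.
- apply: measurableI => //; exact: measurable_label_field_atom.
- move=> b; apply: measurableI; last exact: measurable_label_field_digit.
  apply: measurableI => //; exact: measurable_label_field_atom.
- move=> x; split=> -[/Ev Ex ac]; split=> //= k kc; have := ac k kc;
    by rewrite label_field_shift (ltn_eqF kc) andbF.
- by move=> x _; rewrite label_field_shift !eqxx.
Qed.

Lemma label_field_atoms (s : seq V) (B : V -> set bits) : uniq s ->
  (forall v, atoms (B v)) ->
  digit_law [set x | forall v, v \in s -> B v (label_field x v)] =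
  (\prod_(v <- s) digit_law (B v))%E.
Proof.
move=> us BA; elim: s us => [|v s IH] /=.
  rewrite big_nil => _; apply: ae_prob1; last by apply: aeW => x v.
  rewrite (_ : [set x | _] = setT)//.
  by apply/seteqP; split.
move=> /andP[vs us]; rewrite big_cons -IH//.
set E := [set x | forall w, w \in s -> B w (label_field x w)].
rewrite (_ : [set x | _] = E `&` [set x | B v (label_field x v)]); last first.
  apply/seteqP; split=> x /=.
    move=> h; split=> [w ws|]; first by apply: h; rewrite inE ws orbT.
    by apply: h; rewrite inE eqxx.
  by move=> [h hv] w; rewrite inE => /orP[/eqP -> //|/h].
have [B0|[c Bc]] := BA v.
  have E0 : E `&` [set x | B v (label_field x v)] = set0.
    by apply/seteqP; split=> x //= [_]; rewrite B0.
  by rewrite E0 B0 !measure0 mul0e.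
rewrite Bc label_field_atom ?digit_law_atom//.
- have mB w : measurable (B w) by case: (BA w) => [->//|[c' ->]]; exact: measurable_atom.
  have := measurable_box s mB.
  move=> /(measurable_label_field measurableT); rewrite setTI.
  by apply: mpred_ext.
- move=> n x; split=> h w ws; have := h w ws.
    congr (B w _); apply/funext => k; rewrite label_field_shift.
    by case: eqP => // wv; rewrite -wv ws in vs.
  congr (B w _); apply/funext => k; rewrite label_field_shift.
  by case: eqP => // wv; rewrite -wv ws in vs.
Qed.

Lemma label_field_iid (s : seq V) (B : V -> set bits) : uniq s ->
  (forall v, measurable (B v)) ->
  digit_law [set x | forall v, v \in s -> B v (label_field x v)] =
  (\prod_(v <- s) digit_law (B v))%E.
Proof.
move=> us mB.
apply: (product_rule_pi (X := fun v => [the {mfun _ >-> _} of label_field_at v])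
   (measurable_atoms q) (@atoms_setI q)) => //.
- by right; exists [::]; apply/seteqP; split.
- exact: label_field_atoms.
Qed.

(** Two labels agree on N digits with probability Q ^- N, since shifting a digit of
one of them shifts the difference. *)
Lemma labels_distinct_ae :
  {ae digit_law, forall x, labels_distinct (label_field x)}.
Proof.
apply: ae_all => u; apply: ae_all => v.
have [->|uv] := pselect (u = v); first exact: aeW.
have mE N : mpred (fun x => forall n, (n < N)%N -> label_field x u n.+1 = label_field x v n.+1).
  apply: mpred_all => n; apply: mpred_imp (mpred_cst _ _) _.
  apply: (mpred_rel2 (xi := label_field) (measurable_label_field_digit) (fun a b => a = b)).
have PE N : digit_law [set x | forall n, (n < N)%N -> label_field x u n.+1 = label_field x v n.+1]
    = ((Q ^ N)%:R^-1)%:E.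
  elim: N => [|N IH].
    by rewrite expn0 invr1; apply: ae_prob1; [exact: mE|exact: aeW].
  rewrite (_ : [set x | _] =
    [set x | forall n, (n < N)%N -> label_field x u n.+1 = label_field x v n.+1]
    `&` [set x | label_field x u N.+1 - label_field x v N.+1 = 0]); last first.
    apply/seteqP; split=> x /=.
      move=> h; split=> [n nN|]; first by apply: h; rewrite ltnW.
      by rewrite h ?subrr.
    move=> [h /eqP]; rewrite subr_eq0 => /eqP hN n.
    by rewrite ltnS leq_eqVlt => /orP[/eqP ->|/h].
  rewrite (@shift_uniform R q (choice.pickle (u, N.+1))
    (fun x => label_field x u N.+1 - label_field x v N.+1)) ?IH//.
  - by rewrite -EFinM -invfM -natrM expnS.
  - exact: mE.
  - move=> a; apply: measurableI; first exact: mE.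
    exact: (mpred_rel2 (xi := label_field) (measurable_label_field_digit) (fun b c => b - c = a)).
  - move=> x; split=> h n nN; have := h n nN;
      by rewrite !label_field_shift !eqSS (ltn_eqF nN) !andbF.
  - move=> x _; rewrite !label_field_shift !eqxx/=.
    by case: eqP => [vu|_]; rewrite ?[_ - _ + 1]addrAC//; case: uv.
pose A := [set x | u <> v -> exists n, label_field x u n.+1 <> label_field x v n.+1].
have mA : mpred A.
  apply: mpred_imp (mpred_cst _ _) _; apply: mpred_ex => n.
  exact: (mpred_rel2 (xi := label_field) (measurable_label_field_digit) (fun a b => a <> b)).
apply/negligibleP; first exact: measurableC.
apply: (@geometric_eq0 R _ 1 Q%:R^-1 0) => // [|N _].
  by rewrite invr_ge0 ler0n invf_lt1 ?ltr1n ?ltr0n.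
rewrite mul1r exprVn -natrX -PE; apply: le_measure; rewrite ?inE//.
- exact: measurableC.
- exact: mE.
move=> x /= nA n nN; apply: contrapT => ne; apply: nA => _.
by exists n.
Qed.

End LabelField.

(** * The law of the spins *)

Section UniqueChoice.
Variable q : nat.

Definition the_or0 (C : 'Z_q -> Prop) : 'Z_q := xget 0 [set c | C c].

Lemma the_or0P (C : 'Z_q -> Prop) c : (forall a b, C a -> C b -> a = b) ->
  C c -> the_or0 C = c.
Proof.
move=> Cu Cc; apply: Cu => //.
by apply: (@xgetPex _ 0 [set c | C c]); exists c.
Qed.

Lemma mpred_the_or0 d (T : measurableType d) (C : T -> 'Z_q -> Prop) c :
  (forall x a b, C x a -> C x b -> a = b) ->
  (forall a, mpred (fun x => C x a)) -> mpred (fun x => the_or0 (C x) = c).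
Proof.
move=> Cu mC.
have m : mpred (fun x => C x c \/ (c = 0 /\ forall a, ~ C x a)).
  apply: mpred_or => //; apply: mpred_and; first exact: mpred_cst.
  by apply: mpred_all => a; apply: mpred_not.
apply: mpred_ext m => x; split=> [[Cc|[-> nC]]|<-].
- by apply: the_or0P => //; exact: Cu.
- by rewrite /the_or0 xgetPN.
- have [[a Ca]|nC] := pselect (exists a, C x a).
    by left; apply: (@xgetPex _ 0 [set c | C x c]); exists a.
  have nC' a : ~ C x a by move=> Ca; apply: nC; exists a.
  by right; split=> //; rewrite /the_or0 xgetPN.
Qed.

End UniqueChoice.

Section ChainSpins.
Variables (R : realType) (V : countType) (e : rel V) (q : nat) (f : nat -> nat).
Hypotheses (e_sym : symmetric e) (e_conn : graph_connected e).
Hypothesis e_lf : locally_finite_graph e.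
Hypothesis f_mono : {homo f : i j / (i <= j)%N}.
Hypothesis f_big : forall j, (3 * j < f j)%N.
Variable rho : rel V.
Hypotheses (rho_sym : symmetric rho) (rho_e : subrel rho e).
Hypothesis rho_infinite : exists z, ~ finite_at rho z.
Hypothesis rho_unique : forall y z, ~ finite_at rho y -> ~ finite_at rho z ->
  conn rho y z.
Hypothesis rho_tame : forall u, exists2 j0, (0 < j0)%N & tame e f rho u j0.

Local Notation Q := (Zp_trunc q).+2.
Local Notation bits := (pspace nat 'Z_q).
Local Notation digit_law := (@digit_law R q).
Local Notation label_field := (@label_field V q).

Let f_gt j : (j < f j)%N. Proof. by have := f_big j; lia. Qed.

Definition spin u (x : bits) : 'Z_q := the_or0 (chain_spin e f rho (label_field x) u).

Definition spin_config (x : bits) : pspace V 'Z_q := fun u => spin u x.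

Lemma measurable_spin u c : mpred (fun x => spin u x = c).
Proof.
apply: mpred_the_or0 => [x a b|a].
  exact: chain_spin_uniq (connxx _ _).
apply: (@mpred_chain_spin _ bits V e q f (fun=> rho) label_field).
  by move=> *; exact: mpred_cst.
exact: measurable_label_field_digit.
Qed.

Lemma measurable_spin_set u (B : set 'Z_q) : mpred (fun x => B (spin u x)).
Proof.
have m : mpred (fun x => exists c, B c /\ spin u x = c).
  apply: mpred_ex => c; apply: mpred_and; first exact: mpred_cst.
  exact: measurable_spin.
by apply: mpred_ext m => x; split=> [[c [? ->]]|] //; exists (spin u x).
Qed.

Lemma measurable_spin_config : measurable_fun setT spin_config.
Proof.
apply: measurable_pspace => u _ B _; rewrite setTI.
exact: measurable_spin_set.
Qed.

Lemma spin_exists u (x : bits) : labels_distinct (label_field x) ->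
  exists c, chain_spin e f rho (label_field x) u c.
Proof.
move=> lx; have [j0 j00 tm] := rho_tame u.
have [n [c [z [a nz]]]] := chain_reaches e_conn e_lf f_big lx j00 tm rho_infinite.
by exists c, (f j0), n, z.
Qed.

Lemma spinE u c (x : bits) : chain_spin e f rho (label_field x) u c -> spin u x = c.
Proof. by apply: the_or0P => a b; apply: chain_spin_uniq (connxx _ _). Qed.

Lemma spinP u (x : bits) : labels_distinct (label_field x) ->
  chain_spin e f rho (label_field x) u (spin u x).
Proof. by move=> /(spin_exists u)[c h]; rewrite (spinE h). Qed.

Lemma spin_conn u v (x : bits) : labels_distinct (label_field x) -> conn rho u v ->
  spin u x = spin v x.
Proof.
move=> lx uv; apply/esym; apply: spinE.
by apply: chain_spin_conn uv _ => //; exact: spinP.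
Qed.

Lemma spin_infinite u (x : bits) : ~ finite_at rho u -> spin u x = 0.
Proof. by move=> nu; apply: spinE; exists 0%N, 0%N, u. Qed.

Local Notation shift u := (shift_digit (choice.pickle (u, 0%N))).

Lemma labels_shift (u : V) (x : bits) :
  labels_distinct (label_field (shift u x)) <-> labels_distinct (label_field x).
Proof.
by split=> h v w /h[n hn]; exists n; move: hn; rewrite !label_field_shift !andbF.
Qed.

Lemma spin_shift (u : V) (x : bits) : labels_distinct (label_field x) -> finite_at rho u ->
  spin u (shift u x) = spin u x + 1.
Proof.
move=> lx fu; apply: spinE.
apply: (chain_spin_shift f_gt (xi := label_field x)) => //.
- by move=> v k; rewrite label_field_shift andbF.
- by move=> v /eqP/negbTE vu; rewrite label_field_shift vu.
- by rewrite label_field_shift !eqxx.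
- exact: spinP.
Qed.

Lemma spin_shift_avoid (u : V) j0 v (x : bits) : labels_distinct (label_field x) ->
  level e f rho u j0 -> (forall j, level e f rho v j -> (j0 <= j)%N) ->
  ~ conn rho v u -> spin v (shift u x) = spin v x.
Proof.
move=> lx uj vj nvu; apply: spinE.
apply: (chain_spin_shift_avoid f_gt (xi := label_field x) (u0 := u) rho_sym _ _ uj) => //.
- by move=> w k; rewrite label_field_shift andbF.
- by move=> w /eqP/negbTE wu; rewrite label_field_shift wu.
- exact: spinP.
Qed.

Let LD := [set x : bits | labels_distinct (label_field x)].

Let mLD : measurable LD.
Proof. exact: (mpred_labels_distinct (@measurable_label_field_digit V q)). Qed.

Lemma drop_labels (A : set bits) : measurable A ->
  digit_law (A `&` LD) = digit_law A.
Proof.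
move=> mA; apply: full_setI => //; apply: ae_prob1 => //.
exact: labels_distinct_ae.
Qed.

Lemma spin_uniform (u : V) (E : set bits) a : measurable E -> finite_at rho u ->
  (forall x, LD x -> (E (shift u x) <-> E x)) ->
  digit_law (E `&` [set x | spin u x = a]) = (Q%:R^-1%:E * digit_law E)%E.
Proof.
move=> mE fu Eu.
have mEs b : measurable (E `&` [set x | spin u x = b]).
  by apply: measurableI => //; exact: measurable_spin.
rewrite -(drop_labels (mEs a)) -(drop_labels mE) setIAC.
apply: (@shift_uniform R q (choice.pickle (u, 0%N)) (spin u)).
- exact: measurableI.
- by move=> b; rewrite setIAC; apply: measurableI.
- move=> x; split=> -[Ex lx].
    have lx' := (labels_shift u x).1 lx.
    by split=> //; apply/(Eu _ lx').
  by split; [apply/(Eu _ lx)|apply/(labels_shift u x)].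
- by move=> x [_ lx]; exact: spin_shift.
Qed.

Lemma spin_uniform_set (u : V) (E : set bits) (B : set 'Z_q) : measurable E ->
  finite_at rho u -> (forall x, LD x -> (E (shift u x) <-> E x)) ->
  digit_law (E `&` [set x | B (spin u x)]) =
  (digit_law [set x | B (spin u x)] * digit_law E)%E.
Proof.
move=> mE fu Eu.
have sumE (D : set bits) : measurable D ->
    (forall x, LD x -> (D (shift u x) <-> D x)) ->
    digit_law (D `&` [set x | B (spin u x)]) =
    ((\sum_(a < Q | `[< B a >]) Q%:R^-1%:E) * digit_law D)%E.
  move=> mD Du.
  rewrite measure_levels; last first.
    by move=> a; apply: measurableI => //; exact: measurable_spin.
  rewrite ge0_sume_distrl; last by move=> *; rewrite lee_fin invr_ge0.
  by apply: eq_bigr => a _; exact: spin_uniform.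
rewrite sumE//; congr (_ * _)%E; rewrite -[in RHS](setTI [set x | _]) sumE//.
by rewrite probability_setT mule1.
Qed.

Lemma min_level (s : seq V) : (exists2 v, v \in s & finite_at rho v) ->
  exists v j, [/\ v \in s, finite_at rho v, level e f rho v j &
    forall w i, w \in s -> level e f rho w i -> (j <= i)%N].
Proof.
move=> [v0 v0s fv0].
have [j0 _ tm] := rho_tame v0.
have [i0 li0] := tame_level e_conn e_lf f_big tm rho_infinite fv0.
have ex : exists j, `[< exists2 v, v \in s & level e f rho v j >].
  by exists i0; apply/asboolP; exists v0.
case: (ex_minnP ex) => j /asboolP[v vs vj] jmin; exists v, j; split=> //.
  by case: vj => F [hF _]; exists F.
by move=> w i ws wi; apply: jmin; apply/asboolP; exists w.
Qed.

(** A vertex u of least level is split off: shifting its digit 0 leaves the other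
spins alone, so that its own spin is uniform given them. If no cluster is
finite, there is at most one vertex, as the infinite cluster is unique. *)
Lemma spin_product (s : seq V) (B : V -> set 'Z_q) : uniq s ->
  {in s &, forall u v, u != v -> ~ conn rho u v} ->
  digit_law [set x | forall v, v \in s -> B v (spin v x)] =
  (\prod_(v <- s) digit_law [set x | B v (spin v x)])%E.
Proof.
elim: (size s) {-2}s (leqnn (size s)) => {s} [|n IH] s sn us sep.
  move: sn; rewrite leqn0 size_eq0 => /eqP ->; rewrite big_nil.
  apply: ae_prob1; last by apply: aeW => x v.
  rewrite (_ : [set x | _] = setT)//.
  by apply/seteqP; split.
have [fin|nfin] := pselect (exists2 v, v \in s & finite_at rho v); last first.
  case: s sn us sep nfin => [|v [|w s]] sn us sep nfin; first exact: (IH [::]).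
    rewrite big_seq1; congr (digit_law _); apply/seteqP; split=> x /=.
      by apply; rewrite inE.
    by move=> Bx w; rewrite inE => /eqP ->.
  exfalso; apply: (sep v w); rewrite ?inE ?eqxx ?orbT//.
    by move: us; rewrite /= inE negb_or => /andP[/andP[]].
  by apply: rho_unique => h; apply: nfin; [exists v|exists w];
     rewrite ?inE ?eqxx ?orbT.
have [u [j [uS fu uj umin]]] := min_level fin.
pose s' := rem u s; have s's : perm_eq s (u :: s') by exact: perm_to_rem.
have us' : uniq s' by exact: rem_uniq.
have us'n : u \notin s' by rewrite mem_rem_uniqF.
have s'sub v : v \in s' -> v \in s by exact: mem_rem.
have s'n : (size s' <= n)%N by move: sn; rewrite (perm_size s's).
rewrite (perm_big _ s's) big_cons /= -(IH s')//; last first.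
  by move=> v w /s'sub vs /s'sub ws; exact: sep.
pose E := [set x | forall v, v \in s' -> B v (spin v x)].
have mE : measurable E.
  suff : mpred (fun x => forall v, v \in s' -> B v (spin v x)) by [].
  apply: mpred_all => v; apply: mpred_imp (mpred_cst _ _) _.
  exact: measurable_spin_set.
rewrite -spin_uniform_set//; last first.
  move=> x lx.
  have spE v : v \in s' -> spin v (shift u x) = spin v x.
    move=> vs'; apply: (spin_shift_avoid lx uj) => [i|].
      by apply: umin; exact: s'sub.
    apply: sep => //; first exact: s'sub.
    by apply: contraNneq us'n => <-.
  by split=> h v vs'; have := h v vs'; rewrite spE.
congr (digit_law _); apply/seteqP; split=> x /=.
  move=> h; split=> [v /s'sub|]; first exact: h.
  exact: h.
move=> [Ex Bu] v; rewrite (perm_mem s's) inE => /orP[/eqP -> //|].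
exact: Ex.
Qed.

End ChainSpins.

(** * Percolation configurations and the spin law *)

Section OpenGraph.
Variables (V : countType) (e : rel V).
Hypotheses (e_sym : symmetric e) (e_irr : irreflexive e).
Implicit Types w : pspace (eindex e) bool.

Lemma open_adj_sym w : symmetric (open_adj w).
Proof.
move=> u v; apply/asboolP/asboolP => -[a [aE wa]]; exists a; split=> //;
  by rewrite aE fsetUC.
Qed.

Lemma edge_ends (a : edge e) u v : val a = [fset u; v]%fset -> e u v.
Proof.
case: a => A /= /asboolP[x [y [exy ->]]] /fsetP h.
have := h u; rewrite !inE eqxx /= => /orP hu.
have := h v; rewrite !inE eqxx orbT => /orP hv.
have xy : x != y by apply: contraTneq exy => ->; rewrite e_irr.
case: hu => /eqP ?; case: hv => /eqP ?; subst u v => //.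
- by have := h y; rewrite !inE eqxx orbT orbb => /esym/eqP yx; rewrite yx eqxx in xy.
- by rewrite e_sym.
- by have := h x; rewrite !inE eqxx /= orbb => /esym/eqP yx; rewrite yx eqxx in xy.
Qed.

Lemma open_adj_e w : subrel (open_adj w) e.
Proof. by move=> u v /asboolP[a [/edge_ends]]. Qed.

Lemma measurable_open_adj u v :
  mpred (fun w : pspace (eindex e) bool => open_adj w u v).
Proof.
have m : mpred (fun w : pspace (eindex e) bool =>
    exists a : edge e, val a = [fset u; v]%fset /\ w a).
  apply: mpred_ex => a; apply: mpred_and; first exact: mpred_cst.
  have := @measurable_coord (edge e) _ bool a measurableT [set true] I.
  by rewrite setTI; apply: mpred_ext.
by apply: mpred_ext m => w; split=> /asboolP.
Qed.

Lemma finite_atP (rho : rel V) u :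
  finite_at rho u <-> finite_set [set v | conn rho u v].
Proof.
split=> [[F hF]|fin].
  rewrite (_ : [set v | _] = [set` F]); first exact: finite_fset.
  by apply/seteqP; split=> v /=; [move=> /hF|move=> vF; apply/hF].
exists (fset_set [set v | conn rho u v]) => v.
rewrite in_fset_set//; split=> [/set_mem//|uv]; exact/mem_set.
Qed.

Lemma unique_infinite_clusterP w : unique_infinite_cluster w ->
  (exists z, ~ finite_at (open_adj w) z) /\
  (forall y z, ~ finite_at (open_adj w) y -> ~ finite_at (open_adj w) z ->
     conn (open_adj w) y z).
Proof.
move=> [C [[[u uC] Cinf] Cu]]; split.
  by exists u => /finite_atP; rewrite uC in Cinf.
move=> y z ny nz.
have CE x : ~ finite_at (open_adj w) x -> C = open_cluster w x.
  move=> nx; apply: Cu; split; first by exists x.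
  by move=> fx; apply: nx; apply/finite_atP.
have : open_cluster w z z by exact: connxx.
by rewrite -(CE z nz) (CE y ny).
Qed.

End OpenGraph.

Section SpinLawUnique.
Variables (R : realType) (V : countType) (e : rel V) (q : nat).
Local Notation Q := (Zp_trunc q).+2.
Hypothesis e_irr : irreflexive e.
Variable w : pspace (eindex e) bool.
Local Notation conn := (conn (open_adj w)).

Let measurable_at (B : set 'Z_q) v : measurable [set s : spins e q | B (s v)].
Proof.
have := @measurable_coord V _ 'Z_q v measurableT B I.
by rewrite setTI.
Qed.

Lemma spin_law_marginal (m1 m2 : probability (spins e q) R) v (B : set 'Z_q) :
  spin_law w m1 -> spin_law w m2 ->
  m1 [set s | B (s v)] = m2 [set s | B (s v)].
Proof.
move=> [_ _ fin1 inf1] [_ _ fin2 inf2].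
have [fv|nv] := pselect (finite_set (open_cluster w v)).
  have mE (m : probability (spins e q) R) :
      (forall u a, finite_set (open_cluster w u) ->
         m [set s | s u = a] = (q%:R^-1)%:E) ->
      m [set s | B (s v)] = (\sum_(a < Q | `[< B a >]) (q%:R^-1)%:E)%E.
    move=> fin.
    have mv a : measurable (setT `&` [set s : spins e q | s v = a]).
      by rewrite setTI; exact: (measurable_at [set a]).
    have := @measure_levels _ _ _ m _ (fun s : spins e q => s v) setT B mv.
    rewrite setTI => ->; apply: eq_bigr => a _; rewrite setTI; exact: fin.
  by rewrite !mE.
have mE (m : probability (spins e q) R) : m [set s | s v = 0] = 1%E ->
    m [set s | B (s v)] = m [set s | B 0].
  move=> m1'; apply: (@full_eq _ _ _ m _ _ [set s : spins e q | s v = 0]).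
  - exact: measurable_at.
  - exact: (@mpred_cst _ (spins e q) (B 0)).
  - exact: (measurable_at [set 0]).
  - exact: m1'.
  - by move=> s /= ->.
rewrite mE ?inf1// [RHS]mE ?inf2//.
have [B0|B0] := pselect (B 0).
  rewrite (_ : [set s | _] = setT); first by rewrite !probability_setT.
  by apply/seteqP; split.
rewrite (_ : [set s | _] = set0); first by rewrite !measure0.
by apply/seteqP; split.
Qed.

(** Spins are almost surely constant on clusters, so a box constrains one
representative per cluster; the product rule then reduces its probability to
marginals, which [spin_law] prescribes. *)
Lemma spin_law_unique (m1 m2 : probability (spins e q) R) :
  spin_law w m1 -> spin_law w m2 -> forall A, measurable A -> m1 A = m2 A.
Proof.
move=> l1 l2; apply: (@pspace_unique V _ 'Z_q) => [|s B _].
  exact: (probability_lty m1 measurableT).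
(* the first vertex of s in the cluster of v *)
pose rep v := head v [seq u <- s | `[< conn u v >]].
have repP v : v \in s -> rep v \in s /\ conn (rep v) v.
  move=> vs; have : v \in [seq u <- s | `[< conn u v >]].
    by rewrite mem_filter vs asboolT//; exact: connxx.
  rewrite /rep; case E : [seq _ <- _ | _] => [//|u l] _ /=.
  have : u \in [seq u <- s | `[< conn u v >]] by rewrite E inE eqxx.
  by rewrite mem_filter => /andP[/asboolP]; split.
have rep_eq u v : u \in s -> v \in s -> conn u v -> rep u = rep v.
  move=> us vs uv; rewrite /rep.
  have -> : [seq x <- s | `[< conn x u >]] = [seq x <- s | `[< conn x v >]].
    apply: eq_filter => x; apply/asboolP/asboolP => h.
      exact: conn_trans h uv.
    by apply: conn_trans h (conn_sym _ uv); exact: open_adj_sym.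
  case E : [seq _ <- _ | _] => [|//].
  have : v \in [seq x <- s | `[< conn x v >]].
    by rewrite mem_filter vs asboolT//; exact: connxx.
  by rewrite E.
pose F : {fset V} := [fset rep v | v in s]%fset.
pose B' u := [set a | forall v, v \in s -> rep v = u -> B v a].
have mF (m : probability (spins e q) R) : spin_law w m ->
    m [set x | forall v, v \in s -> B v (x v)] =
    (\prod_(u <- F) m [set x | B' u (x u)])%E.
  move=> [lc lp _ _]; rewrite -lp; last first.
    move=> u u' /imfsetP[v /= vs ->] /imfsetP[v' /= vs' ->] /eqP neq cE.
    apply: neq; have [_ cv] := repP _ vs; have [_ cv'] := repP _ vs'.
    have crr : conn (rep v) (rep v').
      have : open_cluster w (rep v') (rep v') by exact: connxx.
      by rewrite -cE.
    have os := @open_adj_sym _ e w.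
    apply: rep_eq => //; apply: conn_trans (conn_sym os cv) _.
    exact: conn_trans crr cv'.
  have mB (l : seq V) (D : V -> set 'Z_q) : measurable
      [set x : spins e q | forall v, v \in l -> D v (x v)].
    by apply: (@measurable_box V _ 'Z_q).
  pose J := [set x : spins e q | forall v, v \in s -> x (rep v) = x v].
  have meqJ u v : measurable [set x : spins e q | x u = x v].
    have m' : mpred (fun x : spins e q => exists a : 'Z_q, x u = a /\ x v = a).
      by apply: mpred_ex => a; apply: mpred_and; exact: (measurable_at [set a]).
    by apply: mpred_ext m' => x; split=> [[a [-> ->]]//|xuv]; exists (x v).
  have mJ : mpred J.
    by apply: mpred_all => v; apply: mpred_imp (mpred_cst _ _) _; exact: meqJ.
  apply: (@full_eq _ _ _ _ _ _ J) => //; first exact: mB.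
    apply: ae_prob1 => //; apply: ae_all => v.
    have [vs|vs] := boolP (v \in s); last exact: aeW.
    have [_ cv] := repP _ vs.
    have := prob1_ae (meqJ _ _) (lc _ _ cv).
    by apply: filterS.
  move=> x Jx; split=> [h u /imfsetP[v /= vs uE] v' vs' v'u|h v vs].
    by rewrite -v'u Jx//; exact: h.
  have [rs _] := repP _ vs.
  rewrite -(Jx v vs); apply: (h (rep v)) => //.
  by apply/imfsetP; exists v.
apply: (etrans (mF m1 l1)); apply: (etrans _ (esym (mF m2 l2))); apply: eq_bigr => u _.
exact: spin_law_marginal.
Qed.

End SpinLawUnique.

Section NearEdges.
Variables (V : countType) (e : rel V).
Hypotheses (e_conn : graph_connected e) (e_lf : locally_finite_graph e).

Definition near_edges u r : seq (edge e) :=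
  pmap (insub : {fset V} -> option (edge e))
    [seq [fset x; y]%fset | x <- ball_seq e u r, y <- ball_seq e u r].

Lemma size_near_edges D u r : (forall x, (size (nbrs e x) < D)%N) ->
  (size (near_edges u r) <= D ^ (2 * r))%N.
Proof.
move=> deg; rewrite size_pmap; apply: leq_trans (count_size _ _) _.
by rewrite size_allpairs mul2n -addnn expnD leq_mul// size_ball_seq.
Qed.

Lemma mem_near_edges u r (b : edge e) :
  [set v | v \in val b] `<=` gball e u r -> b \in near_edges u r.
Proof.
move=> bB; have /asboolP[x [y [exy bE]]] := valP b.
rewrite mem_pmap_sub; apply/allpairsP; exists (x, y).
have xb : x \in val b by rewrite bE !inE eqxx.
have yb : y \in val b by rewrite bE !inE eqxx orbT.
by rewrite !mem_ball_seq//; split=> //; apply: bB.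
Qed.

End NearEdges.

(** * The gradient as a function of percolation and labels *)

Section GradientMap.
Variables (R : realType) (V : countType) (e : rel V) (q : nat) (f : nat -> nat).
Hypotheses (e_sym : symmetric e) (e_irr : irreflexive e).
Hypotheses (e_conn : graph_connected e) (e_lf : locally_finite_graph e).
Hypothesis f_mono : {homo f : i j / (i <= j)%N}.
Hypothesis f_big : forall j, (3 * j < f j)%N.

Local Notation Q := (Zp_trunc q).+2.
Local Notation bits := (pspace nat 'Z_q).
Local Notation digit_law := (@digit_law R q).
Local Notation perc := (fconf (eindex e) bool).
Local Notation labels := (fconf (vindex e) bits).
Local Notation label_field := (@label_field V q).
Implicit Types w : pspace (eindex e) bool.

Let f_gt j : (j < f j)%N. Proof. by have := f_big j; lia. Qed.

(** The configurations on which every line of ancestors ends in the one infinite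
cluster. *)
Definition good w := [/\ exists z, ~ finite_at (open_adj w) z,
  forall y z, ~ finite_at (open_adj w) y -> ~ finite_at (open_adj w) z ->
    conn (open_adj w) y z &
  forall u, exists2 j0, (0 < j0)%N & tame e f (open_adj w) u j0].

Lemma measurable_good : mpred good.
Proof.
have mo := @measurable_open_adj V e.
apply: mpred_and3.
- apply: mpred_ex => z; by apply: mpred_not; exact: (mpred_finite_at mo).
- apply: mpred_all => y; apply: mpred_all => z.
  apply: mpred_imp; first by apply: mpred_not; exact: (mpred_finite_at mo).
  apply: mpred_imp; first by apply: mpred_not; exact: (mpred_finite_at mo).
  exact: (mpred_conn mo).
- apply: mpred_all => u; apply: mpred_ex2 => j0; first exact: mpred_cst.
  exact: (mpred_tame e f mo).
Qed.

(** Total and equivariant by construction: no choice is involved, since at most one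
value merges the two lines. *)
Definition gradient_map (y : pair_conf perc labels) : pspace (oindex e) 'Z_q :=
  fun a => the_or0 (merged e f (open_adj y.1) y.2 (val a).1 (val a).2).

Lemma measurable_gradient_map : measurable_fun setT gradient_map.
Proof.
apply: (@measurable_pspace (oedge e) _ 'Z_q) => a _ B _; rewrite setTI.
have mw u v : mpred (fun y : pair_conf perc labels => open_adj y.1 u v).
  have := @measurable_fst _ _ (pspace (eindex e) bool) (pspace V bits) measurableT
    _ (measurable_open_adj u v).
  by rewrite setTI.
have mx v k c : mpred (fun y : pair_conf perc labels => y.2 v k = c).
  have m : measurable_fun setT (fun y : pair_conf perc labels => (y.2 : V -> bits) v).
    apply: (measurableT_comp (@measurable_coord V _ bits v)).
    exact: measurable_snd.
  have m' := measurableT_comp (@measurable_coord nat _ 'Z_q k) m.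
  by have := m' measurableT [set c] I; rewrite setTI.
have m : mpred (fun y : pair_conf perc labels => exists c, B c /\
    the_or0 (merged e f (open_adj y.1) y.2 (val a).1 (val a).2) = c).
  apply: mpred_ex => c; apply: mpred_and; first exact: mpred_cst.
  apply: mpred_the_or0 => [y b b'|b].
    exact: (merged_uniq (@open_adj_sym _ e y.1) f_gt).
  exact: (mpred_merged e f mw mx).
apply: mpred_ext m => y; split=> [[c [Bc yc]]|By]; last by exists (gradient_map y a).
by rewrite /preimage/= /gradient_map yc.
Qed.

Lemma open_adj_act (g : aut e) w u v :
  open_adj (cact (c := perc) g w : pspace (eindex e) bool) u v =
  open_adj w (g u) (g v).
Proof.
have imE x y : (g @` [fset x; y] = [fset g x; g y])%fset.
  exact: imfset_fset2.
apply/asboolP/asboolP => -[a [aE wa]].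
  by exists (edge_act g a); rewrite /= aE imE.
have euv : is_edge e [fset u; v]%fset.
  by apply/asboolP; exists u, v; rewrite -(aut_adj g) (edge_ends e_sym e_irr aE).
exists (exist (fun A : {fset V} => is_edge e A) _ euv); split=> //.
rewrite /= (_ : edge_act g _ = a)//; apply: val_inj.
by rewrite /= imE aE.
Qed.

Lemma gradient_map_equivariant : equivariant gradient_map.
Proof.
move=> g y; apply/funext => a; rewrite /gradient_map /=; congr the_or0.
apply/funext => c; apply/propext.
apply: (@merged_aut V e q f e_conn g) => // u v.
exact: open_adj_act.
Qed.

Lemma gradient_map_spin w (x : bits) : good w -> labels_distinct (label_field x) ->
  gradient_map (w, label_field x) =
  gradient (spin_config e f (open_adj w) x : spins e q).
Proof.
move=> [inf uniq tm] lx; apply/funext => a; rewrite /gradient_map.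
set u := (val a).1; set v := (val a).2.
have os := @open_adj_sym _ e w.
have sP z := spinP e_conn e_lf f_big os inf tm z lx.
apply: the_or0P => [c c'|]; first exact: merged_uniq.
have [K [n [z [az nz]]]] := sP u.
have [K' [n' [z' [az' nz']]]] := sP v.
exists (maxn K K'), n, n', z, z', (spin e f (open_adj w) u x), (spin e f (open_adj w) v x).
split=> //; [apply: chain_mono az|apply: chain_mono az'|exact: uniq].
  exact: leq_maxl.
exact: leq_maxr.
Qed.

Lemma measurable_gradient : measurable_fun setT (@gradient V e q).
Proof.
apply: (@measurable_pspace (oedge e) _ 'Z_q) => a _ B _; rewrite setTI.
have ms v b : mpred (fun s : spins e q => s v = b).
  have := @measurable_coord V _ 'Z_q v measurableT [set b] I.
  by rewrite setTI.
have m : mpred (fun s : spins e q => exists b c : 'Z_q,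
    [/\ s (val a).2 = b, s (val a).1 = c & B (b - c)]).
  apply: mpred_ex => b; apply: mpred_ex => c; apply: mpred_and3 => //.
  exact: mpred_cst.
apply: mpred_ext m => s; split; first by move=> [b [c [<- <-]]].
by move=> Bs; exists (s (val a).2), (s (val a).1).
Qed.

Section SpinLaw.
Variable w : pspace (eindex e) bool.
Hypotheses (w_good : good w) (q_gt1 : (1 < q)%N).
Local Notation rho := (open_adj w).

Let os : symmetric rho. Proof. exact: open_adj_sym. Qed.
Let oe : subrel rho e. Proof. exact: open_adj_e. Qed.
Let inf : exists z, ~ finite_at rho z. Proof. by case: w_good. Qed.
Let one_inf : forall y z, ~ finite_at rho y -> ~ finite_at rho z -> conn rho y z.
Proof. by case: w_good. Qed.
Let tm : forall u, exists2 j0, (0 < j0)%N & tame e f rho u j0.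
Proof. by case: w_good. Qed.

Let mspin : measurable_fun setT (spin_config (q := q) e f rho).
Proof. exact: measurable_spin_config. Qed.

HB.instance Definition _ := isMeasurableFun.Build _ _ _ _
  (spin_config (q := q) e f rho) mspin.

Definition chain_law : probability (spins e q) R :=
  [the probability _ _ of distribution digit_law (spin_config e f rho)].

Lemma chain_spin_law : spin_law w chain_law.
Proof.
split.
- move=> u v uv.
  rewrite -[LHS]/(digit_law [set x | spin e f rho u x = spin e f rho v x]).
  apply: ae_prob1.
    have m : mpred (fun x => exists c,
        spin (q := q) e f rho u x = c /\ spin e f rho v x = c).
      by apply: mpred_ex => c; apply: mpred_and; exact: measurable_spin.
    by apply: mpred_ext m => x; split=> [[c [-> ->]]//|h]; exists (spin e f rho v x).
  apply: filterS (labels_distinct_ae R V q) => x lx /=.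
  exact: (spin_conn e_conn e_lf f_big).
- move=> F B sep.
  apply: (spin_product R e_conn e_lf f_big os inf one_inf tm) => //; first exact: fset_uniq.
  move=> u v uF vF /(sep u v uF vF) nuv uv; apply: nuv.
  apply/funext => z; apply/propext; split=> h.
    by apply: conn_trans h; exact: conn_sym.
  exact: conn_trans h.
- move=> u a /finite_atP fu.
  rewrite -[LHS]/(digit_law [set x | spin e f rho u x = a]).
  have := spin_uniform R e_conn e_lf f_big os inf tm a measurableT fu
    (fun _ _ => iff_refl _).
  rewrite setTI probability_setT mule1 => ->.
  by rewrite Zp_cast.
- move=> u nu.
  rewrite -[LHS]/(digit_law [set x | spin e f rho u x = 0]).
  apply: ae_prob1.
    exact: measurable_spin.
  apply: aeW => x; apply: spin_infinite => // /finite_atP.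
  exact: nu.
Qed.

End SpinLaw.
End GradientMap.

Section KernelProbability.
Context dX dY (X : measurableType dX) (Y : measurableType dY) (R : realType).
Variables (k : R.-pker X ~> Y) (x : X).

(** Uniqueness of the spin law concerns probabilities, so the values of a
probability kernel are given that structure. *)
Definition kernel_at : set Y -> \bar R := k x.

HB.instance Definition _ := Measure.on kernel_at.

Let kernel_at_setT : kernel_at setT = 1%E.
Proof. exact: prob_kernel. Qed.

HB.instance Definition _ := Measure_isProbability.Build _ _ _ kernel_at
  kernel_at_setT.

End KernelProbability.

Section GradientLaw.
Variables (R : realType) (V : countType) (e : rel V) (q : nat) (f : nat -> nat).
Hypotheses (e_sym : symmetric e) (e_irr : irreflexive e).
Hypotheses (e_conn : graph_connected e) (e_lf : locally_finite_graph e).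
Hypothesis f_mono : {homo f : i j / (i <= j)%N}.
Hypothesis f_big : forall j, (3 * j < f j)%N.
Hypothesis q_gt1 : (1 < q)%N.

Local Notation bits := (pspace nat 'Z_q).
Local Notation digit_law := (@digit_law R q).
Local Notation label_field := (@label_field V q).
Local Notation gmap := (@gradient_map V e q f).

Lemma measurable_gradient_label_field : measurable_fun setT
  (fun z : pspace (eindex e) bool * bits => gmap (z.1, label_field z.2)).
Proof.
apply: (measurableT_comp (measurable_gradient_map _)) => //.
apply/measurable_fun_pairP; split; first exact: measurable_fst.
exact: (measurableT_comp (@measurable_label_field V q) (@measurable_snd _ _ _ _)).
Qed.

Lemma good_law w (m : probability (spins e q) R) A : good f w -> spin_law w m ->
  measurable A ->
  digit_law [set x | A (gmap (w, label_field x))] = m (@gradient V e q @^-1` A).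
Proof.
move=> gw lw mA.
have mgA : measurable (@gradient V e q @^-1` A).
  by rewrite -[X in measurable X]setTI; apply: measurable_gradient.
have os := @open_adj_sym _ e w.
rewrite -(spin_law_unique (chain_spin_law R e_conn e_lf f_big gw q_gt1) lw mgA).
rewrite -[RHS]/(digit_law [set x | A (gradient (spin_config e f (open_adj w) x : spins e q))]).
apply: ae_prob_eq.
- have := measurable_xsection w (measurable_gradient_label_field measurableT mA).
  by rewrite setTI /xsection; apply: mpred_ext => x; rewrite /= inE.
- have mg := measurableT_comp (@measurable_gradient V e q)
    (measurable_spin_config (q := q) e f os).
  by have := mg measurableT A mA; rewrite setTI.
- apply: filterS (labels_distinct_ae R V q) => x lx /=.
  by rewrite gradient_map_spin.
Qed.

Section OnProductSpace.
Context d1 (W1 : measurableType d1) (P1 : probability W1 R).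
Variable omega1 : {mfun W1 >-> pspace (eindex e) bool}.
Context d (W : measurableType d) (P : probability W R).
Variable omega : {mfun W >-> pspace (eindex e) bool}.
Variable sigma : {mfun W >-> spins e q}.
Hypothesis omega1_law : same_law P1 omega1 P omega.
Hypothesis omega_good : {ae P, forall x, good f (omega x)}.
Hypothesis sigma_law : spins_given_percolation P omega sigma.

(** Given the percolation configuration both sides have the law that [spin_law]
determines, so both are integrals of one kernel against one law. *)
Lemma gradient_law : same_law (P1 \x digit_law)%E
  (fun z => gmap (omega1 z.1, label_field z.2)) P (@gradient V e q \o sigma).
Proof.
move=> A mA; have [kappa [kP klaw]] := sigma_law.
pose D := (fun z : pspace (eindex e) bool * bits => gmap (z.1, label_field z.2)) @^-1` A.
have mD : measurable D.
  by rewrite -[D]setTI; exact: measurable_gradient_label_field.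
pose h w := digit_law (xsection D w).
have mh : measurable_fun setT h by exact: measurable_fun_xsection.
have h0 w : (0 <= h w)%E by [].
have mgA : measurable (@gradient V e q @^-1` A).
  by rewrite -[X in measurable X]setTI; apply: measurable_gradient.
transitivity (\int[P1]_x (h \o omega1) x)%E.
  by [].
transitivity (\int[pushforward P1 omega1]_w h w)%E.
  by rewrite ge0_integral_pushforward.
transitivity (\int[pushforward P omega]_w h w)%E.
  by apply: eq_measure_integral => B mB _; exact: omega1_law.
transitivity (\int[P]_x (h \o omega) x)%E.
  by rewrite ge0_integral_pushforward.
have := kP setT _ measurableT mgA; rewrite !preimage_setT setTI => ->.
apply: ae_eq_integral => //.
- exact: measurableT_comp.
- apply: (measurableT_comp (measurable_kernel kappa _ mgA)) => //.
apply: filterS2 omega_good klaw => x gx lx _.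
pose m : probability (spins e q) R :=
  [the probability _ _ of kernel_at kappa (omega x)].
rewrite -[RHS]/(m _) -(good_law gx (m := m) lx mA) /h /=.
by congr (digit_law _); apply/seteqP; split=> z; rewrite /xsection/= inE.
Qed.

End OnProductSpace.
End GradientLaw.

(** * Coding radius of the gradient *)

Section Coding.
Variables (R : realType) (V : countType) (e : rel V) (q : nat) (f : nat -> nat).
Hypotheses (e_sym : symmetric e) (e_irr : irreflexive e).
Hypotheses (e_conn : graph_connected e) (e_lf : locally_finite_graph e).
Hypothesis f_mono : {homo f : i j / (i <= j)%N}.
Hypothesis f_big : forall j, (3 * j < f j)%N.

Local Notation bits := (pspace nat 'Z_q).
Local Notation perc := (fconf (eindex e) bool).
Local Notation labels := (fconf (vindex e) bits).
Local Notation gmap := (@gradient_map V e q f).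
Implicit Types w : pspace (eindex e) bool.

Lemma coding_radius_le (C : config_space e) (I : indexing e) dT
    (T : measurableType dT) (phi : C -> pspace I T) y i r :
  (forall y', agree (gball e (base i) r) y y' -> phi y' i = phi y i) ->
  (coding_radius R phi y i <= r%:R%:E)%E.
Proof. by move=> h; apply: ereal_inf_lbound; exists r. Qed.

Lemma agree_open (B : set V) w w' :
  agree (c := perc) B w w' -> agree_on B (open_adj w) (open_adj w').
Proof.
move=> h x y Bx By; apply/asboolP/asboolP => -[a [aE wa]]; exists a; split=> //.
  rewrite -h// => z /=; change (z \in val a -> B z).
  by rewrite aE !inE => /orP[] /eqP ->.
rewrite h// => z /=; change (z \in val a -> B z).
by rewrite aE !inE => /orP[] /eqP ->.
Qed.

Lemma tame_le (rho : rel V) u j j' : (j <= j')%N -> tame e f rho u j -> tame e f rho u j'.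
Proof. by move=> jj tm i x ji; apply: tm; exact: leq_trans jj ji. Qed.

(** Tameness brings both lines to infinite clusters within distance 3 * f j0, and
local connectedness joins their ends by a path inside the ball, which completes
the certificate of [merged_agree]. *)
Lemma gradient_read w (xi : V -> bits) (a : oedge e) j0 l r :
  (0 < j0)%N -> labels_distinct xi ->
  (exists z, ~ finite_at (open_adj w) z) ->
  tame e f (open_adj w) (val a).1 j0 -> tame e f (open_adj w) (val a).2 j0 ->
  (forall z z', ~ finite_at (open_adj w) z -> ~ finite_at (open_adj w) z' ->
     gball e (val a).1 (3 * f j0).+1 z -> gball e (val a).1 (3 * f j0).+1 z' ->
     connected_within w (gball e (val a).1 l) z z') ->
  (l <= r)%N -> ((chain_radius f (f j0)).+1 <= r)%N ->
  forall y', agree (c := pair_conf perc labels) (gball e (val a).1 r) (w, xi) y' ->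
    gmap y' a = gmap (w, xi) a.
Proof.
move=> j00 lx inf; set u := (val a).1; set v := (val a).2 => tu tv lu lr Kr.
have uv : (gdist e u v <= 1)%N by apply: gdist_adj; exact: (valP a).
have [n [t [z [az nz]]]] := chain_reaches e_conn e_lf f_big lx j00 tu inf.
have [m [s [z' [az' nz']]]] := chain_reaches e_conn e_lf f_big lx j00 tv inf.
have oe := @open_adj_e _ e e_sym e_irr.
have uz : (gdist e u z <= 3 * f j0)%N by exact: (chain_dist e_conn f_mono f_big (oe w)) az.
have vz : (gdist e v z' <= 3 * f j0)%N by exact: (chain_dist e_conn f_mono f_big (oe w)) az'.
have [||p [pp pz pl]] := lu z z' nz nz'; rewrite /gball/=.
- exact: leqW.
- by have := gdist_tri e_conn v u z'; lia.
suff h y' : agree (c := pair_conf perc labels) (gball e u r) (w, xi) y' -> gmap y' a = s - t.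
  by move=> y' yy'; apply: etrans (h y' yy') (esym (h (w, xi) _)); split.
move=> [ww xx]; apply: the_or0P => [c c'|].
  apply: merged_uniq; first exact: open_adj_sym.
  by move=> j; have := f_big j; lia.
apply: (merged_agree e_conn f_mono f_big (oe w) (oe _) uv az az' pp pz _ Kr).
- by move=> x /pl; rewrite /gball/=; lia.
- exact: agree_open.
- by move=> x ux; apply: xx => _ ->.
Qed.

Lemma connected_within_mono w (B B' : set V) u v : B `<=` B' ->
  connected_within w B u v -> connected_within w B' u v.
Proof. by move=> BB' [p [pp pl pB]]; exists p; split=> // x /pB /BB'. Qed.

Lemma finite_connection w u r :
  (forall z z', ~ finite_at (open_adj w) z -> ~ finite_at (open_adj w) z' ->
     conn (open_adj w) z z') ->
  exists l, forall z z', ~ finite_at (open_adj w) z -> ~ finite_at (open_adj w) z' ->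
    gball e u r z -> gball e u r z' -> connected_within w (gball e u l) z z'.
Proof.
move=> one.
have [l lP] : exists l, forall c, c \in [seq (z, z') | z <- ball_seq e u r, z' <- ball_seq e u r] ->
    conn (open_adj w) c.1 c.2 -> connected_within w (gball e u l) c.1 c.2.
  elim: [seq _ | _ <- _, _ <- _] => [|c s [l lP]]; first by exists 0%N.
  have [cc|nc] := pselect (conn (open_adj w) c.1 c.2); last first.
    by exists l => c'; rewrite inE => /orP[/eqP ->|/lP].
  have [p [pp pc]] := cc.
  exists (maxn l (\max_(x <- c.1 :: p) gdist e u x)%N) => c'.
  rewrite inE => /orP[/eqP -> _|c's /(lP _ c's)].
    exists p; split=> // x xp; rewrite /gball/= leq_max; apply/orP; right.
    exact: (@leq_bigmax_seq V (c.1 :: p) xpredT (gdist e u) x xp isT).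
  by apply: connected_within_mono => x; rewrite /gball/= leq_max => ->.
exists l => z z' nz nz' uz uz'.
apply: (lP (z, z')); last exact: one.
by apply/allpairsP; exists (z, z'); rewrite !mem_ball_seq.
Qed.

Lemma gradient_coding_finite w (xi : V -> bits) (a : oedge e) : good f w ->
  labels_distinct xi -> (coding_radius R gmap (w, xi) a < +oo)%E.
Proof.
move=> [inf one tm] lx.
have [j1 j10 t1] := tm (val a).1; have [j2 j20 t2] := tm (val a).2.
pose j0 := maxn j1 j2.
have [l lP] := finite_connection (val a).1 (3 * f j0).+1 one.
apply: (@le_lt_trans _ _ (maxn l (chain_radius f (f j0)).+1)%:R%:E); last exact: ltry.
apply: coding_radius_le => y' yy'.
apply: (gradient_read (j0 := j0) (l := l)) yy' => //.
- by rewrite leq_max j10.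
- by apply: tame_le t1; exact: leq_maxl.
- by apply: tame_le t2; exact: leq_maxr.
- exact: leq_maxl.
- exact: leq_maxr.
Qed.

End Coding.

(** * Choice of the thresholds *)

Section Tameness.
Variables (R : realType) (V : countType) (e : rel V).
Hypotheses (e_sym : symmetric e) (e_irr : irreflexive e).
Hypotheses (e_conn : graph_connected e) (e_lf : locally_finite_graph e).
Context d (W : measurableType d) (P : probability W R).
Variable omega : {mfun W >-> pspace (eindex e) bool}.

Local Notation rho x := (open_adj (omega x)).

Lemma measurable_rho u v : mpred (fun x => rho x u v).
Proof.
have := @measurable_funPTI _ _ _ _ omega _ (measurable_open_adj u v).
exact.
Qed.

Section Scale.
Variable f : nat -> nat.

Definition wild u j x := exists y, (gdist e u y <= 3 * j)%N /\ stretched e (rho x) y (f j).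

Lemma measurable_wild u j : mpred (wild u j).
Proof.
apply: mpred_ex => y; apply: mpred_and (mpred_cst _ _) _.
exact: (mpred_stretched e measurable_rho).
Qed.

Lemma not_tameE u j0 x :
  ~ tame e f (rho x) u j0 <-> exists2 j, (j0 <= j)%N & wild u j x.
Proof.
split=> [nt|[j j0j [y [uy st]]] tm]; last exact: (tm j y j0j uy st).
apply: contrapT => nw; apply: nt => j y j0j uy st; apply: nw.
by exists j => //; exists y.
Qed.

Lemma tame_tail u (K r : R) n0 : 0 <= K -> 0 <= r < 1 ->
  (forall j, (n0 <= j)%N -> (P [set x | wild u j x] <= (K * r ^+ j)%:E)%E) ->
  forall j0, (n0 <= j0)%N ->
  (P [set x | ~ tame e f (rho x) u j0] <= (K * r ^+ j0 / (1 - r))%:E)%E.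
Proof.
move=> K0 r01 h j0 nj.
rewrite (_ : [set x | _] = [set x | exists2 j, (j0 <= j)%N & wild u j x]); last first.
  by apply/seteqP; split=> x /= /not_tameE.
apply: union_tail => //; first exact: measurable_wild.
by move=> j j0j; apply: h; exact: leq_trans nj j0j.
Qed.

Lemma tame_ae u (K r : R) n0 : 0 <= K -> 0 <= r < 1 ->
  (forall j, (n0 <= j)%N -> (P [set x | wild u j x] <= (K * r ^+ j)%:E)%E) ->
  {ae P, forall x, exists2 j0, (0 < j0)%N & tame e f (rho x) u j0}.
Proof.
move=> K0 r01 h.
have mt j : mpred (fun x => tame e f (rho x) u j).
  exact: (mpred_tame e f measurable_rho).
have mex : mpred (fun x => exists2 j0, (0 < j0)%N & tame e f (rho x) u j0).
  by apply: mpred_ex2 => j; [exact: mpred_cst|exact: mt].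
apply/negligibleP; first exact: measurableC.
apply: (@geometric_eq0 R _ (K / (1 - r)) r n0.+1) => // n n0n.
rewrite mulrAC; apply: le_trans (tame_tail K0 r01 h (ltnW n0n)).
apply: le_measure; rewrite ?inE; [exact: measurableC|exact: mpred_not|].
move=> x /= nx tx; apply: nx; exists n => //; exact: leq_trans _ n0n.
Qed.

Lemma good_ae : {ae P, forall x, unique_infinite_cluster (omega x)} ->
  (forall u, {ae P, forall x, exists2 j0, (0 < j0)%N & tame e f (rho x) u j0}) ->
  {ae P, forall x, good f (omega x)}.
Proof.
move=> one /ae_all tm; apply: filterS2 one tm => x /unique_infinite_clusterP[ex un] tx.
by split.
Qed.

End Scale.

Lemma null_decreasing (F : nat -> set W) (eps : R) : 0 < eps ->
  (forall n, measurable (F n)) -> nonincreasing_seq F ->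
  P (\bigcap_n F n) = 0%E -> exists n, (P (F n) <= eps%:E)%E.
Proof.
move=> eps0 mF niF F0; apply: contrapT => nex.
have cv : P (F n) @[n --> \oo] --> P (\bigcap_n F n).
  apply: nonincreasing_cvg_mu => //; first exact: probability_lty.
  exact: bigcap_measurable.
have : (eps%:E <= lim (P (F n) @[n --> \oo]))%E.
  apply: lime_ge; first by apply/cvg_ex; eexists; exact: cv.
  apply: nearW => n; rewrite leNgt; apply/negP => h; apply: nex; exists n.
  exact: ltW.
by rewrite (cvg_lim _ cv)// F0 lee_fin leNgt eps0.
Qed.

Lemma not_stretched_large x y : unique_infinite_cluster (omega x) ->
  exists m0, forall m, (m0 <= m)%N -> ~ stretched e (rho x) y m.
Proof.
move=> /unique_infinite_clusterP[[z nz] _].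
have [[F hF]|ny] := pselect (finite_at (rho x) y); last first.
  by exists 0%N => m _ [].
pose D := (\max_(c <- [seq (a, b) | a <- F, b <- F]) gdist e c.1 c.2)%N.
exists (maxn D (gdist e y z)).+1 => m; rewrite gtn_max => /andP[Dm zm] [_ []].
  move=> [a [b [/hF aF /hF bF]]]; rewrite leqNgt => /negP; apply.
  apply: leq_ltn_trans Dm; apply: (@leq_bigmax_seq _ _ xpredT _ (a, b)) => //.
  by apply/allpairsP; exists (a, b).
by move=> /(_ y z (connxx _ _) nz); rewrite leqNgt zm.
Qed.

(** As the infinite cluster is unique, a given vertex is not stretched at any large
enough distance. Hence f k can be chosen such that some vertex within 4 * k of
a fixed origin is stretched at f k with probability at most 2 ^- k, and
Borel-Cantelli applies: the ball of radius 3 * j around any vertex lies in the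
ball of radius 4 * j around the origin for large j. *)
Lemma exists_scale : {ae P, forall x, unique_infinite_cluster (omega x)} ->
  exists f : nat -> nat, [/\ {homo f : i j / (i <= j)%N},
    forall j, (3 * j < f j)%N & {ae P, forall x, good f (omega x)}].
Proof.
move=> one.
have [[c0 _]|nV] := pselect (exists c0 : V, True); last first.
  exists (fun j => (3 * j).+1); split=> [i j ij|j|]; [by lia|by []|].
  apply: filterS one => x /unique_infinite_clusterP[[z _] _].
  by exfalso; apply: nV; exists z.
pose E k m := [set x | exists y, (gdist e c0 y <= 4 * k)%N /\
   exists2 i, (m <= i)%N & stretched e (rho x) y i].
have mE k m : measurable (E k m).
  suff : mpred (fun x => exists y, (gdist e c0 y <= 4 * k)%N /\
     exists2 i, (m <= i)%N & stretched e (rho x) y i) by [].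
  apply: mpred_ex => y; apply: mpred_and (mpred_cst _ _) _.
  apply: mpred_ex2 => i; first exact: mpred_cst.
  exact: (mpred_stretched e measurable_rho).
have : forall k, exists m, (P (E k m) <= ((2^-1 : R) ^+ k)%:E)%E.
  move=> k; apply: null_decreasing => //.
  - by move=> m n mn; apply/subsetPset => x [y [cy [i ni st]]];
      exists y; split=> //; exists i => //; exact: leq_trans mn ni.
  - apply/negligibleP; first exact: bigcap_measurable.
    apply: negligibleS one => x /= capE ux.
    have : exists m0, forall y, y \in ball_seq e c0 (4 * k) -> forall m, (m0 <= m)%N ->
        ~ stretched e (rho x) y m.
      elim: (ball_seq e c0 (4 * k)) => [|y s [m1 m1P]]; first by exists 0%N.
      have [m2 m2P] := not_stretched_large y ux.
      exists (maxn m1 m2) => y'; rewrite inE => /orP[/eqP ->|ys] m;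
        rewrite geq_max => /andP[h1 h2]; [exact: m2P|exact: m1P].
    move=> [m0 m0P]; have [y [cy [i m0i st]]] := capE m0 I.
    by apply: (m0P y _ i m0i st); rewrite mem_ball_seq.
move=> /choice[g gP].
(* adding up the g i makes f monotone *)
pose f k := (\sum_(i < k.+1) g i + 3 * k + 1)%N.
have fg k : (g k <= f k)%N by rewrite /f big_ord_recr/=; lia.
have fS k : (f k <= f k.+1)%N by rewrite /f [in leqRHS]big_ord_recr/=; lia.
exists f; split.
- by move=> i j /subnK <-; elim: (j - i)%N => // n IH; rewrite addSn (leq_trans IH).
- by move=> j; rewrite /f; lia.
apply: good_ae => // u.
apply: (@tame_ae f u 1 2^-1 (gdist e c0 u)) => //.
  by rewrite invr_ge0 ler0n invf_lt1 ?ltr1n ?ltr0n.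
move=> j uj; rewrite mul1r; apply: le_trans (gP j).
apply: le_measure; rewrite ?inE//; first exact: measurable_wild.
move=> x [y [uy st]]; exists y; split.
  by have := gdist_tri e_conn u c0 y; lia.
by exists (f j).
Qed.

End Tameness.

(** * The finitary factors *)

Section FactorLemmas.
Variables (R : realType) (V : countType) (e : rel V).

Lemma coding_radius_fin (C : config_space e) (I : indexing e) dT
    (T : measurableType dT) (phi : C -> pspace I T) y i :
  (coding_radius R phi y i < +oo)%E ->
  exists r, forall y', agree (gball e (base i) r) y y' -> phi y' i = phi y i.
Proof.
rewrite /coding_radius /einf => h; apply: contrapT => nex; move: h.
rewrite (_ : [set _ | _ in _] = set0) ?ereal_inf0 ?ltxx//.
by apply/seteqP; split=> // x [r rP _]; exfalso; apply: nex; exists r.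
Qed.

Lemma iid_seq d (W : measurableType d) (P : probability W R) dS
    (S : measurableType dS) (xi : W -> pspace (vindex e) S) : iid P xi ->
  exists m : probability S R, forall (s : seq V) (B : V -> set S), uniq s ->
    (forall v, measurable (B v)) ->
    P [set x | forall v, v \in s -> B v (xi x v)] = (\prod_(v <- s) m (B v))%E.
Proof.
move=> [m mP]; exists m => s B us mB; have := mP [fset v in s]%fset B mB.
rewrite (_ : [set x | _] = [set x | forall v, v \in s -> B v (xi x v)]).
  move=> ->; apply: perm_big; apply: uniq_perm => //.
  by move=> v; rewrite !inE.
by apply/seteqP; split=> x h v vs; apply: h; move: vs; rewrite !inE.
Qed.

Lemma same_law_ae d1 d2 d (W1 : measurableType d1) (W2 : measurableType d2)
    (T : measurableType d) (P1 : probability W1 R) (P2 : probability W2 R)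
    (X1 : {mfun W1 >-> T}) (X2 : {mfun W2 >-> T}) (A : T -> Prop) :
  same_law P1 X1 P2 X2 -> mpred A ->
  {ae P2, forall x, A (X2 x)} -> {ae P1, forall x, A (X1 x)}.
Proof.
move=> law mA h; apply: prob1_ae; first exact: (measurable_funPTI X1 mA).
rewrite -[LHS]/(P1 (X1 @^-1` A)) law//.
apply: ae_prob1 => //; exact: (measurable_funPTI X2 mA).
Qed.

Lemma agree_mono (I : indexing e) dT (T : measurableType dT) (B B' : set V)
    (y y' : fconf I T) : B `<=` B' -> agree B' y y' -> agree B y y'.
Proof. by move=> BB' h i iB; apply: h => v /iB /BB'. Qed.

End FactorLemmas.

Section Composition.
Variables (R : realType) (V : countType) (e : rel V) (q : nat) (f : nat -> nat).
Hypotheses (e_sym : symmetric e) (e_irr : irreflexive e).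
Hypotheses (e_conn : graph_connected e) (e_lf : locally_finite_graph e).
Hypothesis f_mono : {homo f : i j / (i <= j)%N}.
Hypothesis f_big : forall j, (3 * j < f j)%N.
Hypothesis q_gt1 : (1 < q)%N.
Context d (W : measurableType d) (P : probability W R).
Variable omega : {mfun W >-> pspace (eindex e) bool}.
Variable sigma : {mfun W >-> spins e q}.
Hypothesis omega_good : {ae P, forall x, good f (omega x)}.
Hypothesis sigma_law : spins_given_percolation P omega sigma.

Local Notation bits := (pspace nat 'Z_q).
Local Notation digit_law := (@digit_law R q).
Local Notation label_field := (@label_field V q).
Local Notation gmap := (@gradient_map V e q f).
Local Notation perc := (fconf (eindex e) bool).
Local Notation labels := (fconf (vindex e) bits).

Lemma ae_fst d1 (W1 : measurableType d1) (P1 : probability W1 R)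
    (A : W1 -> Prop) : {ae P1, forall x, A x} ->
  {ae (P1 \x digit_law)%E, forall z, A z.1}.
Proof.
move=> [N [mN PN sN]]; exists (N `*` setT); split; first exact: measurableX.
  by rewrite product_measure1E// [X in (X * _)%E]PN mul0e.
by move=> z nA; split=> //; exact: sN.
Qed.

Lemma ae_snd d1 (W1 : measurableType d1) (P1 : probability W1 R)
    (A : bits -> Prop) : {ae digit_law, forall x, A x} ->
  {ae (P1 \x digit_law)%E, forall z, A z.2}.
Proof.
move=> [N [mN PN sN]]; exists (setT `*` N); split; first exact: measurableX.
  by rewrite product_measure1E// [X in (_ * X)%E]PN mule0.
by move=> z nA; split=> //; exact: sN.
Qed.

Lemma gradient_coding_ae d1 (W1 : measurableType d1) (P1 : probability W1 R)
    (omega1 : W1 -> pspace (eindex e) bool) a :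
  {ae P1, forall x, good f (omega1 x)} ->
  {ae (P1 \x digit_law)%E, forall z,
    (coding_radius R gmap (omega1 z.1, label_field z.2) a < +oo)%E}.
Proof.
move=> g1; apply: filterS2 (ae_fst g1) (ae_snd _ (labels_distinct_ae R V q)).
by move=> z gz lz; apply: gradient_coding_finite.
Qed.

Definition perc_fst (z : W * bits) : pspace (eindex e) bool := omega z.1.

Lemma measurable_perc_fst : measurable_fun setT perc_fst.
Proof. by apply: (measurableT_comp (measurable_funP omega)); exact: measurable_fst. Qed.

HB.instance Definition _ := isMeasurableFun.Build _ _ _ _ perc_fst measurable_perc_fst.

Definition labels_snd (z : W * bits) : pspace (vindex e) bits := label_field z.2.

Lemma measurable_labels_snd : measurable_fun setT labels_snd.
Proof. by apply: (measurableT_comp (@measurable_label_field V q)); exact: measurable_snd. Qed.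

HB.instance Definition _ := isMeasurableFun.Build _ _ _ _ labels_snd measurable_labels_snd.

Theorem gradient_finitary_factor :
  exists d' (W' : measurableType d') (P' : probability W' R)
         dS (S : measurableType dS)
         (omega' : {RV P' >-> pspace (eindex e) bool})
         (xi : {RV P' >-> pspace (vindex e) S}),
    [/\ same_law P' omega' P omega, iid P' xi, independent P' omega' xi &
        finitary_factor
          (C := pair_conf (fconf (eindex e) bool) (fconf (vindex e) S))
          P (@gradient V e q \o sigma) P' (fun x => (omega' x, xi x))].
Proof.
exists _, (W * bits)%type, [the probability _ _ of (P \x digit_law)%E], _, bits.
exists [the {mfun _ >-> _} of perc_fst], [the {mfun _ >-> _} of labels_snd].
have preimX (A : set W) (B : set bits) :
    [set z : W * bits | A z.1 /\ B z.2] = A `*` B by [].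
have mom A : measurable A -> measurable (omega @^-1` A).
  by move=> mA; exact: measurable_funPTI.
have mfi A : measurable A -> measurable (label_field @^-1` A).
  by move=> mA; rewrite -[X in measurable X]setTI; exact: measurable_label_field.
split.
- move=> A mA; rewrite (_ : _ @^-1` A = (omega @^-1` A) `*` setT).
    rewrite /= product_measure1E//; last exact: mom.
    by rewrite [X in (_ * X)%E]probability_setT mule1.
  by apply/seteqP; split=> z // [].
- exists [the probability _ _ of digit_law] => F B mB.
  rewrite (_ : [set x | _] =
    setT `*` [set x | forall v, v \in (F : seq V) -> B v (label_field x v)]).
    rewrite /= product_measure1E//.
      rewrite [X in (X * _)%E]probability_setT mul1e.
      exact: (label_field_iid R (fset_uniq F) mB).
    have := mfi _ (measurable_box F mB).
    exact.
  by apply/seteqP; split=> z // [].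
- move=> A B mA mB; rewrite (_ : _ `&` _ = (omega @^-1` A) `*` (label_field @^-1` B))//.
  rewrite /= product_measure1E; [|exact: mom|exact: mfi].
  congr (_ * _)%E.
    rewrite (_ : _ @^-1` A = (omega @^-1` A) `*` setT).
      rewrite /= product_measure1E//; last exact: mom.
    by rewrite [X in (_ * X)%E]probability_setT mule1.
    by apply/seteqP; split=> z // [].
  rewrite (_ : _ @^-1` B = setT `*` (label_field @^-1` B)).
    rewrite /= product_measure1E//; last exact: mfi.
    by rewrite [X in (X * _)%E]probability_setT mul1e.
  by apply/seteqP; split=> z // [].
- exists gmap; split.
  + exact: measurable_gradient_map.
  + exact: gradient_map_equivariant.
  + by apply: gradient_law => //; move=> A mA.
  + by move=> a; apply: gradient_coding_ae.
Qed.

Section Coded.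
Context d1 (W1 : measurableType d1) (P1 : probability W1 R).
Context dS (S1 : measurableType dS).
Variable Y1 : {mfun W1 >-> pspace (vindex e) S1}.
Hypothesis Y1_iid : iid P1 Y1.
Variable phi1 : fconf (vindex e) S1 -> pspace (eindex e) bool.
Hypothesis phi1_factor : finitary_factor_map phi1 P omega P1 Y1.

Let S := (S1 * bits)%type.

Definition joint_labels (z : W1 * bits) : pspace (vindex e) S :=
  fun v => (Y1 z.1 v, label_field z.2 v).

Let measurable_joint_at v : measurable_fun setT (fun z => joint_labels z v).
Proof.
apply/measurable_fun_pairP; split.
  have mY : measurable_fun setT (Y1 \o (fst : W1 * bits -> W1)).
    by apply: measurableT_comp => //; exact: measurable_fst.
  exact: (measurableT_comp (@measurable_coord V _ S1 v) mY).
exact: (measurableT_comp (@measurable_label_field_at V q v) (@measurable_snd _ _ W1 bits)).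
Qed.

Lemma measurable_joint_labels : measurable_fun setT joint_labels.
Proof. by apply: (@measurable_pspace V _ S). Qed.

HB.instance Definition _ := isMeasurableFun.Build _ _ _ _ joint_labels
  measurable_joint_labels.

Definition joint_at v (z : W1 * bits) : S := joint_labels z v.

Lemma measurable_joint_at' v : measurable_fun setT (joint_at v).
Proof. exact: measurable_joint_at. Qed.

HB.instance Definition _ v := isMeasurableFun.Build _ _ _ _ (joint_at v)
  (measurable_joint_at' v).

(** It suffices to consider rectangles, for which the product rule is that of the
two independent fields. *)
Lemma joint_labels_iid : iid (P1 \x digit_law)%E joint_labels.
Proof.
have [m1 m1P] := iid_seq Y1_iid.
exists [the probability _ _ of (m1 \x digit_law)%E] => F B mB.
pose G : set (set S) := [set A `*` B | A in measurable & B in measurable].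
apply: (@product_rule_pi _ _ _ S R (P1 \x digit_law)%E (m1 \x digit_law)%E V
  (fun v => [the {mfun _ >-> _} of joint_at v]) G) => //.
- exact: measurable_prod_measurableType.
- move=> _ _ [A mA [B1 mB1 <-]] [A' mA' [B1' mB1' <-]].
  exists (A `&` A'); first exact: measurableI.
  by exists (B1 `&` B1'); [exact: measurableI|rewrite setXI].
- by exists setT => //; exists setT => //; rewrite setXTT.
- move=> s D us GD.
  have /choice[A AP] : forall v, exists A, measurable A /\
     exists B, measurable B /\ A `*` B = D v.
    by move=> v; have [A mA [B1 mB1 E]] := GD v; exists A; split=> //; exists B1.
  have /choice[A' A'P] : forall v, exists B, measurable B /\ A v `*` B = D v.
    by move=> v; have [_] := AP v.
  have mA v : measurable (A v) by have [] := AP v.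
  have mA' v : measurable (A' v) by have [] := A'P v.
  have DE v : D v = A v `*` A' v by have [] := A'P v.
  rewrite (_ : [set x | _] = [set x | forall v, v \in s -> A v (Y1 x v)] `*`
     [set x | forall v, v \in s -> A' v (label_field x v)]); last first.
    apply/seteqP; split=> z /=.
      by move=> h; split=> v vs; have := h v vs; rewrite DE => -[].
    by move=> [h h'] v vs; rewrite DE; split; [exact: h|exact: h'].
  have mY : measurable [set x | forall v, v \in s -> A v (Y1 x v)].
    have := @measurable_funPTI _ _ _ _ Y1 _ (measurable_box s mA).
    exact.
  have mF : measurable [set x | forall v, v \in s -> A' v (label_field x v)].
    have := measurable_label_field measurableT (measurable_box s mA').
    by rewrite setTI.
  rewrite /= product_measure1E//.
  rewrite [X in (X * _)%E](m1P s A us mA) [X in (_ * X)%E](label_field_iid R us mA').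
  rewrite -big_split; apply: eq_bigr => v _.
  by rewrite DE /= product_measure1E.
- exact: fset_uniq.
Qed.

Definition compose_gradient (y : fconf (vindex e) S) : pspace (oindex e) 'Z_q :=
  gmap (phi1 (fun v => (y v).1), fun v => (y v).2).

(** The gradient reads the percolation in a ball, and each edge of this ball reads
the labels around it. *)
Lemma compose_read (y : fconf (vindex e) S) (a : oedge e) r r' :
  (forall y', agree (c := pair_conf perc labels) (gball e (val a).1 r)
      (phi1 (fun v => (y v).1), fun v => (y v).2) y' ->
     gmap y' a = compose_gradient y a) ->
  (forall b : edge e, [set v | v \in val b] `<=` gball e (val a).1 r ->
     forall y1', agree (c := fconf (vindex e) S1) (gball e (base (i := eindex e) b) r')
       (fun v => (y v).1) y1' -> phi1 y1' b = phi1 (fun v => (y v).1) b) ->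
  forall y', agree (gball e (val a).1 (r + r')) y y' ->
    compose_gradient y' a = compose_gradient y a.
Proof.
move=> hr hr' y' yy'; apply: hr; split.
  move=> b bB; apply/esym; apply: hr' => // v vB.
  have yv : y v = y' v.
    apply: yy' => w /vB; apply: (gball_sub e_conn).
    have : gball e (val a).1 r (base (i := eindex e) b).
      by apply: bB; exact: xchooseP.
    by rewrite /gball/=; lia.
  by rewrite /= yv.
move=> v vB; have yv : y v = y' v.
  apply: yy' => w /vB; apply: (gball_sub e_conn).
  by rewrite gdistxx; lia.
by rewrite /= yv.
Qed.

Lemma finite_edge_radius (y1 : pspace (vindex e) S1) u r :
  (forall b : edge e, exists r', forall y1',
     agree (c := fconf (vindex e) S1) (gball e (base (i := eindex e) b) r') y1 y1' ->
     phi1 y1' b = phi1 y1 b) ->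
  exists r', forall b : edge e, [set v | v \in val b] `<=` gball e u r ->
    forall y1', agree (c := fconf (vindex e) S1) (gball e (base (i := eindex e) b) r') y1 y1' ->
     phi1 y1' b = phi1 y1 b.
Proof.
move=> h.
suff [r' hr'] : exists r', forall b, b \in near_edges e u r -> forall y1',
    agree (c := fconf (vindex e) S1) (gball e (base (i := eindex e) b) r') y1 y1' ->
    phi1 y1' b = phi1 y1 b.
  by exists r' => b /(mem_near_edges e_conn e_lf); exact: hr'.
elim: (near_edges e u r) => [|b s [r1 r1P]]; first by exists 0%N.
have [r2 r2P] := h b; exists (maxn r1 r2) => b'.
rewrite inE => /orP[/eqP ->|/r1P{}r1P] y1' yy; [apply: r2P|apply: r1P];
  apply: agree_mono yy => x; rewrite /gball/= leq_max => ->; rewrite ?orbT//.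
Qed.

Definition coded (x : W1) : pspace (eindex e) bool := phi1 (Y1 x).

Lemma measurable_coded : measurable_fun setT coded.
Proof.
have [mphi _ _ _] := phi1_factor.
exact: (measurableT_comp mphi (measurable_funP Y1)).
Qed.

HB.instance Definition _ := isMeasurableFun.Build _ _ _ _ coded measurable_coded.

Lemma composition_factor :
  finitary_factor_map (C := fconf (vindex e) S) compose_gradient
    P (@gradient V e q \o sigma) (P1 \x digit_law)%E joint_labels.
Proof.
have [mphi eqphi lawphi radphi] := phi1_factor.
have lawC : same_law P1 [the {mfun _ >-> _} of coded] P omega by exact: lawphi.
split.
- have mpair : measurable_fun setT (fun y : pspace (vindex e) S =>
      (phi1 (fun v => (y v).1), (fun v => (y v).2) : pspace (vindex e) bits)).
    apply/measurable_fun_pairP; split.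
      apply: (measurableT_comp mphi); apply: (@measurable_pspace V _ S1) => v.
      exact: (measurableT_comp (@measurable_fst _ _ S1 bits) (@measurable_coord V _ S v)).
    apply: (@measurable_pspace V _ bits) => v.
    exact: (measurableT_comp (@measurable_snd _ _ S1 bits) (@measurable_coord V _ S v)).
  have mg : measurable_fun setT gmap by exact: measurable_gradient_map.
  exact: (measurableT_comp mg mpair).
- move=> g y.
  have := @gradient_map_equivariant V e q f e_sym e_irr e_conn g
    (phi1 (fun v => (y v).1), (fun v => (y v).2) : pspace (vindex e) bits).
  rewrite /compose_gradient => <-; congr (gmap (_, _)).
  exact: (eqphi g (fun v => (y v).1)).
- have := gradient_law e_conn e_lf f_big q_gt1
    (omega1 := [the {mfun _ >-> _} of coded]) lawC omega_good sigma_law.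
  exact.
- move=> a; have gC : {ae P1, forall x, good f (coded x)}.
    by apply: same_law_ae lawC _ omega_good; exact: measurable_good.
  have rads : {ae P1, forall x, forall b : edge e,
      (coding_radius R phi1 (Y1 x) b < +oo)%E}.
    by apply: ae_all => b; exact: radphi.
  apply: filterS2 (gradient_coding_ae a gC) (ae_fst rads) => z rz rb.
  have [r rP] := coding_radius_fin rz.
  have [r' r'P] := finite_edge_radius (val a).1 r
    (fun b => coding_radius_fin (rb b)).
  apply: (@le_lt_trans _ _ (r + r')%:R%:E); last exact: ltry.
  apply: coding_radius_le => y' yy'.
  exact: (@compose_read (joint_labels z) a r r' rP r'P y' yy').
Qed.

End Coded.
End Composition.

(** * Regularization of a coding map *)

Section IidLaw.
Variables (R : realType) (V : countType) (e : rel V).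
Hypotheses (e_sym : symmetric e) (e_irr : irreflexive e).
Hypotheses (e_conn : graph_connected e) (e_lf : locally_finite_graph e).
Context dS (S : measurableType dS).
Local Notation conf := (pspace (vindex e) S).
Variables (mu : probability conf R) (m : probability S R).
Hypothesis mu_iid : forall (s : seq V) (B : V -> set S), uniq s ->
  (forall v, measurable (B v)) ->
  mu [set y | forall v, v \in s -> B v (y v)] = (\prod_(v <- s) m (B v))%E.

Definition act_conf (g : aut e) (y : conf) : conf := fun v => y (g v).

Lemma measurable_act_conf g : measurable_fun setT (act_conf g).
Proof.
apply: (@measurable_pspace V _ S) => v.
exact: (@measurable_coord V _ S (g v)).
Qed.

HB.instance Definition _ g := isMeasurableFun.Build _ _ _ _ (act_conf g)
  (measurable_act_conf g).

Lemma undup_box (s : seq V) (B : V -> set S) :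
  [set y : conf | forall v, v \in s -> B v (y v)] =
  [set y | forall v, v \in undup s -> B v (y v)].
Proof. by apply/seteqP; split=> y h v vs; apply: h; move: vs; rewrite mem_undup. Qed.

Lemma act_conf_law g A : measurable A -> mu (act_conf g @^-1` A) = mu A.
Proof.
move: A; apply: (@pspace_unique V _ S R (distribution mu (act_conf g)) mu).
  exact: (probability_lty (distribution mu (act_conf g)) measurableT).
move=> s B mB; rewrite -[LHS]/(mu (act_conf g @^-1` [set y | forall v, v \in s -> B v (y v)])).
have [h gK hK] := aut_bij g.
rewrite (undup_box s B) [RHS](mu_iid (undup_uniq s) mB).
have -> : act_conf g @^-1` [set y | forall v, v \in undup s -> B v (y v)] =
    [set y | forall u, u \in map g (undup s) -> B (h u) (y u)].
  apply/seteqP; split=> y /= hy v.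
    by move=> /mapP[w ws ->]; rewrite gK; exact: hy.
  by move=> vs; have := hy (g v); rewrite gK; apply; exact: map_f.
rewrite [LHS](mu_iid (B := fun u => B (h u))) ?map_inj_uniq ?undup_uniq//.
  by rewrite big_map; apply: eq_bigr => v _; rewrite gK.
exact: can_inj gK.
Qed.

Section Splice.
Variable B : set V.

Definition splice (z : conf * conf) : conf :=
  fun v => if `[< B v >] then z.1 v else z.2 v.

Lemma measurable_splice : measurable_fun setT splice.
Proof.
apply: (@measurable_pspace V _ S) => v; rewrite /splice.
have [Bv|Bv] := asboolP (B v).
  exact: (measurableT_comp (@measurable_coord V _ S v) (@measurable_fst _ _ conf conf)).
exact: (measurableT_comp (@measurable_coord V _ S v) (@measurable_snd _ _ conf conf)).
Qed.

HB.instance Definition _ := isMeasurableFun.Build _ _ _ _ splice measurable_splice.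

(** Independence of the labels: those outside B may be replaced by fresh ones. *)
Lemma splice_law A : measurable A -> (mu \x mu)%E (splice @^-1` A) = mu A.
Proof.
move: A; apply: (@pspace_unique V _ S R (distribution (mu \x mu)%E splice) mu).
  exact: (probability_lty (distribution (mu \x mu)%E splice) measurableT).
move=> s D mD.
rewrite -[LHS]/((mu \x mu)%E (splice @^-1` [set y | forall v, v \in s -> D v (y v)])).
rewrite (undup_box s D) [RHS](mu_iid (undup_uniq s) mD); set t := undup s.
have ut : uniq t by exact: undup_uniq.
pose D1 v := if `[< B v >] then D v else setT.
pose D2 v := if `[< B v >] then setT else D v.
have mD1 v : measurable (D1 v) by rewrite /D1; case: ifP.
have mD2 v : measurable (D2 v) by rewrite /D2; case: ifP.
have -> : splice @^-1` [set y | forall v, v \in t -> D v (y v)] =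
    [set y | forall v, v \in t -> D1 v (y v)] `*`
    [set y | forall v, v \in t -> D2 v (y v)].
  apply/seteqP; split=> z /=.
    by move=> h; split=> v vt; have := h v vt; rewrite /splice /D1 /D2; case: ifP.
  move=> [h1 h2] v vt; have := h1 v vt; have := h2 v vt.
  by rewrite /splice /D1 /D2; case: ifP.
rewrite product_measure1E; [|exact: (measurable_box t mD1)|exact: (measurable_box t mD2)].
rewrite [X in (X * _)%E](mu_iid ut mD1) [X in (_ * X)%E](mu_iid ut mD2) -big_split.
apply: eq_bigr => v _; rewrite /D1 /D2; case: ifP => _ /=.
  by rewrite [X in (_ * X)%E]probability_setT mule1.
by rewrite [X in (X * _)%E]probability_setT mul1e.
Qed.

End Splice.

Section Regularization.
Variable phi : fconf (vindex e) S -> pspace (eindex e) bool.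
Hypotheses (phi_meas : measurable_fun setT phi) (phi_eq : equivariant phi).
Implicit Types (i : edge e) (y : conf).

(** Both ends of the edge serve as centres: the chosen base point of an edge is not
preserved by automorphisms. *)
Definition edge_ball i r : set V := [set v | exists2 x, x \in val i & (gdist e x v <= r)%N].

Lemma edge_ball_act (g : aut e) i r v :
  edge_ball (edge_act g i) r (g v) <-> edge_ball i r v.
Proof.
split=> -[x xi xv].
  move: xi => /imfsetP[w /= wi xE]; exists w => //.
  by rewrite -(gdist_aut e_conn g) -xE.
by exists (g x); rewrite ?gdist_aut// /= mem_imfset//; exact: bij_inj (aut_bij g).
Qed.

Lemma edge_ball_mono i r r' : (r <= r')%N -> edge_ball i r `<=` edge_ball i r'.
Proof. by move=> rr v [x xi xv]; exists x => //; exact: leq_trans xv rr. Qed.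

Lemma gball_edge_ball i r : gball e (base (i := eindex e) i) r `<=` edge_ball i r.
Proof. by move=> v vr; exists (base (i := eindex e) i) => //; exact: xchooseP. Qed.

Lemma edge_ball_gball i r : edge_ball i r `<=` gball e (base (i := eindex e) i) r.+1.
Proof.
move=> v [x xi xv]; set c : V := base (i := eindex e) i.
have bi : c \in val i by exact: xchooseP.
have bx : (gdist e c x <= 1)%N.
  have /asboolP[a [b [eab iE]]] := valP i.
  move: bi xi; rewrite iE !inE => /orP[] /eqP -> /orP[] /eqP ->;
    rewrite ?gdistxx//; apply: gdist_adj => //.
  by rewrite e_sym.
change (gdist e c v <= r.+1)%N.
by have := gdist_tri e_conn x c v; lia.
Qed.

(** If all labels far from i are resampled, phi almost surely takes the value b at
i. Unlike the statement that no other labels far from i change the value, this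
defines an event. *)
Definition settled i r b y :=
  mu [set y' | phi (splice (edge_ball i r) (y, y')) i = b] = 1%E.

Let D i r b : set (conf * conf) := [set z | phi (splice (edge_ball i r) z) i = b].

Let mD i r b : measurable (D i r b).
Proof.
have m1 := measurableT_comp phi_meas (measurable_splice (edge_ball i r)).
have m2 := measurableT_comp (@measurable_coord (edge e) _ bool i) m1.
by have := m2 measurableT [set b] I; rewrite setTI.
Qed.

Let D_section i r b y :
  [set y' | phi (splice (edge_ball i r) (y, y')) i = b] = xsection (D i r b) y.
Proof. by apply/seteqP; split=> y'; rewrite /xsection/= inE. Qed.

Lemma measurable_settled i r b : mpred (settled i r b).
Proof.
have mf := measurable_fun_xsection mu (mD i r b).
have := mf measurableT [set 1%E] (emeasurable_set1 1%E).
rewrite setTI; apply: mpred_ext => y.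
by rewrite /settled D_section.
Qed.

Lemma settled_agree i r b y y' : (forall v, edge_ball i r v -> y v = y' v) ->
  settled i r b y -> settled i r b y'.
Proof.
move=> yy'; have E z : splice (edge_ball i r) (y, z) = splice (edge_ball i r) (y', z).
  by apply/funext => v; rewrite /splice/=; case: asboolP => // /yy'.
rewrite /settled; have -> // : [set z | phi (splice (edge_ball i r) (y, z)) i = b] =
    [set z | phi (splice (edge_ball i r) (y', z)) i = b].
by apply/seteqP; split=> z /=; rewrite E.
Qed.

Lemma settled_act (g : aut e) i r b y :
  settled i r b (act_conf g y) <-> settled (edge_act g i) r b y.
Proof.
have E y' : phi (splice (edge_ball i r) (act_conf g y, act_conf g y')) i =
    phi (splice (edge_ball (edge_act g i) r) (y, y')) (edge_act g i).
  have -> : splice (edge_ball i r) (act_conf g y, act_conf g y') =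
      act_conf g (splice (edge_ball (edge_act g i) r) (y, y')).
    apply/funext => v; rewrite /splice /act_conf/=.
    by rewrite (asbool_equiv_eq (edge_ball_act g i r v)).
  set X := splice _ _. have h := phi_eq g X.
  exact: (f_equal (fun x : edge e -> bool => x i) h).
rewrite /settled; have -> // : mu [set y' | phi (splice (edge_ball i r) (act_conf g y, y')) i = b] =
  mu [set y' | phi (splice (edge_ball (edge_act g i) r) (y, y')) (edge_act g i) = b].
rewrite [in LHS]D_section -(act_conf_law g); last exact: measurable_xsection.
by congr (mu _); apply/seteqP; split=> y'; rewrite /xsection/= inE /D/= E.
Qed.

(** Resampling the labels far from i preserves the law, so a value that resampling
almost surely yields is almost surely the actual one. *)
Lemma settled_value i r b : {ae mu, forall y, settled i r b y -> phi y i = b}.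
Proof.
pose N := [set y | settled i r b y /\ phi y i <> b].
have mphi c : mpred (fun y : conf => phi y i = c).
  have := measurableT_comp (@measurable_coord (edge e) _ bool i) phi_meas measurableT.
  by move=> /(_ [set c] I); rewrite setTI.
have mN : mpred (fun y => settled i r b y /\ phi y i <> b).
  by apply: mpred_and; [exact: measurable_settled|exact: mpred_not].
exists N; split=> //; last first.
  by move=> y /= h; split; apply: contrapT => h'; apply: h => // ?; apply: contrapT.
rewrite -(splice_law (edge_ball i r) mN).
apply: integral0_eq => y _ /=.
have [sy|ny] := pselect (settled i r b y); last first.
  rewrite (_ : xsection _ _ = set0) ?measure0//; apply/seteqP; split=> y' //.
  rewrite /xsection/= inE => -[/= s' _]; apply: ny; apply: settled_agree s' => v vB.
  by rewrite /splice asboolT.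
have mx := measurable_xsection y (mD i r b).
have h1 : mu (~` xsection (D i r b) y) = 0%E.
  by rewrite probability_setC// -D_section sy subee.
apply/eqP; rewrite eq_le measure_ge0 andbT -h1; apply: le_measure; rewrite ?inE.
- have := measurable_xsection y (measurable_splice (edge_ball i r) measurableT mN).
  by rewrite setTI.
- exact: measurableC.
- by move=> y'; rewrite /xsection/= !inE => -[].
Qed.

Definition settled_by i r y := settled i r true y \/ settled i r false y.

(** Values settled at different radii may disagree on a null set of labellings; the
smallest radius decides. *)
Definition regularize : fconf (vindex e) S -> pspace (eindex e) bool :=
  fun y i => `[< exists r, settled i r true y /\
                 forall r', (r' < r)%N -> ~ settled i r' false y >].

Lemma measurable_settled_by i r : mpred (settled_by i r).
Proof. by apply: mpred_or; exact: measurable_settled. Qed.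

Lemma measurable_regularize : measurable_fun setT regularize.
Proof.
apply: (@measurable_pspace (edge e) _ bool) => i; apply: mpred_bool.
have mP : mpred (fun y => exists r, settled i r true y /\
    forall r', (r' < r)%N -> ~ settled i r' false y).
  apply: mpred_ex => r; apply: mpred_and; first exact: measurable_settled.
  apply: mpred_all => r'; apply: mpred_imp (mpred_cst _ _) _.
  by apply: mpred_not; exact: measurable_settled.
by apply: mpred_ext mP => y; split=> /asboolP.
Qed.

Lemma regularize_equivariant : equivariant regularize.
Proof.
move=> g y; apply/funext => i; apply: asbool_equiv_eq.
have E r b := settled_act g i r b y.
split=> -[r [h h']]; exists r; split; try exact/E.
  by move=> r' /h' n /E.
by move=> r' /h' n /E.
Qed.

Lemma regularize_read i r y : settled_by i r y ->
  forall y' : conf, (forall v, edge_ball i r v -> y v = y' v) ->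
  regularize y' i = regularize y i.
Proof.
have H y1 : settled_by i r y1 -> regularize y1 i =
    `[< exists2 k, (k <= r)%N & settled i k true y1 /\
        forall k', (k' < k)%N -> ~ settled i k' false y1 >].
  move=> sy; apply: asbool_equiv_eq; split=> [[k [h h']]|[k _ h]]; last by exists k.
  have [kr|rk] := leqP k r; first by exists k.
  exists r => //; split; last by move=> k' k'r; apply: h'; exact: ltn_trans k'r rk.
  by case: sy => // sy; case: (h' r rk sy).
move=> sy y' yy'.
have sE k b : (k <= r)%N -> settled i k b y <-> settled i k b y'.
  move=> kr; split; apply: settled_agree => v /(edge_ball_mono kr) vr.
    exact: yy'.
  exact/esym/yy'.
rewrite !H//; last by case: sy => /sE h; [left|right]; apply: h.
apply: asbool_equiv_eq; split=> -[k kr [h h']]; exists k => //.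
  split; first exact/(sE _ _ kr).
  by move=> k' k'k; rewrite sE; [exact: h'|exact: ltnW (leq_trans k'k kr)].
split; first exact/(sE _ _ kr).
by move=> k' k'k; rewrite -sE; [exact: h'|exact: ltnW (leq_trans k'k kr)].
Qed.

Lemma settled_by_coding i r y :
  (forall y', agree (c := fconf (vindex e) S) (gball e (base (i := eindex e) i) r) y y' ->
     phi y' i = phi y i) -> settled_by i r y.
Proof.
move=> h; have s : settled i r (phi y i) y.
  rewrite /settled (_ : [set y' | _] = setT) ?probability_setT//.
  apply/seteqP; split=> y' // _ /=; apply: h => v vB.
  by rewrite /splice asboolT//; apply/gball_edge_ball/vB.
by case: (phi y i) s; [left|right].
Qed.

Lemma settled_by_act (g : aut e) i r y :
  settled_by i r (act_conf g y) <-> settled_by (edge_act g i) r y.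
Proof. by rewrite /settled_by !settled_act. Qed.

Lemma regularize_ae : (forall i, {ae mu, forall y, exists r, settled_by i r y}) ->
  {ae mu, forall y, regularize y = phi y}.
Proof.
move=> hs; have : {ae mu, forall y, forall i, regularize y i = phi y i}.
  apply: ae_all => i.
  have hv : {ae mu, forall y, forall c : nat * bool, settled i c.1 c.2 y -> phi y i = c.2}.
    by apply: ae_all => -[r b]; exact: settled_value.
  apply: filterS2 (hs i) hv => y [r sr] hv'.
  have [pt|pf] := boolP (phi y i).
    apply/asboolP; exists r; split.
      by case: sr => // sr; have := hv' (r, false) sr; rewrite pt.
    by move=> r' _ s'; have := hv' (r', false) s'; rewrite pt.
  apply/asboolP => -[k [sk _]].
  by have := hv' (k, true) sk; rewrite (negbTE pf).
by apply: filterS => y h; apply/funext.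
Qed.

End Regularization.
End IidLaw.

Section RegularizedCoding.
Variables (R : realType) (V : countType) (e : rel V).
Hypotheses (e_sym : symmetric e) (e_irr : irreflexive e).
Hypotheses (e_conn : graph_connected e) (e_lf : locally_finite_graph e).
Hypothesis e_trans : transitive_graph e.
Context d (W : measurableType d) (P : probability W R).
Variable omega : {mfun W >-> pspace (eindex e) bool}.

Definition identity dT (T : measurableType dT) (x : T) : T := x.

Lemma measurable_identity dT (T : measurableType dT) :
  measurable_fun setT (@identity dT T).
Proof. exact: measurable_id. Qed.

HB.instance Definition _ dT (T : measurableType dT) :=
  isMeasurableFun.Build _ _ _ _ (@identity dT T) (@measurable_identity dT T).

(** Outside H i r the value at i is fixed by a ball of radius r.+1. The constants do
not depend on i, as a union bound over many edges requires. *)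
Definition uniformly_coded dS (S : measurableType dS)
    (mu : probability (pspace (vindex e) S) R)
    (phi : fconf (vindex e) S -> pspace (eindex e) bool)
    (H : edge e -> nat -> set (pspace (vindex e) S)) (K c : R) :=
  [/\ forall i r, measurable (H i r),
      forall i r, (mu (H i r) <= (K * expR (- (c * r%:R)))%:E)%E &
      forall i r y, ~ H i r y -> forall y',
        agree (c := fconf (vindex e) S) (gball e (base (i := eindex e) i) r.+1) y y' ->
        phi y' i = phi y i].

Lemma merge_constants (I : eqType) (s : seq I) (p : I -> nat -> \bar R) :
  (forall i, exists K c : R, [/\ 0 < K, 0 < c &
    forall r : nat, (p i r <= (K * expR (- (c * r%:R)))%:E)%E]) ->
  exists K c : R, [/\ 0 < K, 0 < c & forall i, i \in s ->
    forall r : nat, (p i r <= (K * expR (- (c * r%:R)))%:E)%E].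
Proof.
move=> h; elim: s => [|i s [K [c [K0 c0 Kc]]]].
  by exists 1, 1; split=> //.
have [K' [c' [K0' c0' Kc']]] := h i.
exists (K + K'), (Num.min c c'); split; first exact: addr_gt0.
  by rewrite lt_min c0.
have le (x y : R) r : 0 < x -> x <= K + K' -> Num.min c c' <= y ->
    ((x * expR (- (y * r%:R)))%:E <= ((K + K') * expR (- (Num.min c c' * r%:R)))%:E)%E.
  move=> x0 xK cy; rewrite lee_fin ler_pM ?expR_ge0//; first exact: ltW.
  by rewrite ler_expR lerN2 ler_wpM2r.
move=> j; rewrite inE => /orP[/eqP -> r|js r].
  apply: le_trans (Kc' r) (le _ _ _ K0' _ _); first by rewrite lerDr ltW.
  by rewrite ge_min lexx orbT.
apply: le_trans (Kc j js r) (le _ _ _ K0 _ _); first by rewrite lerDl ltW.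
by rewrite ge_min lexx.
Qed.

(** After regularization the event that the coding radius is large is measurable
with respect to the labels, hence equally likely at all edges of one orbit. By
transitivity every orbit contains an edge at a fixed vertex, so that finitely
many constants have to be merged. *)
Lemma regular_coding : ffiid_exp_tails P omega ->
  exists dS (S : measurableType dS) (mu : probability (pspace (vindex e) S) R)
    (phi : fconf (vindex e) S -> pspace (eindex e) bool) H K c,
  [/\ iid mu (@identity _ (pspace (vindex e) S)),
      finitary_factor_map phi P omega mu (@identity _ (pspace (vindex e) S)),
      0 < K, 0 < c & uniformly_coded mu phi H K c].
Proof.
move=> [d1 [W1 [P1 [dS [S [Y [Yiid [phi [[mphi ephi lphi rphi] tphi]]]]]]]]].
have [m mP] := iid_seq Yiid.
pose mu : probability (pspace (vindex e) S) R :=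
  [the probability _ _ of distribution P1 Y].
have muE A : mu A = P1 (Y @^-1` A) by [].
have mu_iid (s : seq V) (B : V -> set S) : uniq s -> (forall v, measurable (B v)) ->
    mu [set y | forall v, v \in s -> B v (y v)] = (\prod_(v <- s) m (B v))%E.
  by move=> us mB; rewrite muE; exact: mP.
pose psi := regularize mu phi.
pose H i r : set (pspace (vindex e) S) := [set y | ~ settled_by mu phi i r y].
have ms i r : mpred (settled_by mu phi i r) by exact: measurable_settled_by.
have mH i r : mpred (fun y => ~ settled_by mu phi i r y) by apply: mpred_not; exact: ms.
have HY i r x : H i r (Y x) -> (r%:R%:E <= coding_radius R phi (Y x) i)%E.
  move=> h; apply: le_ereal_inf_tmp => _ [k kP <-]; rewrite lee_fin ler_nat leqNgt.
  apply/negP => kr; apply: h; apply: settled_by_coding => // y' yy'.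
  apply: kP; apply: agree_mono yy' => v; rewrite /gball/= => h.
  exact: leq_trans h (ltnW kr).
have tailH i : exists K c : R, [/\ 0 < K, 0 < c &
    forall r : nat, (mu (H i r) <= (K * expR (- (c * r%:R)))%:E)%E].
  have [K [c [K0 c0 Kc]]] := tphi i; exists K, c; split=> // r.
  have [A [mA sA PA]] := Kc r%:R (ler0n _ _).
  apply: le_trans PA; rewrite muE; apply: le_measure; rewrite ?inE//.
    exact: (measurable_funPTI Y (mH i r)).
  by move=> x /HY; exact: sA.
have actH (g : aut e) i r : mu (H (edge_act g i) r) = mu (H i r).
  rewrite -(act_conf_law mu_iid g (mH i r)); congr (mu _).
  have E y := settled_by_act e_conn mu_iid mphi ephi g i r y.
  by apply/seteqP; split=> y h /E.
have [K [c [K0 c0 Kc]]] : exists K c : R, [/\ 0 < K, 0 < c &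
    forall i (r : nat), (mu (H i r) <= (K * expR (- (c * r%:R)))%:E)%E].
  have [[z _]|nV] := pselect (exists z : V, True); last first.
    exists 1, 1; split=> // i; exfalso; apply: nV.
    by have [x _] := edge_nonempty i; exists x.
  have [K [c [K0 c0 Kc]]] :=
    merge_constants (near_edges e z 1) (p := fun i r => mu (H i r)) tailH.
  exists K, c; split=> // i r.
  have /asboolP[x [y [exy iE]]] := valP i.
  have [g gz] := e_trans z x; have [h gK hK] := aut_bij g.
  have ezh : e z (h y) by rewrite -(aut_adj g) gz hK.
  have iP : is_edge e [fset z; h y]%fset by apply/asboolP; exists z, (h y).
  pose i0 : edge e := exist (fun A : {fset V} => is_edge e A) _ iP.
  have -> : i = edge_act g i0.
    by apply: val_inj; rewrite iE /= imfset_fset2 gz hK.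
  rewrite actH; apply: Kc; apply: mem_near_edges => // v /=.
  rewrite !inE => /orP[] /eqP ->; rewrite /gball/= ?gdistxx//.
  exact: gdist_adj.
have read i r y : ~ H i r y -> forall y',
    agree (c := fconf (vindex e) S) (gball e (base (i := eindex e) i) r.+1) y y' ->
    psi y' i = psi y i.
  move=> /contrapT sy y' yy'; apply: (regularize_read sy) => v vB.
  by apply: yy' => w /= ->; exact: edge_ball_gball.
have sett i : {ae mu, forall y, exists r, settled_by mu phi i r y}.
  have mex : mpred (fun y => exists r, settled_by mu phi i r y).
    by apply: mpred_ex => r; exact: ms.
  apply: prob1_ae => //; rewrite muE; apply: ae_prob1.
    exact: measurable_funPTI.
  apply: filterS (rphi i) => x /coding_radius_fin[r rP].
  by exists r; exact: settled_by_coding.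
have psi_phi : {ae mu, forall y, psi y = phi y}.
  exact: (regularize_ae mu_iid mphi sett).
exists _, S, mu, psi, H, K, c; split=> //.
split.
  + exact: measurable_regularize.
  + exact: (regularize_equivariant e_conn mu_iid mphi ephi).
  + move=> A mA; rewrite -(lphi A mA) -[RHS]/(mu (phi @^-1` A)).
    apply: ae_prob_eq.
    * have := measurable_regularize mu mphi measurableT mA.
      by rewrite setTI.
    * by have := mphi measurableT A mA; rewrite setTI.
    * by apply: filterS psi_phi => y /= E; rewrite /identity /= -/psi E.
  + move=> i; apply: filterS (sett i) => y [r sy].
    apply: (@le_lt_trans _ _ r.+1%:R%:E); last exact: ltry.
    by apply: coding_radius_le => y'; apply: read; apply.
Qed.

End RegularizedCoding.

(** * Exponential tails *)

Section Analytic.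
Variable R : realType.

Lemma exp_outweighs (c : R) (N : nat) : 0 < c ->
  exists B0, forall B, (B0 <= B)%N -> N%:R * expR (- (c * B%:R)) <= 2^-1 :> R.
Proof.
move=> c0; pose x : R := 2 * N%:R / c.
exists (Num.truncn x).+1 => B hB.
have xB : x <= B%:R.
  by apply: le_trans (ltW (truncnS_gt x)) _; rewrite ler_nat.
have h : 2 * N%:R <= expR (c * B%:R).
  apply: le_trans (_ : c * B%:R <= _); last first.
    by apply: le_trans (expR_ge1Dx _); rewrite lerDr.
  by rewrite [leRHS]mulrC -ler_pdivrMr.
rewrite expRN ler_pdivrMr ?expR_gt0//.
by rewrite mulrC ler_pdivlMr// mulrC.
Qed.

Lemma einf_geP (A : set nat) (x : \bar R) :
  (x <= einf R A)%E <-> forall n, A n -> (x <= n%:R%:E)%E.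
Proof.
split=> [h n An|h].
  by apply: le_trans h _; apply: ereal_inf_lbound; exists n.
by apply: le_ereal_inf_tmp => _ [n An <-]; exact: h.
Qed.

Lemma esup_fin (A : set nat) : A !=set0 -> (esup R A < +oo)%E <->
  exists N, forall n, A n -> (n <= N)%N.
Proof.
move=> [n0 An0]; split=> [h|[N AN]].
  have ub n : A n -> (n%:R%:E <= esup R A)%E.
    by move=> An; apply: ereal_sup_ubound; exists n.
  case E : (esup R A) h ub => [x| |]//.
    move=> _ ub; exists (Num.truncn x).+1 => n /ub; rewrite lee_fin => nx.
    by rewrite -(ler_nat R); apply: le_trans nx (ltW (truncnS_gt x)).
  by move=> _ /(_ n0 An0).
apply: (@le_lt_trans _ _ N%:R%:E); last exact: ltry.
by apply: ge_ereal_sup => _ [n An <-]; rewrite lee_fin ler_nat AN.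
Qed.

Lemma esup_geP (A : set nat) m : (0 < m)%N -> A !=set0 -> (esup R A < +oo)%E ->
  (m%:R%:E <= esup R A)%E <-> exists2 n, A n & (m <= n)%N.
Proof.
move=> m0 A0 fin; split=> [h|[n An mn]]; last first.
  apply: (@le_trans _ _ n%:R%:E); first by rewrite lee_fin ler_nat.
  by apply: ereal_sup_ubound; exists n.
apply: contrapT => nex; move: h; apply/negP; rewrite -ltNge.
apply: (@le_lt_trans _ _ m.-1%:R%:E); last by rewrite lte_fin ltr_nat prednK.
apply: ge_ereal_sup => _ [n An <-]; rewrite lee_fin ler_nat -ltnS prednK// ltnNge.
by apply/negP => mn; apply: nex; exists n.
Qed.

Lemma union_bound d (T : measurableType d) (P : probability T R) (I : eqType)
    (s : seq I) (F : I -> set T) (p : R) : 0 <= p ->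
  (forall i, measurable (F i)) -> (forall i, i \in s -> (P (F i) <= p%:E)%E) ->
  measurable [set x | exists2 i, i \in s & F i x] /\
  (P [set x | exists2 i, i \in s & F i x] <= ((size s)%:R * p)%:E)%E.
Proof.
move=> p0 mF; elim: s => [|i s IH] Fp.
  rewrite (_ : [set x | _] = set0).
    by split=> //; rewrite measure0 mul0r.
  by apply/seteqP; split=> x // [].
have [mU PU] := IH (fun j js => Fp j (mem_behead (s := i :: s) js)).
rewrite (_ : [set x | _] = F i `|` [set x | exists2 i, i \in s & F i x]).
  split; first exact: measurableU.
  have PU2 := measureU2 P (mF i) mU; apply: (le_trans PU2).
  rewrite /= -natr1 mulrDl mul1r addrC EFinD; apply: leeD => //.
  by apply: Fp; rewrite mem_head.
apply/seteqP; split=> x.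
  by move=> [j]; rewrite inE => /orP[/eqP ->|js Fj]; [left|right; exists j].
move=> [Fx|[j js Fj]]; first by exists i; rewrite ?mem_head.
by exists j => //; rewrite inE js orbT.
Qed.

Lemma exp_pow (c : R) (k n : nat) : expR (- (c * (k * n)%:R)) = expR (- (c * k%:R)) ^+ n.
Proof. by rewrite -expRM_natl natrM mulrN mulrA [_ * n%:R]mulrC. Qed.

Lemma expR_le_pow (c : R) (n m : nat) : 0 < c -> (n <= m)%N ->
  expR (- (c * m%:R)) <= expR (- c) ^+ n.
Proof.
move=> c0 nm; rewrite -expRM_natl ler_expR mulrN lerN2 [n%:R * _]mulrC.
by apply: ler_wpM2l; [exact: ltW|rewrite ler_nat].
Qed.

(** An exponential tail need only be checked along an arithmetic progression of
radii. *)
Lemma geometric_exp_tails (V : countType) (e : rel V) (C : config_space e)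
    (I : indexing e) dT (T : measurableType dT) (phi : C -> pspace I T)
    d' (W' : measurableType d') (P' : probability W' R) (Y : W' -> C) :
  (forall i, exists (k : nat) (K rho : R), [/\ 0 < K, 0 < rho < 1 &
    forall n, exists A, [/\ measurable A,
      forall x, ~ A x -> (coding_radius R phi (Y x) i <= (k * n.+1)%:R%:E)%E &
      (P' A <= (K * rho ^+ n)%:E)%E]]) ->
  exp_tails phi P' Y.
Proof.
move=> h i; have [k [K [rho [K0 /andP[r0 r1] hA]]]] := h i.
pose k' := k.+1; have k0 : 0 < k'%:R :> R by rewrite ltr0n.
pose c := - ln rho / k'%:R.
have lnr : 0 < - ln rho by rewrite oppr_gt0 ln_lt0// r0.
have c0 : 0 < c by rewrite divr_gt0.
have powE (n : nat) (r : R) : r <= k'%:R * n%:R -> rho ^+ n <= expR (- (c * r)).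
  move=> rn; rewrite -[in leLHS](@lnK _ rho) ?posrE// -expRM_natl ler_expR.
  have E : c * r <= n%:R * - ln rho.
    rewrite /c mulrAC ler_pdivrMr// [n%:R * _]mulrC -mulrA.
    by apply: ler_wpM2l; [exact: ltW|rewrite mulrC].
  by rewrite -[leLHS]opprK lerN2 -mulrN.
exists ((K + 1) * rho ^- 3), c; split=> //.
  by rewrite mulr_gt0 ?invr_gt0 ?exprn_gt0// addr_gt0.
move=> r rge0; pose t := Num.truncn (r / k'%:R).
have rt : r <= k'%:R * t.+1%:R.
  by rewrite mulrC -ler_pdivrMr// ltW// truncnS_gt.
have tr : k'%:R * t%:R <= r.
  by rewrite mulrC -ler_pdivlMr// truncn_le divr_ge0// ltW.
have bound (s n : nat) : (t.+1 <= n + s)%N -> (s <= 3)%N ->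
    rho ^+ n <= rho ^- 3 * expR (- (c * r)).
  move=> tn s3; rewrite [leRHS]mulrC ler_pdivlMr ?exprn_gt0// -exprD.
  apply: powE; apply: le_trans rt _; rewrite ler_wpM2l ?(ltW k0)// ler_nat; lia.
(* radii below three steps are absorbed by the constant rho ^- 3 *)
have [t2|t3] := leqP t 2.
  exists setT; split=> //; rewrite probability_setT lee_fin.
  apply: le_trans (_ : 1 * (rho ^- 3 * expR (- (c * r))) <= _); last first.
    rewrite -mulrA ler_wpM2r//; last by rewrite lerDr ltW.
    by rewrite mulr_ge0 ?expR_ge0// invr_ge0 exprn_ge0// ltW.
  by rewrite mul1r; apply: (bound 3 0%N); lia.
have [A [mA radA PA]] := hA (t - 2)%N.
exists A; split=> //.
  move=> x /= rx; apply: contrapT => nA; have := le_trans rx (radA x nA).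
  rewrite lee_fin; apply/negP; rewrite -ltNge; apply: lt_le_trans tr.
  by rewrite -natrM ltr_nat /k'; nia.
apply: le_trans PA _; rewrite lee_fin.
apply: le_trans (_ : K * (rho ^- 3 * expR (- (c * r))) <= _).
  by rewrite ler_wpM2l ?(ltW K0)//; apply: (bound 3); lia.
rewrite -mulrA ler_wpM2r//; last by rewrite lerDl.
by rewrite mulr_ge0 ?expR_ge0// invr_ge0 exprn_ge0// ltW.
Qed.

End Analytic.

(** * Tails of the percolation clusters *)

Section ClusterTails.
Variables (R : realType) (V : countType) (e : rel V).
Hypotheses (e_sym : symmetric e) (e_irr : irreflexive e).
Hypotheses (e_conn : graph_connected e) (e_lf : locally_finite_graph e).
Context d (W : measurableType d) (P : probability W R).
Variable omega : {mfun W >-> pspace (eindex e) bool}.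

Local Notation rho x := (open_adj (omega x)).
Let m_rho := measurable_rho omega.

(** Failure of local uniqueness of the infinite cluster between two radii. *)
Definition torn (w : pspace (eindex e) bool) u k l :=
  exists z z', [/\ ~ finite_at (open_adj w) z, ~ finite_at (open_adj w) z',
    gball e u k z, gball e u k z' & ~ connected_within w (gball e u l) z z'].

Lemma mpred_connected_within d1 (W1 : measurableType d1)
    (w : W1 -> pspace (eindex e) bool) B u v :
  (forall x y, mpred (fun z => open_adj (w z) x y)) ->
  mpred (fun x => connected_within (w x) B u v).
Proof.
move=> mw; apply: mpred_ex => p; apply: mpred_and3; last exact: mpred_cst.
  exact: mpred_path.
exact: mpred_cst.
Qed.

Lemma mpred_torn d1 (W1 : measurableType d1)
    (w : W1 -> pspace (eindex e) bool) u k l :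
  (forall x y, mpred (fun z => open_adj (w z) x y)) ->
  mpred (fun x => torn (w x) u k l).
Proof.
move=> mw; have mf z : mpred (fun x => ~ finite_at (open_adj (w x)) z).
  by apply: mpred_not; exact: mpred_finite_at.
apply: mpred_ex => z; apply: mpred_ex => z'.
apply: mpred_ext (mpred_and (mpred_and (mf z) (mf z'))
  (mpred_and3 (mpred_cst _ (gball e u k z)) (mpred_cst _ (gball e u k z'))
    (mpred_not (mpred_connected_within (gball e u l) z z' mw)))) => x.
by split=> [[[? ?] [? ? ?]]|[? ? ? ? ?]].
Qed.

Variables c c' a : R.
Hypothesis tails : forall (u : V) (r : nat), (1 <= r)%N ->
  (P [set x | r%:R%:E <= gdiam e R (open_cluster (omega x) u)
              /\ gdiam e R (open_cluster (omega x) u) < +oo]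
   + P [set x | r%:R%:E <= set_gdist e R (open_cluster (omega x) u) (Cinf (omega x))]
   + P [set x | (a * r%:R)%:E <= local_uniq R (omega x) u r]
   <= (c' * expR (- (c * r%:R)))%:E)%E.

Definition span (w : pspace (eindex e) bool) u : set nat :=
  [set n | exists x y, [/\ conn (open_adj w) u x, conn (open_adj w) u y & n = gdist e x y]].

Lemma span0 w u : span w u !=set0.
Proof. by exists (gdist e u u), u, u; split=> //; exact: connxx. Qed.

(** Comparing probabilities of events requires their measurability; for the events
about extended distances it is read off an equivalent form with countable
quantifiers. *)
Lemma diam_eventE u (r : nat) : (0 < r)%N ->
  [set x | r%:R%:E <= gdiam e R (open_cluster (omega x) u)
           /\ gdiam e R (open_cluster (omega x) u) < +oo]%E =
  [set x | (exists2 n, span (omega x) u n & (r <= n)%N) /\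
           exists N, forall n, span (omega x) u n -> (n <= N)%N].
Proof.
move=> r0; apply/seteqP; split=> x /= [h1 h2].
  by split; [apply/(esup_geP r0 (span0 _ _) h2)|apply/(esup_fin R (span0 _ _))].
have fin : (esup R (span (omega x) u) < +oo)%E by apply/(esup_fin R (span0 _ _)).
by split=> //; apply/(esup_geP r0 (span0 _ _) fin).
Qed.

Lemma measurable_diam_event u (r : nat) : (0 < r)%N ->
  measurable [set x | r%:R%:E <= gdiam e R (open_cluster (omega x) u)
           /\ gdiam e R (open_cluster (omega x) u) < +oo]%E.
Proof.
move=> r0; rewrite diam_eventE//.
have ms n : mpred (fun x => span (omega x) u n).
  apply: mpred_ex => y; apply: mpred_ex => z; apply: mpred_and3 (mpred_cst _ _);
    exact: mpred_conn.
apply: mpred_and.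
  by apply: mpred_ex2 => // n; exact: mpred_cst.
apply: mpred_ex => N; apply: mpred_all => n; apply: mpred_imp => //; exact: mpred_cst.
Qed.

Lemma CinfP (w : pspace (eindex e) bool) v : Cinf w v <-> ~ finite_at (open_adj w) v.
Proof. by split=> h /finite_atP; exact: h. Qed.

Lemma gap_eventE u (r : nat) :
  [set x | r%:R%:E <= set_gdist e R (open_cluster (omega x) u) (Cinf (omega x))]%E =
  [set x | forall y z, conn (rho x) u y -> ~ finite_at (rho x) z -> (r <= gdist e y z)%N].
Proof.
apply/seteqP; split=> x /=.
  move=> /einf_geP h y z uy nz.
  have := h (gdist e y z); rewrite lee_fin ler_nat; apply.
  by exists y, z; split=> //; apply/CinfP.
move=> h; apply/einf_geP => _ [y [z [uy /CinfP nz ->]]].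
by rewrite lee_fin ler_nat; exact: h.
Qed.

Lemma measurable_gap_event u (r : nat) :
  measurable [set x | r%:R%:E <=
    set_gdist e R (open_cluster (omega x) u) (Cinf (omega x))]%E.
Proof.
rewrite gap_eventE; apply: mpred_all => y; apply: mpred_all => z.
apply: mpred_imp; first exact: mpred_conn.
apply: mpred_imp; last exact: mpred_cst.
by apply: mpred_not; exact: mpred_finite_at.
Qed.

Lemma measurable_link_event u (r : nat) (t : R) :
  measurable [set x | t%:E <= local_uniq R (omega x) u r]%E.
Proof.
rewrite (_ : [set x | _] = [set x | forall n, ((r <= n)%N /\ forall v v',
   Cinf (omega x) v -> Cinf (omega x) v' -> gball e u r v -> gball e u r v' ->
   connected_within (omega x) (gball e u n) v v') -> (t%:E <= n%:R%:E)%E]); last first.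
  by apply/seteqP; split=> x /einf_geP.
have mC v : mpred (fun x => Cinf (omega x) v).
  apply: mpred_ext (mpred_not (mpred_finite_at m_rho v)) => x.
  by split=> /CinfP.
apply: mpred_all => n; apply: mpred_imp; last exact: mpred_cst.
apply: mpred_and; first exact: mpred_cst.
apply: mpred_all => v; apply: mpred_all => v'.
do 2 apply: mpred_imp (mC _) _; do 2 apply: mpred_imp (mpred_cst _ _) _.
exact: mpred_connected_within.
Qed.

Lemma stretched_tail u m : (0 < m)%N ->
  (P [set x | stretched e (rho x) u m] <= (c' * expR (- (c * m%:R)))%:E)%E.
Proof.
move=> m0; have mD := measurable_diam_event u m0; have mG := measurable_gap_event u m.
apply: le_trans (tails u m0); apply: le_trans (leeDl _ _) => //.
apply: le_trans (measureU2 P mD mG).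
apply: le_measure; rewrite ?inE; [exact: (mpred_stretched e m_rho)|exact: measurableU|].
rewrite diam_eventE// gap_eventE => x [[F hF] [[y [z [uy uz mz]]]|sep]]; last by right.
left; split; first by exists (gdist e y z) => //; exists y, z.
exists (\max_(p <- [seq (y, z) | y <- F, z <- F]) gdist e p.1 p.2)%N.
move=> _ [y' [z' [/hF Fy /hF Fz ->]]].
apply: (@leq_bigmax_seq _ _ xpredT (fun p => gdist e p.1 p.2) (y', z')) => //.
by apply/allpairsP; exists (y', z').
Qed.

Lemma torn_tail u k : (0 < k)%N ->
  (P [set x | torn (omega x) u k ((Num.truncn a).+1 * k)] <=
     (c' * expR (- (c * k%:R)))%:E)%E.
Proof.
move=> k0; apply: le_trans (tails u k0); apply: le_trans (leeDr _ _); last first.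
  by rewrite adde_ge0.
apply: le_measure; rewrite ?inE; [exact: mpred_torn|exact: measurable_link_event|].
move=> x [z [z' [nz nz' uz uz' nc]]] /=; apply/einf_geP => n [kn conn_n].
rewrite lee_fin leNgt; apply/negP => na; apply: nc.
apply: connected_within_mono (conn_n z z' _ _ uz uz'); try by apply/CinfP.
have h : (n <= (Num.truncn a).+1 * k)%N.
  rewrite -(ler_nat R) natrM; apply: le_trans (ltW na) _.
  by rewrite ler_wpM2r// ltW// truncnS_gt.
by move=> y; rewrite /gball/= => /leq_trans; exact.
Qed.

End ClusterTails.

(** * Linear thresholds *)

Section SteepScale.
Variables (R : realType) (V : countType) (e : rel V).
Hypotheses (e_sym : symmetric e) (e_irr : irreflexive e).
Hypotheses (e_conn : graph_connected e) (e_lf : locally_finite_graph e).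

(** Linear thresholds, whose slope is chosen after the tails of the percolation. *)
Definition steep (B j : nat) : nat := (B * j.+1)%N.

Lemma steep_mono B : {homo steep B : i j / (i <= j)%N}.
Proof. by move=> i j ij; rewrite /steep leq_mul2l ltnS ij orbT. Qed.

Lemma steep_big B j : (4 <= B)%N -> (3 * j < steep B j)%N.
Proof. by rewrite /steep; nia. Qed.

Lemma degree_bound : transitive_graph e ->
  exists D, (1 < D)%N /\ forall x, (size (nbrs e x) < D)%N.
Proof.
move=> e_trans; have [[z _]|nV] := pselect (exists z : V, True); last first.
  by exists 2%N; split=> // x; exfalso; apply: nV; exists x.
exists (size (nbrs e z)).+2; split=> // x.
by have [g <-] := e_trans z x; rewrite size_nbrs_aut.
Qed.

Section Tails.
Context d (W : measurableType d) (P : probability W R).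
Variable omega : {mfun W >-> pspace (eindex e) bool}.
Variables (D B : nat) (c c' : R).
Hypothesis deg : forall x, (size (nbrs e x) < D)%N.
Hypotheses (c0 : 0 < c) (c'0 : 0 < c') (B4 : (4 <= B)%N).
Hypothesis heavy : (D ^ 3)%:R * expR (- (c * B%:R)) <= 2^-1 :> R.
Hypothesis st : forall u m, (0 < m)%N ->
  (P [set x | stretched e (open_adj (omega x)) u m] <= (c' * expR (- (c * m%:R)))%:E)%E.

(** The ball of radius 3 * j has at most D ^ (3 * j) vertices, a factor that the
exponential tail at distance B * j outweighs. *)
Lemma wild_tail u j :
  (P [set x | wild omega (steep B) u j x] <= (c' * 2^-1 ^+ j)%:E)%E.
Proof.
have B0 : (0 < steep B j)%N by rewrite /steep; nia.
have p0 : 0 <= c' * expR (- (c * (steep B j)%:R)) by rewrite mulr_ge0 ?expR_ge0 ?ltW.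
have [mU PU] := union_bound (s := ball_seq e u (3 * j)) p0
  (fun y => mpred_stretched e (measurable_rho omega) y (steep B j))
  (fun y _ => st y B0).
rewrite (_ : [set x | _] = [set x | exists2 y, y \in ball_seq e u (3 * j) &
    [set x | stretched e (open_adj (omega x)) y (steep B j)] x]); last first.
  apply/seteqP; split=> x [y]; first by move=> [uy s]; exists y; rewrite ?mem_ball_seq.
  by rewrite mem_ball_seq// => uy s; exists y.
apply: (le_trans PU); rewrite lee_fin mulrCA.
apply: ler_wpM2l; first exact: ltW.
apply: le_trans (_ : (D ^ (3 * j))%:R * expR (- (c * (B * j)%:R)) <= _).
  apply: ler_pM; rewrite ?expR_ge0 ?ler_nat ?size_ball_seq//.
  rewrite ler_expR lerN2; apply: ler_wpM2l; first exact: ltW.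
  by rewrite ler_nat /steep leq_mul2l leqnSn orbT.
rewrite exp_pow expnM natrX -exprMn; apply: lerXn2r => //.
  by rewrite nnegrE mulr_ge0 ?expR_ge0.
by rewrite nnegrE invr_ge0.
Qed.

Lemma half_lt1 : 0 <= (2^-1 : R) < 1.
Proof. by rewrite invr_ge0 ler0n invf_lt1 ?ltr1n ?ltr0n. Qed.

Lemma steep_tame_tail u n :
  (P [set x | ~ tame e (steep B) (open_adj (omega x)) u n] <= (2 * c' * 2^-1 ^+ n)%:E)%E.
Proof.
apply: le_trans (tame_tail (ltW c'0) half_lt1 (fun j _ => wild_tail u j) (leq0n n)) _.
have -> : 1 - 2^-1 = 2^-1 :> R by lra.
by rewrite invrK lee_fin; lra.
Qed.

Lemma steep_good : {ae P, forall x, unique_infinite_cluster (omega x)} ->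
  {ae P, forall x, good (steep B) (omega x)}.
Proof.
move=> one; apply: good_ae => // u.
exact: (tame_ae (ltW c'0) half_lt1 (fun j (_ : (0 <= j)%N) => wild_tail u j)).
Qed.

End Tails.
End SteepScale.

(** * Exponential tails of the gradient *)

(** The radii that enter the certificate of the gradient at scale n are iterated
linear functions of n. *)
Lemma linear_radius A B : exists k, forall n,
  (A * (3 * steep B n).+1 <= k * n.+1)%N /\
  ((chain_radius (steep B) (steep B n)).+1 <= k * n.+1)%N.
Proof.
exists (A * (3 * B).+1 + (5 * B + B * B + B + 2))%N => n; split.
  by rewrite mulnDl; apply: leq_trans (leq_addr _ _); rewrite -mulnA leq_mul2l /steep; nia.
rewrite mulnDl; apply: leq_trans (leq_addl _ _).
by rewrite /chain_radius /reading_radius /steep; nia.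
Qed.

Section CodedTails.
Variables (R : realType) (V : countType) (e : rel V) (q : nat).
Hypotheses (e_sym : symmetric e) (e_irr : irreflexive e).
Hypotheses (e_conn : graph_connected e) (e_lf : locally_finite_graph e).
Context d (W : measurableType d) (P : probability W R).
Variable omega : {mfun W >-> pspace (eindex e) bool}.
Hypothesis omega_one : {ae P, forall x, unique_infinite_cluster (omega x)}.
Variables (D B A : nat) (c c' : R).
Hypothesis deg : forall x, (size (nbrs e x) < D)%N.
Hypotheses (c0 : 0 < c) (c'0 : 0 < c') (B4 : (4 <= B)%N).
Hypothesis heavy : (D ^ 3)%:R * expR (- (c * B%:R)) <= 2^-1 :> R.
Hypothesis st : forall u m, (0 < m)%N ->
  (P [set x | stretched e (open_adj (omega x)) u m] <= (c' * expR (- (c * m%:R)))%:E)%E.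
Hypothesis sep : forall u k, (0 < k)%N ->
  (P [set x | torn (omega x) u k (A * k)] <= (c' * expR (- (c * k%:R)))%:E)%E.

Context dS (S : measurableType dS) (mu : probability (pspace (vindex e) S) R).
Variables (phi : fconf (vindex e) S -> pspace (eindex e) bool).
Variables (H : edge e -> nat -> set (pspace (vindex e) S)) (KH cH : R).
Local Notation labels := (@identity _ (pspace (vindex e) S)).
Hypothesis phi_factor : finitary_factor_map phi P omega mu labels.
Hypotheses (KH0 : 0 < KH) (cH0 : 0 < cH).
Hypothesis phi_coded : uniformly_coded mu phi H KH cH.

Local Notation Y1 := [the {mfun _ >-> _} of labels].
Local Notation f := (steep B).

Definition perc (y : pspace (vindex e) S) : pspace (eindex e) bool := phi y.

Lemma measurable_perc : measurable_fun setT perc.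
Proof. by have [mphi _ _ _] := phi_factor. Qed.

HB.instance Definition _ := isMeasurableFun.Build _ _ _ _ perc measurable_perc.

Lemma coded_law (E : set (pspace (eindex e) bool)) : measurable E ->
  mu (perc @^-1` E) = P (omega @^-1` E).
Proof. by have [_ _ law _] := phi_factor; exact: law. Qed.

Let m_open := @measurable_open_adj V e.

Lemma coded_stretched u m : (0 < m)%N ->
  (mu [set y | stretched e (open_adj (perc y)) u m] <= (c' * expR (- (c * m%:R)))%:E)%E.
Proof.
move=> m0; apply: le_trans (st u m0).
by rewrite -[X in (X <= _)%E]/(mu (perc @^-1` [set w | stretched e (open_adj w) u m]))
  coded_law//; exact: (mpred_stretched e m_open).
Qed.

Lemma coded_torn u k : (0 < k)%N ->
  (mu [set y | torn (perc y) u k (A * k)] <= (c' * expR (- (c * k%:R)))%:E)%E.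
Proof.
move=> k0; apply: le_trans (sep u k0).
rewrite -[X in (X <= _)%E]/(mu (perc @^-1` [set w | torn w u k (A * k)])).
rewrite coded_law//.
exact: (mpred_torn (w := fun w : pspace (eindex e) bool => w) u k (A * k) m_open).
Qed.

(** What may prevent the gradient along (u, v) from being certified and read at
scale m: a line of ancestors that does not arrive, ends that are not joined
nearby, or an edge whose state needs labels from further away. *)
Definition undecided u v m r1 r2 : set (pspace (vindex e) S) :=
  [set y | ~ tame e f (open_adj (perc y)) u m] `|`
  [set y | ~ tame e f (open_adj (perc y)) v m] `|`
  [set y | torn (perc y) u (3 * f m).+1 (A * (3 * f m).+1)] `|`
  [set y | exists2 b, b \in near_edges e u r1 & H b r2 y].

Variables k1 k2 : nat.
Hypothesis k1_large : forall n, (A * (3 * f n).+1 <= k1 * n.+1)%N /\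
  ((chain_radius f (f n)).+1 <= k1 * n.+1)%N.
Hypothesis heavyH : (D ^ (2 * k1))%:R * expR (- (cH * k2%:R)) <= 2^-1 :> R.

Local Notation rho := (Num.max 2^-1 (expR (- c)) : R).

Lemma undecided_tail u v m : let E := undecided u v m (k1 * m.+1) (k2 * m.+1) in
  measurable E /\ (mu E <= ((5 * c' + KH) * rho ^+ m)%:E)%E.
Proof.
have [mH HP _] := phi_coded.
have m_perc x y : mpred (fun z => open_adj (perc z) x y) by exact: (measurable_rho perc).
have mt w : mpred (fun y => ~ tame e f (open_adj (perc y)) w m).
  by apply: mpred_not; exact: (mpred_tame e f m_perc).
have ms : mpred (fun y => torn (perc y) u (3 * f m).+1 (A * (3 * f m).+1)).
  exact: mpred_torn.
have p0 : 0 <= KH * expR (- (cH * (k2 * m.+1)%:R)) by rewrite mulr_ge0 ?expR_ge0// ltW.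
have [mU PU] := union_bound (s := near_edges e u (k1 * m.+1)) p0
  (fun b => mH b (k2 * m.+1)%N) (fun b _ => HP b (k2 * m.+1)%N).
have mtt := measurableU _ _ (mt u) (mt v); have mts := measurableU _ _ mtt ms.
split; first exact: (measurableU _ _ mts mU).
have half_rho : 2^-1 ^+ m <= rho ^+ m.
  by apply: lerXn2r; rewrite ?nnegrE ?le_max ?lexx ?invr_ge0 ?ler0n.
have c_rho : expR (- c) ^+ m <= rho ^+ m.
  by apply: lerXn2r; rewrite ?nnegrE ?le_max ?lexx ?expR_ge0 ?orbT.
have tame_rho w : (mu [set y | ~ tame e f (open_adj (perc y)) w m] <=
    (2 * c' * rho ^+ m)%:E)%E.
  apply: le_trans (steep_tame_tail e_conn e_lf deg c0 c'0 B4 heavy coded_stretched w m) _.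
  by rewrite lee_fin; apply: ler_wpM2l => //; rewrite mulr_ge0// ltW.
have torn_rho : (mu [set y | torn (perc y) u (3 * f m).+1 (A * (3 * f m).+1)] <=
    (c' * rho ^+ m)%:E)%E.
  apply: le_trans (coded_torn u (ltn0Sn _)) _; rewrite lee_fin.
  apply: ler_wpM2l; first exact: ltW.
  apply: le_trans c_rho; apply: expR_le_pow => //; rewrite /steep; nia.
have read_rho : (mu [set y | exists2 b, b \in near_edges e u (k1 * m.+1) &
    H b (k2 * m.+1) y] <= (KH * rho ^+ m)%:E)%E.
  apply: (le_trans PU); rewrite lee_fin mulrCA; apply: ler_wpM2l; first exact: ltW.
  apply: le_trans half_rho.
  apply: le_trans (_ : ((D ^ (2 * k1))%:R * expR (- (cH * k2%:R))) ^+ m.+1 <= _).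
    rewrite exprMn -exp_pow -natrX -expnM -mulnA; apply: ler_wpM2r; first exact: expR_ge0.
    by rewrite ler_nat; exact: size_near_edges.
  apply: le_trans (_ : 2^-1 ^+ m.+1 <= _).
    by apply: lerXn2r; rewrite // nnegrE ?invr_ge0 ?ler0n ?mulr_ge0 ?expR_ge0.
  rewrite exprS ler_piMl ?exprn_ge0 ?invr_ge0 ?ler0n// invf_le1 ?ler1n ?ltr0n//.
have add3 (E F : set (pspace (vindex e) S)) (x y : R) : measurable E -> measurable F ->
    (mu E <= x%:E -> mu F <= y%:E -> mu (E `|` F) <= (x + y)%:E)%E.
  move=> mE mF Ex Fy; have EF := measureU2 mu mE mF.
  by apply: (le_trans EF); rewrite EFinD leeD.
have -> : (5 * c' + KH) * rho ^+ m = 2 * c' * rho ^+ m + 2 * c' * rho ^+ m +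
    c' * rho ^+ m + KH * rho ^+ m by ring.
apply: (add3 _ _ _ _ mts mU _ read_rho).
apply: (add3 _ _ _ _ mtt ms _ torn_rho).
exact: (add3 _ _ _ _ (mt u) (mt v)).
Qed.

Hypothesis q_gt1 : (1 < q)%N.

Lemma undecided_radius (a : oedge e) m (z : pspace (vindex e) S * pspace nat 'Z_q) :
  (0 < m)%N -> labels_distinct (label_field z.2 : V -> _) ->
  (exists x, ~ finite_at (open_adj (perc z.1)) x) ->
  ~ undecided (val a).1 (val a).2 m (k1 * m.+1) (k2 * m.+1) z.1 ->
  (coding_radius R (compose_gradient (q := q) f phi) (joint_labels Y1 z) a <=
     (k1 * m.+1 + (k2 * m.+1).+1)%:R%:E)%E.
Proof.
move=> m0 lz infz nU; have [_ _ read] := phi_coded; have [k1a k1b] := k1_large m.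
have tm w : ~ ~ tame e f (open_adj (perc z.1)) w m -> tame e f (open_adj (perc z.1)) w m.
  exact: contrapT.
apply: coding_radius_le => y'; apply: (compose_read e_conn q_gt1).
- move=> yy yy1.
  apply: (gradient_read e_sym e_irr e_conn e_lf (@steep_mono B)
    (fun j => steep_big j B4) m0 lz infz _ _ _ k1a k1b yy1).
  + by apply: tm => h; apply: nU; left; left; left.
  + by apply: tm => h; apply: nU; left; left; right.
  + move=> x x' nx nx' ux ux'; apply: contrapT => nc; apply: nU; left; right.
    by exists x, x'.
- move=> b bB yy yy1; apply: (read b (k2 * m.+1)%N) yy1.
  by move=> h; apply: nU; right; exists b => //; exact: mem_near_edges.
Qed.

Lemma coded_exp_tails :
  exp_tails (compose_gradient (q := q) f phi) (mu \x digit_law R (q := q))%E (joint_labels Y1).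
Proof.
apply: geometric_exp_tails => a.
exists (2 * (k1 + k2) + 1)%N, (5 * c' + KH), rho; split.
- by rewrite addr_gt0// mulr_gt0.
- rewrite lt_max invr_gt0 ltr0n/= gt_max invf_lt1 ?ltr1n ?ltr0n//=.
  by rewrite -expR0 ltr_expR oppr_lt0.
have inf : {ae mu, forall y, exists x, ~ finite_at (open_adj (perc y)) x}.
  have lawC : same_law mu [the {mfun _ >-> _} of perc] P omega by exact: coded_law.
  have minf : mpred (fun w : pspace (eindex e) bool => exists x, ~ finite_at (open_adj w) x).
    by apply: mpred_ex => x; apply: mpred_not; exact: (mpred_finite_at m_open).
  apply: (same_law_ae lawC minf).
  by apply: filterS omega_one => x /unique_infinite_clusterP[].
have [N [mN PN sN]] := filterI (ae_fst q inf) (ae_snd _ (labels_distinct_ae R V q)).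
(* scale n.+1, because [chain_reaches] starts from a positive scale *)
move=> n; pose E := undecided (val a).1 (val a).2 n.+1 (k1 * n.+2) (k2 * n.+2).
have [mE PE] := undecided_tail (val a).1 (val a).2 n.+1.
exists (N `|` E `*` setT); split.
- by apply: measurableU => //; exact: measurableX.
- move=> z nz; have [infz lz] : (exists x, ~ finite_at (open_adj (perc z.1)) x) /\
      labels_distinct (label_field z.2 : V -> _).
    by apply: contrapT => h; apply: nz; left; exact: sN.
  have nE : ~ E z.1 by move=> h; apply: nz; right; split.
  apply: le_trans (undecided_radius (ltn0Sn n) lz infz nE) _.
  by rewrite lee_fin ler_nat; nia.
have mEX : measurable (E `*` [set: pspace nat 'Z_q]) by exact: measurableX.
have NE := measureU2 (mu \x digit_law R (q := q))%E mN mEX.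
have EX : ((mu \x digit_law R (q := q)) (E `*` setT) = mu E)%E.
  by rewrite product_measure1E// [X in (_ * X)%E]probability_setT mule1.
apply: (le_trans NE); rewrite [X in (X + _)%E]PN add0e [leLHS]EX.
apply: le_trans PE _; rewrite lee_fin exprS mulrCA ler_piMl//.
  by rewrite mulr_ge0 ?exprn_ge0 ?le_max ?invr_ge0 ?ler0n// ltW// addr_gt0// mulr_gt0.
rewrite ge_max invf_le1 ?ler1n ?ltr0n//=.
by rewrite -expR0 ler_expR oppr_le0 ltW.
Qed.

End CodedTails.

Theorem theorem2p2 (R : realType) (V : countType) (e : rel V)
    (e_sym : symmetric e) (e_irr : irreflexive e)
    (e_conn : graph_connected e) (e_lf : locally_finite_graph e)
    (e_trans : transitive_graph e)
    (d : measure_display) (W : measurableType d) (P : probability W R)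
    (omega : {RV P >-> pspace (eindex e) bool})
    (omega_inv : aut_invariant (C := fconf (eindex e) bool) P omega)
    (omega_uniq : {ae P, forall x, unique_infinite_cluster (omega x)})
    (q : nat) (q_ge2 : (2 <= q)%N)
    (sigma : {RV P >-> spins e q})
    (sigma_law : spins_given_percolation P omega sigma) :
  [/\ exists d' (W' : measurableType d') (P' : probability W' R)
             dS (S : measurableType dS)
             (omega' : {RV P' >-> pspace (eindex e) bool})
             (xi : {RV P' >-> pspace (vindex e) S}),
        [/\ same_law P' omega' P omega,
            iid P' xi,
            independent P' omega' xi &
            finitary_factor
              (C := pair_conf (fconf (eindex e) bool) (fconf (vindex e) S))
              P (@gradient V e q \o sigma)
              P' (fun x => (omega' x, xi x))],
      ffiid P omega -> ffiid P (@gradient V e q \o sigma) &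
      ffiid_exp_tails P omega ->
      (exists c c' a : R, [/\ 0 < c, 0 < c', 0 < a &
         forall (u : V) (r : nat), (1 <= r)%N ->
           (P [set x | r%:R%:E <= gdiam e R (open_cluster (omega x) u)
                       /\ gdiam e R (open_cluster (omega x) u) < +oo]
            + P [set x | r%:R%:E <=
                         set_gdist e R (open_cluster (omega x) u) (Cinf (omega x))]
            + P [set x | (a * r%:R)%:E <= local_uniq R (omega x) u r]
            <= (c' * expR (- (c * r%:R)))%:E)%E]) ->
      ffiid_exp_tails P (@gradient V e q \o sigma)].
Proof.
have [f [f_mono f_big f_good]] := exists_scale e_conn e_lf omega_uniq.
split.
- exact: (gradient_finitary_factor e_sym e_irr e_conn e_lf f_mono f_big q_ge2 f_good sigma_law).
- move=> [d1 [W1 [P1 [dS [S [Y [Yiid [phi phi_factor]]]]]]]].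
  eexists _, _, [the probability _ _ of (P1 \x digit_law R (q := q))%E], _, _.
  exists [the {mfun _ >-> _} of joint_labels Y]; split; first exact: joint_labels_iid.
  exists (compose_gradient f phi).
  exact: (composition_factor e_sym e_irr e_conn e_lf f_mono f_big q_ge2 f_good
    sigma_law phi_factor).
move=> exp_omega [c [c' [a [c0 c'0 a0 tails]]]].
have [dS [S [mu [phi [H [KH [cH [mu_iid phi_factor KH0 cH0 phi_coded]]]]]]]] :=
  regular_coding e_sym e_conn e_lf e_trans exp_omega.
have [D [D1 deg]] := degree_bound e_lf e_trans.
have [B0 heavy] := exp_outweighs (D ^ 3) c0.
pose B := maxn 4 B0.
have {}heavy := heavy B (leq_maxr _ _).
have B4 : (4 <= B)%N by exact: leq_maxl.
have [k1 k1_large] := linear_radius (Num.truncn a).+1 B.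
have [k2 heavyH] := exp_outweighs (D ^ (2 * k1)) cH0.
have st u m := stretched_tail tails u (m := m).
have sep u k := torn_tail tails u (k := k).
have B_good : {ae P, forall x, good (steep B) (omega x)}.
  exact: (steep_good e_conn e_lf deg c0 c'0 B4 heavy st).
eexists _, _, [the probability _ _ of (mu \x digit_law R (q := q))%E], _, _.
exists [the {mfun _ >-> _} of joint_labels
  [the {mfun _ >-> _} of @identity _ (pspace (vindex e) S)]].
split; first exact: joint_labels_iid.
exists (compose_gradient (steep B) phi); split.
  exact: (composition_factor e_sym e_irr e_conn e_lf (@steep_mono B)
    (fun j => steep_big j B4) q_ge2 B_good sigma_law phi_factor).
exact: (coded_exp_tails e_sym e_irr e_conn e_lf omega_uniq deg c0 c'0 B4 heavy st sep
  phi_factor KH0 cH0 phi_coded k1_large (heavyH k2 (leqnn _)) q_ge2).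
Qed.
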